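(* 1. There exists a graded set $\mathcal{D}_o$ such that $(\mathbf{H}_o)_+$ is isomorphic to $(\mathbf{H}_p^{\mathcal{D}_o})_+$ as graded $Dup$-$Dend$ bialgebras. 2. There exists a graded set $\mathcal{D}_{ho}$ such that $(\mathbf{H}_{ho})_+$ is isomorphic to $(\mathbf{H}_p^{\mathcal{D}_{ho}})_+$ as graded $Dup$-$Dend$ bialgebras.
   Context: $K$ is a commutative field; all vector spaces are over $K$. **$Dup$-$Dend$ bialgebras.** A duplicial algebra is a vector space $A$ with two bilinear products $.$ (written $xy$) and $\nwarrow$ such that for all $x,y,z\in A$: $(xy)z=x(yz)$, $(x\nwarrow y)\nwarrow z=x\nwarrow(y\nwarrow z)$, $(xy)\nwarrow z=x(y\nwarrow z)$. A dendriform coalgebra is a vector space $A$ with two maps $\tilde\Delta_\prec,\tilde\Delta_\succ:A\to A\otimes A$ such that, with $\tilde\Delta=\tilde\Delta_\prec+\tilde\Delta_\succ$: $$(\tilde\Delta_\prec\otimes Id)\tilde\Delta_\prec=(Id\otimes\tilde\Delta)\tilde\Delta_\prec,\quad (\tilde\Delta_\succ\otimes Id)\tilde\Delta_\prec=(Id\otimes\tilde\Delta_\prec)\tilde\Delta_\succ,\quad (\tilde\Delta\otimes Id)\tilde\Delta_\succ=(Id\otimes\tilde\Delta_\succ)\tilde\Delta_\succ.$$ Sweedler notation: $\tilde\Delta(a)=a'\otimes a''$, $\tilde\Delta_\prec(a)=a'_\prec\otimes a''_\prec$, $\tilde\Delta_\succ(a)=a'_\succ\otimes a''_\succ$. A $Dup$-$Dend$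 bialgebra is a family $(A,.,\nwarrow,\tilde\Delta_\prec,\tilde\Delta_\succ)$ such that $(A,.,\nwarrow)$ is a duplicial algebra, $(A,\tilde\Delta_\prec,\tilde\Delta_\succ)$ is a dendriform coalgebra, and for all $x,y\in A$: $$\tilde\Delta_\prec(xy)=y\otimes x+x'y\otimes x''+xy'_\prec\otimes y''_\prec+y'_\prec\otimes xy''_\prec+x'y'_\prec\otimes x''y''_\prec,$$ $$\tilde\Delta_\succ(xy)=x\otimes y+x'\otimes x''y+xy'_\succ\otimes y''_\succ+y'_\succ\otimes xy''_\succ+x'y'_\succ\otimes x''y''_\succ,$$ $$\tilde\Delta_\prec(x\nwarrow y)=y\otimes x+y'_\prec\otimes x\nwarrow y''_\prec+x'_\prec\nwarrow y\otimes x''_\prec+x'_\succ y\otimes x''_\succ+x'_\succ y'_\prec\otimes x''_\succ\nwarrow y''_\prec,$$ $$\tilde\Delta_\succ(x\nwarrow y)=y'_\succ\otimes x\nwarrow y''_\succ+x'_\succ\otimes x''_\succ\nwarrow y+x'_\succ y'_\succ\otimes x''_\succ\nwarrow y''_\succ.$$ It is graded if $A=\bigoplus_{n\ge0}A_n$ and all four structure maps are homogeneous of degree $0$. Isomorphisms of graded $Dup$-$Dend$ bialgebras are linear bijections, homogeneous of degree $0$, compatible with all four structure maps. **Forests and cuts.** A rooted forest is a finite graph whose connected components are rooted trees; $V(F)$ is the vertex set of $F$. Edges are oriented from leaves to roots, $w\to v$ means there is an edge from $w$ to $v$, and $v\twoheadrightarrow w$ means there is an oriented path from $v$ to $w$ (with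 $v\twoheadrightarrow v$). A subset $\boldsymbol v\subseteq V(F)$ is an admissible cut if there are no two distinct $v,w\in\boldsymbol v$ with $v\twoheadrightarrow w$; $Lea_{\boldsymbol v}F$ is the sub-forest on $\{w:\exists v\in\boldsymbol v,\ w\twoheadrightarrow v\}$ and $Roo_{\boldsymbol v}F$ the sub-forest on the other vertices. We write $\boldsymbol v\mid\models V(F)$ if moreover $Lea_{\boldsymbol v}F$ and $Roo_{\boldsymbol v}F$ are both non-empty. **$(\mathbf{H}_o)_+$, $(\mathbf{H}_{ho})_+$.** An ordered forest is a rooted forest with a total order on its vertices (up to isomorphism). $(\mathbf{H}_o)_+$ has basis the non-empty ordered forests, graded by the number of vertices. $FG$ is the disjoint union, and $F\nwarrow G$ is obtained by grafting $G$ on the greatest vertex of $F$; in both cases the orders of $F$ and $G$ are kept and all vertices of $F$ are smaller than all vertices of $G$. With $g_F$ the greatest vertex of $F$, $\tilde\Delta_\prec(F)$ (resp. $\tilde\Delta_\succ(F)$) is the sum of $Lea_{\boldsymbol v}F\otimes Roo_{\boldsymbol v}F$ over $\boldsymbol v\mid\models V(F)$ with $g_F\in V(Lea_{\boldsymbol v}F)$ (resp. $g_F\in V(Roo_{\boldsymbol v}F)$). An ordered forest is heap-ordered if $i\twoheadrightarrow j$ with $i\neq j$ implies $i>j$; $(\mathbf{H}_{ho})_+$ is the subspace of $(\mathbf{H}_o)_+$ spanned by non-empty heap-ordered forests, with the restricted operations. **$(\mathbf{H}_p^{\mathcal{D}})_+$.** A planar forest is a rooted forest with a total order (from left to right) on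 its roots and, for each vertex $v$, on $\{w:w\to v\}$. For a graded set $\mathcal{D}=\bigsqcup_n\mathcal{D}(n)$, $(\mathbf{H}_p^{\mathcal{D}})_+$ has basis the non-empty planar forests with vertices decorated by elements of $\mathcal{D}$, the degree being the sum of the degrees of the decorations. $FG$ is concatenation; $F\nwarrow G$ is obtained by grafting $G$ on the rightmost leaf of $F$; with $r_F$ the rightmost leaf of $F$, $\tilde\Delta_\prec(F)$ (resp. $\tilde\Delta_\succ(F)$) is the sum of $Lea_{\boldsymbol v}F\otimes Roo_{\boldsymbol v}F$ over $\boldsymbol v\mid\models V(F)$ with $r_F\in Lea_{\boldsymbol v}F$ (resp. $r_F\in Roo_{\boldsymbol v}F$). *)

(* Defs.v *)
From HB Require Import structures.
From mathcomp Require Import all_boot all_order all_algebra.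
From mathcomp Require Import finmap.
From mathcomp.multinomials Require Import monalg.

Set Implicit Arguments.
Unset Strict Implicit.
Unset Printing Implicit Defensive.

Import GRing.Theory.
Local Open Scope ring_scope.

(* The vector space with basis B is {malg K[B]}.  The tensor product of
  {malg K[B]} and {malg K[C]} is {malg K[B * C]}, in which the pure tensor of
  the basis vectors b and c is the basis vector (b, c). *)

Section FreeModules.

Variable K : fieldType.

Definition vect (B : choiceType) (b : B) : {malg K[B]} := mkmalgU b 1.

Definition linext (B : choiceType) (M : lmodType K) (f : B -> M)
    (x : {malg K[B]}) : M :=
  \sum_(b <- msupp x) x@_b *: f b.

Definition bilinext (B C : choiceType) (M : lmodType K) (f : B -> C -> M)
    (x : {malg K[B]}) (y : {malg K[C]}) : M :=
  linext (fun b => linext (f b) y) x.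

Definition tens (B C : choiceType) :
    {malg K[B]} -> {malg K[C]} -> {malg K[(B * C)%type]} :=
  bilinext (fun b c => vect (b, c)).

(* The linear map on the tensor product induced by f, which has to be bilinear;
   for t written t' (x) t'' in Sweedler's notation, this is f(t', t''). *)
Definition sweedler (B C : choiceType) (M : lmodType K)
    (f : {malg K[B]} -> {malg K[C]} -> M) : {malg K[(B * C)%type]} -> M :=
  linext (fun p => f (vect p.1) (vect p.2)).

Definition homog (B : choiceType) (deg : B -> nat) (n : nat)
    (x : {malg K[B]}) : Prop :=
  forall b, b \in msupp x -> deg b = n.

End FreeModules.

Notation "x ⊗ y" := (tens x y) (at level 45, no associativity).
Notation "\swd_ ( x , y <- t ) E" := (sweedler (fun x y => E) t)
  (at level 46, x name, y name, t at level 50, E at level 46,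
   format "\swd_ ( x ,  y  <-  t )  E").

(* Two bilinear products and two linear coproducts on a graded vector space
   with a given homogeneous basis, described by their values on the basis. *)
Record ddData (K : fieldType) := DDData {
  dd_basis : choiceType;
  dd_deg : dd_basis -> nat;
  dd_mul0 : dd_basis -> dd_basis -> {malg K[dd_basis]};
  dd_graft0 : dd_basis -> dd_basis -> {malg K[dd_basis]};
  dd_prec0 : dd_basis -> {malg K[(dd_basis * dd_basis)%type]};
  dd_succ0 : dd_basis -> {malg K[(dd_basis * dd_basis)%type]}
}.

Definition dd_space (K : fieldType) (A : ddData K) : lmodType K :=
  {malg K[dd_basis A]}.
Definition dd_space2 (K : fieldType) (A : ddData K) : lmodType K :=
  {malg K[(dd_basis A * dd_basis A)%type]}.

Definition dd_deg2 (K : fieldType) (A : ddData K)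
    (p : dd_basis A * dd_basis A) : nat := (dd_deg p.1 + dd_deg p.2)%N.

Definition dd_mul (K : fieldType) (A : ddData K) :
  dd_space A -> dd_space A -> dd_space A := bilinext (@dd_mul0 K A).
Definition dd_graft (K : fieldType) (A : ddData K) :
  dd_space A -> dd_space A -> dd_space A := bilinext (@dd_graft0 K A).
Definition dd_prec (K : fieldType) (A : ddData K) :
  dd_space A -> dd_space2 A := linext (@dd_prec0 K A).
Definition dd_succ (K : fieldType) (A : ddData K) :
  dd_space A -> dd_space2 A := linext (@dd_succ0 K A).
Definition dd_cop (K : fieldType) (A : ddData K) (x : dd_space A) :
  dd_space2 A := dd_prec x + dd_succ x.

Section Bialgebra.

Variables (K : fieldType) (A : ddData K).

Local Notation "x ∙ y" := (@dd_mul K A x y) (at level 40, left associativity).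
Local Notation "x ↖ y" := (@dd_graft K A x y)
  (at level 40, left associativity).
Local Notation Dp := (@dd_prec K A).
Local Notation Ds := (@dd_succ K A).
Local Notation D := (@dd_cop K A).

Definition duplicial_algebra : Prop :=
  [/\ forall x y z : dd_space A, (x ∙ y) ∙ z = x ∙ (y ∙ z),
      forall x y z : dd_space A, (x ↖ y) ↖ z = x ↖ (y ↖ z)
    & forall x y z : dd_space A, (x ∙ y) ↖ z = x ∙ (y ↖ z)].

Definition dendriform_coalgebra : Prop :=
  [/\ forall a : dd_space A,
        \swd_(x, y <- Dp a) \swd_(x1, x2 <- Dp x) ((x1 ⊗ x2) ⊗ y)
        = \swd_(x, y <- Dp a) \swd_(y1, y2 <- D y) ((x ⊗ y1) ⊗ y2),
      forall a : dd_space A,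
        \swd_(x, y <- Dp a) \swd_(x1, x2 <- Ds x) ((x1 ⊗ x2) ⊗ y)
        = \swd_(x, y <- Ds a) \swd_(y1, y2 <- Dp y) ((x ⊗ y1) ⊗ y2)
    & forall a : dd_space A,
        \swd_(x, y <- Ds a) \swd_(x1, x2 <- D x) ((x1 ⊗ x2) ⊗ y)
        = \swd_(x, y <- Ds a) \swd_(y1, y2 <- Ds y) ((x ⊗ y1) ⊗ y2)].

Definition dupdend_compat : Prop :=
  [/\ forall x y : dd_space A,
        Dp (x ∙ y)
        = y ⊗ x
          + \swd_(x1, x2 <- D x) ((x1 ∙ y) ⊗ x2)
          + \swd_(y1, y2 <- Dp y) ((x ∙ y1) ⊗ y2)
          + \swd_(y1, y2 <- Dp y) (y1 ⊗ (x ∙ y2))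
          + \swd_(x1, x2 <- D x) \swd_(y1, y2 <- Dp y)
              ((x1 ∙ y1) ⊗ (x2 ∙ y2)),
      forall x y : dd_space A,
        Ds (x ∙ y)
        = x ⊗ y
          + \swd_(x1, x2 <- D x) (x1 ⊗ (x2 ∙ y))
          + \swd_(y1, y2 <- Ds y) ((x ∙ y1) ⊗ y2)
          + \swd_(y1, y2 <- Ds y) (y1 ⊗ (x ∙ y2))
          + \swd_(x1, x2 <- D x) \swd_(y1, y2 <- Ds y)
              ((x1 ∙ y1) ⊗ (x2 ∙ y2)),
      forall x y : dd_space A,
        Dp (x ↖ y)
        = y ⊗ x
          + \swd_(y1, y2 <- Dp y) (y1 ⊗ (x ↖ y2))
          + \swd_(x1, x2 <- Dp x) ((x1 ↖ y) ⊗ x2)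
          + \swd_(x1, x2 <- Ds x) ((x1 ∙ y) ⊗ x2)
          + \swd_(x1, x2 <- Ds x) \swd_(y1, y2 <- Dp y)
              ((x1 ∙ y1) ⊗ (x2 ↖ y2))
    & forall x y : dd_space A,
        Ds (x ↖ y)
        = \swd_(y1, y2 <- Ds y) (y1 ⊗ (x ↖ y2))
          + \swd_(x1, x2 <- Ds x) (x1 ⊗ (x2 ↖ y))
          + \swd_(x1, x2 <- Ds x) \swd_(y1, y2 <- Ds y)
              ((x1 ∙ y1) ⊗ (x2 ↖ y2))].

Definition homogeneous_maps : Prop :=
  [/\ forall m n (x y : dd_space A),
        homog (@dd_deg K A) m x -> homog (@dd_deg K A) n y ->
        homog (@dd_deg K A) (m + n) (x ∙ y),
      forall m n (x y : dd_space A),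
        homog (@dd_deg K A) m x -> homog (@dd_deg K A) n y ->
        homog (@dd_deg K A) (m + n) (x ↖ y),
      forall n (x : dd_space A),
        homog (@dd_deg K A) n x -> homog (@dd_deg2 K A) n (Dp x)
    & forall n (x : dd_space A),
        homog (@dd_deg K A) n x -> homog (@dd_deg2 K A) n (Ds x)].

Definition graded_dupdend_bialgebra : Prop :=
  [/\ duplicial_algebra, dendriform_coalgebra, dupdend_compat
    & homogeneous_maps].

End Bialgebra.

Definition graded_dupdend_iso (K : fieldType) (A B : ddData K)
    (phi : {linear dd_space A -> dd_space B}) : Prop :=
  [/\ bijective phi,
      forall n (x : dd_space A),
        homog (@dd_deg K A) n x -> homog (@dd_deg K B) n (phi x),
      forall x y : dd_space A,
        phi (dd_mul x y) = dd_mul (phi x) (phi y)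
        /\ phi (dd_graft x y) = dd_graft (phi x) (phi y)
    & forall x : dd_space A,
        dd_prec (phi x) = \swd_(a, b <- dd_prec x) (phi a ⊗ phi b)
        /\ dd_succ (phi x) = \swd_(a, b <- dd_succ x) (phi a ⊗ phi b)].

Definition isomorphic_graded_dupdend (K : fieldType) (A B : ddData K) : Prop :=
  [/\ graded_dupdend_bialgebra A, graded_dupdend_bialgebra B
    & exists phi : {linear dd_space A -> dd_space B}, graded_dupdend_iso phi].

(* In a rooted forest with vertex set V, [e w v] means that there is an edge
  from w to v, oriented towards the roots; oriented paths, possibly of length
  0, are given by [connect e]. *)

Section Cuts.

Variables (V : finType) (e : rel V).

Definition admissible (S : {set V}) : bool :=
  [forall v in S, forall w in S, (v != w) ==> ~~ connect e v w].

Definition lea (S : {set V}) : {set V} :=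
  [set w | [exists v in S, connect e w v]].

Definition roo (S : {set V}) : {set V} := ~: lea S.

Definition proper_cut (S : {set V}) : bool :=
  [&& admissible S, lea S != set0 & roo S != set0].

Definition acyclic : bool :=
  [forall v, forall w, e v w ==> ~~ connect e w v].

Lemma acyclic_rank : acyclic ->
  exists r : V -> nat, forall v w, e v w -> (r w < r v)%N.
Proof.
move=> /forallP acy; exists (fun v => #|connect e v|) => v w evw.
apply: proper_card; apply/properP; split.
  by apply/subsetP=> u; rewrite !inE; apply: connect_trans; apply: connect1.
exists v; rewrite !inE ?connect0 //.
by have /forallP/(_ w)/implyP/(_ evw) := acy v.
Qed.

Lemma rank_connect (r : V -> nat) : (forall v w, e v w -> (r w < r v)%N) ->
  forall v w, connect e v w -> v != w -> (r w < r v)%N.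
Proof.
move=> er v w /connectP[p]; elim: p v => [|u p IHp] v /=.
  by move=> _ ->; rewrite eqxx.
move=> /andP[evu pu] lst _; have [Euw|neq_uw] := eqVneq u w.
  by rewrite -Euw er.
exact: ltn_trans (IHp u pu lst neq_uw) (er _ _ evu).
Qed.

Lemma rank_acyclic (r : V -> nat) :
  (forall v w, e v w -> (r w < r v)%N) -> acyclic.
Proof.
move=> er; apply/forallP=> v; apply/forallP=> w; apply/implyP=> evw.
apply/negP=> cwv; have [Evw|neq_wv] := eqVneq w v.
  by move: (er _ _ evw); rewrite Evw ltnn.
by have := ltn_trans (rank_connect er cwv neq_wv) (er _ _ evw); rewrite ltnn.
Qed.

End Cuts.

(* The vertices of an ordered forest with n + 1 vertices are numbered by 'I_n.+1
   along their total order, and the forest is given by the function mapping a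
   vertex to its parent (None for a root).  This picks exactly one
   representative in each isomorphism class of non-empty ordered forests. *)
Definition parents (n : nat) := {ffun 'I_n.+1 -> option 'I_n.+1}.

Definition pgraph := {n : nat & parents n}.

Definition pgraph_edge (F : pgraph) : rel 'I_(tag F).+1 :=
  fun w v => tagged F w == Some v.

Definition pgraph_mul (F G : pgraph) : pgraph :=
  existT parents (tag F + (tag G).+1)%N
    [ffun i : 'I_((tag F).+1 + (tag G).+1) =>
       match split i with
       | inl j => omap (lshift (tag G).+1) (tagged F j)
       | inr k => omap (@rshift (tag F).+1 (tag G).+1) (tagged G k)
       end].

Definition pgraph_graft (F G : pgraph) : pgraph :=
  existT parents (tag F + (tag G).+1)%N
    [ffun i : 'I_((tag F).+1 + (tag G).+1) =>
       match split i with
       | inl j => omap (lshift (tag G).+1) (tagged F j)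
       | inr k => Some (if tagged G k is Some k'
                        then @rshift (tag F).+1 (tag G).+1 k'
                        else lshift (tag G).+1 ord_max)
       end].

(* The sub-forest on a non-empty set A of vertices; [enum A] lists A in
   increasing order. *)
Definition pgraph_sub (F : pgraph) (A : {set 'I_(tag F).+1}) : pgraph :=
  existT parents #|A|.-1
    [ffun i : 'I_(#|A|.-1).+1 =>
       if tagged F (nth ord0 (enum A) i) is Some y then
         if y \in A then Some (inord (index y (enum A))) else None
       else None].

Lemma pgraph_mul_rank (F G : pgraph) (r s : nat -> nat) :
  (forall v w, @pgraph_edge F v w -> (r w < r v)%N) ->
  (forall v w, @pgraph_edge G v w -> (s w < s v)%N) ->
  forall v w, @pgraph_edge (pgraph_mul F G) v w ->
    ((if w < (tag F).+1 then r w else r (tag F) + (s (w - (tag F).+1)).+1)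
     < if v < (tag F).+1 then r v else r (tag F) + (s (v - (tag F).+1)).+1)%N.
Proof.
move=> hr hs v w; rewrite /pgraph_edge /= ffunE; case: splitP => j /= Ev.
  case E: (tagged F j) => [y|] //= /eqP[<-] /=.
  by rewrite Ev !ltn_ord; apply: hr; apply/eqP.
case E: (tagged G j) => [y|] //= /eqP[<-] /=.
have ltA k : ((tag F).+1 + k < (tag F).+1)%N = false by rewrite ltnNge leq_addr.
rewrite Ev !ltA !addKn ltn_add2l ltnS.
by apply: hs; apply/eqP.
Qed.

Lemma pgraph_graft_rank (F G : pgraph) (r s : nat -> nat) :
  (forall v w, @pgraph_edge F v w -> (r w < r v)%N) ->
  (forall v w, @pgraph_edge G v w -> (s w < s v)%N) ->
  forall v w, @pgraph_edge (pgraph_graft F G) v w ->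
    ((if w < (tag F).+1 then r w else r (tag F) + (s (w - (tag F).+1)).+1)
     < if v < (tag F).+1 then r v else r (tag F) + (s (v - (tag F).+1)).+1)%N.
Proof.
move=> hr hs v w; rewrite /pgraph_edge /= ffunE; case: splitP => j /= Ev.
  case E: (tagged F j) => [y|] //= /eqP[<-] /=.
  by rewrite Ev !ltn_ord; apply: hr; apply/eqP.
have ltA k : ((tag F).+1 + k < (tag F).+1)%N = false by rewrite ltnNge leq_addr.
rewrite Ev !ltA !addKn.
case E: (tagged G j) => [y|] /eqP[<-] /=.
  rewrite ltA addKn ltn_add2l ltnS.
  by apply: hs; apply/eqP.
by rewrite ltnSn addnS ltnS leq_addr.
Qed.

Lemma pgraph_sub_edge (F : pgraph) (A : {set 'I_(tag F).+1}) v w :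
  @pgraph_edge (pgraph_sub A) v w ->
  [/\ (v < size (enum A))%N, (w < size (enum A))%N
    & pgraph_edge (nth ord0 (enum A) v) (nth ord0 (enum A) w)].
Proof.
rewrite /pgraph_edge /= ffunE; case E: (tagged F _) => [y|] //.
case: ifP => // yA /eqP[<-].
have A_gt0 : (0 < #|A|)%N by apply/card_gt0P; exists y.
have ltA : forall i : 'I_(#|A|.-1).+1, (i < size (enum A))%N.
  by move=> i; rewrite -cardE -[X in (_ < X)%N](prednK A_gt0).
have Ei : (inord (index y (enum A)) : 'I_(#|A|.-1).+1) = index y (enum A)
    :> nat.
  by rewrite inordK // prednK // cardE index_mem mem_enum.
split; [exact: ltA | exact: ltA |].
by apply/eqP; rewrite Ei nth_index ?mem_enum //; apply: E.
Qed.

Definition oforest := {F : pgraph | acyclic (@pgraph_edge F)}.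

Definition osize (F : oforest) : nat := (tag (val F)).+1.
Definition overt (F : oforest) : finType := 'I_(osize F).
Definition oedge (F : oforest) : rel (overt F) := @pgraph_edge (val F).
Definition ogreatest (F : oforest) : overt F := ord_max.

Lemma ord_rank n (e : rel 'I_n) : acyclic e ->
  exists r : nat -> nat, forall v w, e v w -> (r w < r v)%N.
Proof.
move=> /acyclic_rank[r er].
exists (fun i => if insub i is Some v then r v else 0%N) => v w evw.
by rewrite !valK er.
Qed.

Fact omul_subproof (F G : oforest) :
  acyclic (@pgraph_edge (pgraph_mul (val F) (val G))).
Proof.
have [r hr] := ord_rank (valP F); have [s hs] := ord_rank (valP G).
exact: rank_acyclic (pgraph_mul_rank hr hs).
Qed.

Fact ograft_subproof (F G : oforest) :
  acyclic (@pgraph_edge (pgraph_graft (val F) (val G))).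
Proof.
have [r hr] := ord_rank (valP F); have [s hs] := ord_rank (valP G).
exact: rank_acyclic (pgraph_graft_rank hr hs).
Qed.

Fact osub_subproof (F : oforest) (A : {set overt F}) :
  acyclic (@pgraph_edge (@pgraph_sub (val F) A)).
Proof.
have [r hr] := acyclic_rank (valP F).
apply: (@rank_acyclic _ _ (fun i : 'I_(#|A|.-1).+1 =>
  r (nth (ord0 : overt F) (enum A) i))) => v w.
by case/pgraph_sub_edge=> _ _; apply: hr.
Qed.

Definition omul (F G : oforest) : oforest :=
  exist (fun F : pgraph => acyclic (@pgraph_edge F)) _ (omul_subproof F G).
Definition ograft (F G : oforest) : oforest :=
  exist (fun F : pgraph => acyclic (@pgraph_edge F)) _ (ograft_subproof F G).
Definition osub (F : oforest) (A : {set overt F}) : oforest :=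
  exist (fun F : pgraph => acyclic (@pgraph_edge F)) _ (osub_subproof A).

Definition Ho (K : fieldType) : ddData K := {|
  dd_basis := oforest;
  dd_deg := osize;
  dd_mul0 := fun F G => vect K (omul F G);
  dd_graft0 := fun F G => vect K (ograft F G);
  dd_prec0 := fun F =>
    \sum_(S : {set overt F} | proper_cut (@oedge F) S
                              && (ogreatest F \in lea (@oedge F) S))
      vect K (osub (lea (@oedge F) S), osub (roo (@oedge F) S));
  dd_succ0 := fun F =>
    \sum_(S : {set overt F} | proper_cut (@oedge F) S
                              && (ogreatest F \in roo (@oedge F) S))
      vect K (osub (lea (@oedge F) S), osub (roo (@oedge F) S))
|}.

Definition heap_ordered (F : oforest) : bool :=
  [forall i : overt F, forall j : overt F,
     connect (@oedge F) i j ==> (i != j) ==>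
     ((j : 'I_(osize F)) < (i : 'I_(osize F)))%N].

Lemma heap_orderedP (F : oforest) :
  reflect (forall i j : 'I_(tag (val F)).+1,
             @pgraph_edge (val F) i j -> (j < i)%N)
          (heap_ordered F).
Proof.
apply: (iffP idP) => [/forallP hF i j eij | hF].
  have /forallP/(_ j)/implyP/(_ (connect1 eij))/implyP := hF i.
  apply; apply/eqP=> Eij; subst j.
  have /forallP/(_ i)/forallP/(_ i)/implyP/(_ eij) := valP F.
  by rewrite connect0.
apply/forallP=> i; apply/forallP=> j; apply/implyP=> cij; apply/implyP=> neij.
exact: (@rank_connect _ _ (fun i : 'I_(tag (val F)).+1 => i : nat) hF).
Qed.

Lemma blockE (n a : nat) :
  (if (a < n.+1)%N then a else (n + (a - n.+1).+1)%N) = a.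
Proof. by case: ltnP => // le_na; rewrite addnS -addSn subnKC. Qed.

Lemma heap_mul (F G : oforest) :
  heap_ordered F -> heap_ordered G -> heap_ordered (omul F G).
Proof.
move=> /heap_orderedP hF /heap_orderedP hG; apply/heap_orderedP=> v w.
move/(pgraph_mul_rank (r := id) (s := id) hF hG).
by rewrite !blockE.
Qed.

Lemma heap_graft (F G : oforest) :
  heap_ordered F -> heap_ordered G -> heap_ordered (ograft F G).
Proof.
move=> /heap_orderedP hF /heap_orderedP hG; apply/heap_orderedP=> v w.
move/(pgraph_graft_rank (r := id) (s := id) hF hG).
by rewrite !blockE.
Qed.

Lemma heap_sub (F : oforest) (A : {set overt F}) :
  heap_ordered F -> heap_ordered (osub A).
Proof.
move=> /heap_orderedP hF; apply/heap_orderedP=> v w.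
case/pgraph_sub_edge=> ltv ltw /hF; apply: contraTT; rewrite -!leqNgt => le_vw.
have srt : sorted leq (map val (enum A)).
  rewrite sorted_map /enum_mem; apply: sorted_filter.
    by move=> x y z /=; apply: leq_trans.
  by rewrite -enumT -sorted_map val_enum_ord iota_sorted.
have := sorted_leq_nth leq_trans leqnn 0%N srt v w.
by rewrite !inE !size_map => /(_ ltv ltw le_vw); rewrite !(nth_map ord0).
Qed.

Definition hoforest := {F : oforest | heap_ordered F}.

Definition homul (F G : hoforest) : hoforest :=
  exist heap_ordered (omul (val F) (val G)) (heap_mul (valP F) (valP G)).
Definition hograft (F G : hoforest) : hoforest :=
  exist heap_ordered (ograft (val F) (val G)) (heap_graft (valP F) (valP G)).
Definition hosub (F : hoforest) (A : {set overt (val F)}) : hoforest :=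
  exist heap_ordered (osub A) (heap_sub A (valP F)).

Definition Hho (K : fieldType) : ddData K := {|
  dd_basis := hoforest;
  dd_deg := fun F => osize (val F);
  dd_mul0 := fun F G => vect K (homul F G);
  dd_graft0 := fun F G => vect K (hograft F G);
  dd_prec0 := fun F =>
    \sum_(S : {set overt (val F)} |
            proper_cut (@oedge (val F)) S
            && (ogreatest (val F) \in lea (@oedge (val F)) S))
      vect K (hosub (lea (@oedge (val F)) S), hosub (roo (@oedge (val F)) S));
  dd_succ0 := fun F =>
    \sum_(S : {set overt (val F)} |
            proper_cut (@oedge (val F)) S
            && (ogreatest (val F) \in roo (@oedge (val F)) S))
      vect K (hosub (lea (@oedge (val F)) S), hosub (roo (@oedge (val F)) S))
|}.

Record gradedSet := GradedSet {
  gs_sort :> choiceType;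
  gs_deg : gs_sort -> nat
}.

(* A planar decorated tree: the decoration of its root, and the sequence of the
   subtrees attached to the root, from left to right. *)
Inductive ptree (D : Type) : Type := PNode of D & seq (ptree D).

Section PtreeChoice.

Variable D : choiceType.

Fixpoint ptree_enc (t : ptree D) : GenTree.tree D :=
  let: PNode d ts := t in
  GenTree.Node 0 (GenTree.Leaf d :: map ptree_enc ts).

Fixpoint ptree_dec (t : GenTree.tree D) : option (ptree D) :=
  if t is GenTree.Node _ (GenTree.Leaf d :: us)
  then Some (PNode d (pmap ptree_dec us)) else None.

Fixpoint ptree_encK (t : ptree D) : ptree_dec (ptree_enc t) = Some t.
Proof.
case: t => d ts /=; congr (Some (PNode d _)).
by elim: ts => //= t ts IHts; rewrite ptree_encK /= IHts.
Qed.

HB.instance Definition _ := Equality.copy (ptree D) (pcan_type ptree_encK).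
HB.instance Definition _ := Choice.copy (ptree D) (pcan_type ptree_encK).

End PtreeChoice.

Definition flatmapi (T U : Type) (f : nat -> T -> seq U) :=
  fix loop (i : nat) (ts : seq T) : seq U :=
    if ts is t :: ts' then f i t ++ loop i.+1 ts' else [::].

(* A vertex of a planar forest is represented by its address i_0 :: ... :: i_k:
   it is reached from the root of the i_0-th tree by moving to the i_1-th child,
   then to the i_2-th child of that vertex, and so on.  In a tree, the i_0 is
   dropped, so that the root has address [::]. *)
Fixpoint tree_verts (D : Type) (t : ptree D) : seq (seq nat) :=
  let: PNode _ ts := t in
  [::] :: flatmapi (fun i u => map (cons i) (tree_verts u)) 0 ts.

Definition forest_verts (D : Type) (F : seq (ptree D)) : seq (seq nat) :=
  flatmapi (fun i u => map (cons i) (tree_verts u)) 0 F.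

(* The sub-forest on the vertices satisfying P, where P is the set of the
   vertices of Lea or of Roo of a cut: in both cases, a kept vertex whose parent
   is not kept has no kept ancestor, and becomes a root. *)
Fixpoint tree_sub (D : Type) (P : pred (seq nat)) (t : ptree D) :
    seq (ptree D) :=
  let: PNode d ts := t in
  let us := flatmapi (fun i u => tree_sub (fun a => P (i :: a)) u) 0 ts in
  if P [::] then [:: PNode d us] else us.

Definition forest_sub (D : Type) (P : pred (seq nat)) (F : seq (ptree D)) :
    seq (ptree D) :=
  flatmapi (fun i u => tree_sub (fun a => P (i :: a)) u) 0 F.

Definition rightmost_from (T : Type) (f : T -> seq nat) :=
  fix loop (i : nat) (ts : seq T) : seq nat :=
    match ts with
    | [::] => [::]
    | [:: t] => i :: f t
    | _ :: ts' => loop i.+1 ts'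
    end.

Fixpoint tree_rleaf (D : Type) (t : ptree D) : seq nat :=
  let: PNode _ ts := t in rightmost_from (@tree_rleaf D) 0 ts.

Definition forest_rleaf (D : Type) (F : seq (ptree D)) : seq nat :=
  rightmost_from (@tree_rleaf D) 0 F.

(* The value G at [::] is what grafts G on a childless vertex in tree_graft. *)
Definition on_last (T : Type) (G : seq T) (f : T -> T) :=
  fix loop (ts : seq T) : seq T :=
    match ts with
    | [::] => G
    | [:: t] => [:: f t]
    | t :: ts' => t :: loop ts'
    end.

Fixpoint tree_graft (D : Type) (G : seq (ptree D)) (t : ptree D) : ptree D :=
  let: PNode d ts := t in PNode d (on_last G (tree_graft G) ts).

Definition forest_graft (D : Type) (F G : seq (ptree D)) : seq (ptree D) :=
  on_last G (tree_graft G) F.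

Fixpoint tree_deg (D : Type) (deg : D -> nat) (t : ptree D) : nat :=
  let: PNode d ts := t in (deg d + sumn (map (tree_deg deg) ts))%N.

Definition pforest (D : choiceType) := {F : seq (ptree D) | F != [::]}.

Definition pdeg (D : gradedSet) (F : pforest D) : nat :=
  sumn (map (tree_deg (@gs_deg D)) (val F)).

Fact pmul_subproof (D : choiceType) (F G : pforest D) :
  val F ++ val G != [::].
Proof. by case: F => -[]. Qed.

Fact pgraft_subproof (D : choiceType) (F G : pforest D) :
  forest_graft (val F) (val G) != [::].
Proof. by case: F => -[|t [|u F]]. Qed.

Definition pmul (D : choiceType) (F G : pforest D) : pforest D :=
  exist (fun F : seq (ptree D) => F != [::]) _ (pmul_subproof F G).
Definition pgraft (D : choiceType) (F G : pforest D) : pforest D :=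
  exist (fun F : seq (ptree D) => F != [::]) _ (pgraft_subproof F G).

Definition pvert (D : choiceType) (F : pforest D) : finType :=
  seq_sub (forest_verts (val F)).

Definition pedge (D : choiceType) (F : pforest D) : rel (pvert F) :=
  fun w v => (size (ssval w) == (size (ssval v)).+1)
             && prefix (ssval v) (ssval w).

Definition addresses (D : choiceType) (F : pforest D) (A : {set pvert F}) :
    seq (seq nat) := [seq ssval v | v in A].

(* The default value F of insubd is only used when A is empty; see psubE. *)
Definition psub (D : choiceType) (F : pforest D) (A : {set pvert F}) :
    pforest D :=
  insubd F (forest_sub (fun a => a \in addresses A) (val F)).

Lemma cat_neq_nil (T : eqType) (s1 s2 : seq T) :
  (s1 ++ s2 != [::]) = (s1 != [::]) || (s2 != [::]).
Proof. by case: s1. Qed.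

Fixpoint tree_sub_neq0 (D : choiceType) (P : pred (seq nat)) (t : ptree D) :
  has P (tree_verts t) -> tree_sub P t != [::].
Proof.
case: t => d ts /=; case: (P [::]) => //=.
elim: ts 0%N => [|t ts IHts] i //=; rewrite has_cat has_map cat_neq_nil.
by case/orP=> [/(@tree_sub_neq0 D _ t) -> // | /IHts ->]; rewrite orbT.
Qed.

Lemma forest_sub_neq0 (D : choiceType) (P : pred (seq nat))
    (F : seq (ptree D)) :
  has P (forest_verts F) -> forest_sub P F != [::].
Proof.
rewrite /forest_sub /forest_verts; elim: F 0%N => //= t ts IHts i.
rewrite has_cat has_map cat_neq_nil => /orP[/tree_sub_neq0 -> // | /IHts ->].
by rewrite orbT.
Qed.

Lemma psubE (D : choiceType) (F : pforest D) (A : {set pvert F}) :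
  A != set0 ->
  val (psub A) = forest_sub (fun a => a \in addresses A) (val F).
Proof.
case/set0Pn=> v vA; apply: insubdK; apply: forest_sub_neq0.
by apply/hasP; exists (ssval v); [exact: ssvalP | exact: image_f].
Qed.

Definition Hp (K : fieldType) (D : gradedSet) : ddData K := {|
  dd_basis := pforest D;
  dd_deg := @pdeg D;
  dd_mul0 := fun F G => vect K (pmul F G);
  dd_graft0 := fun F G => vect K (pgraft F G);
  dd_prec0 := fun F =>
    \sum_(S : {set pvert F} |
            proper_cut (@pedge D F) S
            && (forest_rleaf (val F) \in addresses (lea (@pedge D F) S)))
      vect K (psub (lea (@pedge D F) S), psub (roo (@pedge D F) S));
  dd_succ0 := fun F =>
    \sum_(S : {set pvert F} |
            proper_cut (@pedge D F) S
            && (forest_rleaf (val F) \in addresses (roo (@pedge D F) S)))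
      vect K (psub (lea (@pedge D F) S), psub (roo (@pedge D F) S))
|}.

(* Main.v *)
(* Let A be one of the two algebras of ordered forests.  An admissible cut v is
   determined by Lea_v, which is any set of vertices closed under descendants, and
   the axioms of A compare such sets for F, G and FG (or F ↖ G).

   Let D be a basis of the space of primitive elements of A, i.e. those killed
   by both half-coproducts, consisting of homogeneous elements.  Sending the
   single vertex d to the primitive element d, PNode d F to d ↖ Phi F and
   juxtaposition to products extends to a map Phi from the decorated planar
   forests to A.  As d is primitive, the half-coproducts of d ↖ x only depend on
   those of x, in the same way as the cuts of PNode d F depend on those of F, so
   Phi is a morphism.  The primitive elements of planar forests are spanned by
   the single vertices, so Phi is injective, by induction on the number of
   vertices; thus the planar forests inherit the bialgebra axioms from A.  For
   the surjectivity, by induction on the degree, the half-coproducts of x in A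
   come from some pair (u, v) of tensors of planar forests, which satisfies the
   dendriform axioms because Phi is injective.  Such a pair is always the pair of
   half-coproducts of some y, and x - Phi y is primitive. *)
From HB Require Import structures.
From mathcomp Require Import all_boot all_order all_algebra.
From mathcomp Require Import finmap.
From mathcomp.multinomials Require Import monalg.
From mathcomp Require Import boolp zify.
Require Import Defs.

Set Implicit Arguments.
Unset Strict Implicit.
Unset Printing Implicit Defensive.

Import GRing.Theory.
Local Open Scope ring_scope.

(** * Linear maps between free modules *)

(** That every pair of tensors satisfying the dendriform axioms is a pair of half-coproducts rests
    on one operator. [Tlast] reads from y its coefficients on the forests that end with a one-vertex
    tree, and the coefficients of [dd_prec y] on the tensors l ⊗ r where r ends with such a tree. It
    is unitriangular, hence bijective, so some y has the readings prescribed by a given pair (u, v).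
    The difference between (u, v) and the half-coproducts of y still satisfies the axioms and has
    zero readings; the axioms then spread these zeros to all slices of both tensors. Injectivity of
    the same operator shows that single vertices span the primitive elements.

    The other difficulty is that cuts are subsets of dependent finite types. For ordered forests,
    subsets are compared through increasing lists of natural numbers. For planar forests, cuts are
    enumerated recursively, each with a mask along the list of vertices that ties it to a subset. *)

Section Linear.

Variable K : fieldType.
Implicit Types (U V W M N : lmodType K) (B C E : choiceType).

(** Linearity is a predicate on plain functions, so that anonymous maps built with [sweedler] need
    no packing. *)
Definition lin U V (f : U -> V) : Prop :=
  forall c x y, f (c *: x + y) = c *: f x + f y.

Definition bilin U V W (f : U -> V -> W) : Prop :=
  (forall y, lin (f^~ y)) /\ (forall x, lin (f x)).

Lemma linD U V (f : U -> V) : lin f -> forall x y, f (x + y) = f x + f y.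
Proof. by move=> fl x y; rewrite -[x]scale1r fl !scale1r. Qed.

Lemma lin0 U V (f : U -> V) : lin f -> f 0 = 0.
Proof. by move=> fl; apply: (addrI (f 0)); rewrite -linD // !addr0. Qed.

Lemma linZ U V (f : U -> V) : lin f -> forall c x, f (c *: x) = c *: f x.
Proof. by move=> fl c x; rewrite -[_ *: x]addr0 fl (lin0 fl) addr0. Qed.

Lemma linB U V (f : U -> V) : lin f -> forall x y, f (x - y) = f x - f y.
Proof. by move=> fl x y; rewrite linD // -scaleN1r linZ // scaleN1r. Qed.

Lemma lin_sum U V (f : U -> V) (I : Type) (r : seq I) (P : pred I) F :
  lin f -> f (\sum_(i <- r | P i) F i) = \sum_(i <- r | P i) f (F i).
Proof. by move=> fl; apply: (big_morph f (linD fl) (lin0 fl)). Qed.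

Lemma lin_id U : lin (fun x : U => x). Proof. by []. Qed.

Lemma lin_comp U V W (f : V -> W) (g : U -> V) :
  lin f -> lin g -> lin (fun x => f (g x)).
Proof. by move=> fl gl c x y; rewrite gl fl. Qed.

Lemma lin_add U V (f g : U -> V) : lin f -> lin g -> lin (fun x => f x + g x).
Proof. by move=> fl gl c x y; rewrite fl gl scalerDr addrACA. Qed.

Lemma lin_sub U V (f g : U -> V) : lin f -> lin g -> lin (fun x => f x - g x).
Proof.
by move=> fl gl c x y; rewrite fl gl scalerBr opprD addrACA.
Qed.

Lemma lin_cst0 U V : lin (fun _ : U => 0 : V).
Proof. by move=> c x y; rewrite scaler0 addr0. Qed.

Lemma lin_bl U V W (T : lmodType K) (op : U -> V -> W) (f : T -> U) v :
  bilin op -> lin f -> lin (fun x : T => op (f x) v).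
Proof. by case=> opl _ fl; apply: (lin_comp (opl v) fl). Qed.

Lemma lin_br U V W (T : lmodType K) (op : U -> V -> W) (f : T -> V) u :
  bilin op -> lin f -> lin (fun x : T => op u (f x)).
Proof. by case=> _ opr fl; apply: (lin_comp (opr u) fl). Qed.

Lemma linextEw B M (f : B -> M) (x : {malg K[B]}) (d : {fset B}) :
  (msupp x `<=` d)%fset -> linext f x = \sum_(b <- d) x@_b *: f b.
Proof.
move=> le_xd; rewrite /linext (big_fset_incl _ le_xd) // => b _ xb.
by rewrite mcoeff_outdom // scale0r.
Qed.

Lemma lin_linext B M (f : B -> M) : lin (linext f).
Proof.
move=> c x y; set d := (msupp x `|` msupp y)%fset.
have lx : (msupp x `<=` d)%fset by apply: fsubsetUl.
have ly : (msupp y `<=` d)%fset by apply: fsubsetUr.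
have lxy : (msupp (c *: x + y) `<=` d)%fset.
  apply: fsubset_trans (msuppD_le _ _) _.
  by rewrite fsubUset ly andbT (fsubset_trans (msuppZ_le _ _)).
rewrite (linextEw _ lx) (linextEw _ ly) (linextEw _ lxy) scaler_sumr -big_split.
by apply: eq_bigr => b _; rewrite mcoeffD mcoeffZ scalerDl scalerA.
Qed.

Lemma coef_vect B (b c : B) : (vect K b)@_c = (b == c)%:R.
Proof. by rewrite /vect mcoeffU. Qed.

Lemma linext_vect B M (f : B -> M) b : linext f (vect K b) = f b.
Proof.
rewrite /linext /vect msuppU oner_eq0 big_seq_fset1.
by rewrite mcoeffUU scale1r.
Qed.

Lemma vectE B (x : {malg K[B]}) : x = \sum_(b <- msupp x) x@_b *: vect K b.
Proof.
rewrite {1}[x]monalgE; apply: eq_bigr => b _; apply/malgP=> c.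
by rewrite mcoeffZ coef_vect mcoeffU mulr_natr.
Qed.

Lemma linE B M (f : {malg K[B]} -> M) : lin f ->
  forall x, f x = \sum_(b <- msupp x) x@_b *: f (vect K b).
Proof.
move=> fl x; rewrite {1}[x]vectE lin_sum //; apply: eq_bigr => b _.
exact: linZ.
Qed.

Lemma lin_eq B M (f g : {malg K[B]} -> M) : lin f -> lin g ->
  (forall b, f (vect K b) = g (vect K b)) -> forall x, f x = g x.
Proof.
by move=> fl gl fg x; rewrite !linE //; apply: eq_bigr => b _; rewrite fg.
Qed.

Lemma bilin_eq B C M (f g : {malg K[B]} -> {malg K[C]} -> M) :
  bilin f -> bilin g ->
  (forall b c, f (vect K b) (vect K c) = g (vect K b) (vect K c)) ->
  forall x y, f x y = g x y.
Proof.
move=> [fl fr] [gl gr] fg x y.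
apply: (lin_eq (fl y) (gl y)) => b.
by apply: (lin_eq (fr _) (gr _)) => c.
Qed.

Lemma lin_linext_param U B M (f : U -> B -> M) x :
  (forall b, lin (f^~ b)) -> lin (fun u => linext (f u) x).
Proof.
move=> fl c u v; rewrite /linext scaler_sumr -big_split; apply: eq_bigr => b _.
by rewrite fl scalerDr !scalerA mulrC.
Qed.

Lemma bilin_bilinext B C M (f : B -> C -> M) : bilin (bilinext f).
Proof.
split=> [y|x]; first exact: lin_linext.
by apply: lin_linext_param => b; apply: lin_linext.
Qed.

Lemma bilinext_vect B C M (f : B -> C -> M) b c :
  bilinext f (vect K b) (vect K c) = f b c.
Proof. by rewrite /bilinext !linext_vect. Qed.

Lemma bilin_tens B C : bilin (@tens K B C).
Proof. exact: bilin_bilinext. Qed.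

Lemma lin_tensl U B C (f : U -> {malg K[B]}) (y : {malg K[C]}) :
  lin f -> lin (fun x => f x ⊗ y).
Proof. exact: lin_bl (bilin_tens _ _). Qed.

Lemma lin_tensr U B C (f : U -> {malg K[C]}) (x : {malg K[B]}) :
  lin f -> lin (fun y => x ⊗ f y).
Proof. exact: lin_br (bilin_tens _ _). Qed.

Lemma tens_vect B C (b : B) (c : C) : vect K b ⊗ vect K c = vect K (b, c).
Proof. exact: bilinext_vect. Qed.

Lemma lin_swd B C M (f : {malg K[B]} -> {malg K[C]} -> M) : lin (sweedler f).
Proof. exact: lin_linext. Qed.

Lemma lin_swd_param U B C M (f : U -> {malg K[B]} -> {malg K[C]} -> M) t :
  (forall x y, lin (fun u => f u x y)) -> lin (fun u => sweedler (f u) t).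
Proof. by move=> fl; apply: lin_linext_param => b; apply: fl. Qed.

Lemma swd_vect B C M (f : {malg K[B]} -> {malg K[C]} -> M) b c :
  sweedler f (vect K (b, c)) = f (vect K b) (vect K c).
Proof. exact: linext_vect. Qed.

Lemma swd_tens B C M (f : {malg K[B]} -> {malg K[C]} -> M) x y :
  bilin f -> sweedler f (x ⊗ y) = f x y.
Proof.
move=> fb; move: x y; apply: bilin_eq => //.
  split=> [y|x].
    by apply: lin_comp (lin_swd _) _; apply: lin_bl (bilin_tens _ _) (@lin_id _).
  by apply: lin_comp (lin_swd _) _; apply: lin_br (bilin_tens _ _) (@lin_id _).
by move=> b c; rewrite tens_vect swd_vect.
Qed.

Lemma eq_swd B C M (f g : {malg K[B]} -> {malg K[C]} -> M) t :
  (forall x y, f x y = g x y) -> sweedler f t = sweedler g t.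
Proof. by move=> fg; apply: lin_eq t => [||[b c]]; rewrite ?swd_vect; try exact: lin_swd. Qed.

Lemma lin_swd_out B C M N (f : {malg K[B]} -> {malg K[C]} -> M) (g : M -> N) t :
  lin g -> g (sweedler f t) = sweedler (fun x y => g (f x y)) t.
Proof.
move=> gl; move: t; apply: lin_eq => [||[b c]]; first exact: lin_comp gl (lin_swd _).
  exact: lin_swd.
by rewrite !swd_vect.
Qed.

(** With values in [K^o], coefficients are linear maps between modules, and identities between
    coefficients can be checked on basis vectors by [lin_eq]. *)
Lemma lin_coef B b : lin (fun x : {malg K[B]} => x@_b : K^o).
Proof. by move=> c x y; rewrite mcoeffD mcoeffZ. Qed.

Lemma coef_tens B C (x : {malg K[B]}) (y : {malg K[C]}) b c :
  (x ⊗ y)@_(b, c) = x@_b * y@_c.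
Proof.
pose f (x : {malg K[B]}) (y : {malg K[C]}) : K^o := (x ⊗ y)@_(b, c).
pose g (x : {malg K[B]}) (y : {malg K[C]}) : K^o := x@_b * y@_c.
have fb : bilin f.
  split=> [v|u]; apply: lin_comp (lin_coef _) _.
    exact: lin_bl (bilin_tens _ _) (@lin_id _).
  exact: lin_br (bilin_tens _ _) (@lin_id _).
have gb : bilin g.
  split=> [v|u] a z w; rewrite /g mcoeffD mcoeffZ; first by rewrite mulrDl -mulrA.
  by rewrite mulrDr mulrCA.
apply: (bilin_eq fb gb) => b' c'.
by rewrite /f /g tens_vect !coef_vect xpair_eqE -mulnb natrM.
Qed.

(** This is f ⊗ g when f and g are linear. *)
Definition tmap B C B' C' (f : {malg K[B]} -> {malg K[B']})
    (g : {malg K[C]} -> {malg K[C']}) (t : {malg K[(B * C)%type]}) :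
    {malg K[(B' * C')%type]} :=
  \swd_(x, y <- t) (f x ⊗ g y).

Lemma lin_tmap B C B' C' f g : lin (@tmap B C B' C' f g).
Proof. exact: (lin_swd (fun x y => f x ⊗ g y)). Qed.

Lemma tmap_vect B C B' C' f g (b : B) (c : C) :
  @tmap B C B' C' f g (vect K (b, c)) = f (vect K b) ⊗ g (vect K c).
Proof. exact: swd_vect. Qed.

Lemma tmap_tens B C B' C' f g x y : lin f -> lin g ->
  @tmap B C B' C' f g (x ⊗ y) = f x ⊗ g y.
Proof.
move=> fl gl; apply: swd_tens; split=> [v|u].
  exact: lin_bl (bilin_tens _ _) fl.
exact: lin_br (bilin_tens _ _) gl.
Qed.

Lemma tmap_comp B C B1 C1 B2 C2 (f : {malg K[B1]} -> {malg K[B2]})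
    (g : {malg K[C1]} -> {malg K[C2]}) (f' : {malg K[B]} -> {malg K[B1]})
    (g' : {malg K[C]} -> {malg K[C1]}) t : lin f -> lin g ->
  tmap f g (tmap f' g' t) = tmap (fun x => f (f' x)) (fun y => g (g' y)) t.
Proof.
move=> fl gl; rewrite /tmap lin_swd_out; last exact: lin_swd.
by apply: eq_swd => x y; apply: tmap_tens.
Qed.

Lemma eq_tmap B C B' C' f1 f2 g1 g2 t : f1 =1 f2 -> g1 =1 g2 ->
  @tmap B C B' C' f1 g1 t = tmap f2 g2 t.
Proof. by move=> f12 g12; apply: eq_swd => x y; rewrite f12 g12. Qed.

Lemma tmap_id B C (t : {malg K[(B * C)%type]}) : tmap id id t = t.
Proof.
move: t; apply: lin_eq => [||[b c]]; [exact: lin_tmap|exact: lin_id|].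
by rewrite tmap_vect tens_vect.
Qed.

(** Contraction of the first factor with the coordinate form of b; [slice2] contracts the second
    factor. *)
Definition slice1 B C (b : B) : {malg K[(B * C)%type]} -> {malg K[C]} :=
  linext (fun p => if p.1 == b then vect K p.2 else 0).
Definition slice2 B C (c : C) : {malg K[(B * C)%type]} -> {malg K[B]} :=
  linext (fun p => if p.2 == c then vect K p.1 else 0).

Lemma coef_slice1 B C (b : B) (c : C) t : (slice1 b t)@_c = t@_(b, c).
Proof.
move: t; apply: (@lin_eq _ K^o) => [||[b' c']]; try exact: lin_coef.
  exact: lin_comp (lin_coef _) (lin_linext _).
rewrite /slice1 linext_vect /= coef_vect xpair_eqE.
by case: eqP => _; rewrite ?coef_vect ?mcoeff0.
Qed.

Lemma coef_slice2 B C (b : B) (c : C) t : (slice2 c t)@_b = t@_(b, c).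
Proof.
move: t; apply: (@lin_eq _ K^o) => [||[b' c']]; try exact: lin_coef.
  exact: lin_comp (lin_coef _) (lin_linext _).
rewrite /slice2 linext_vect /= coef_vect xpair_eqE andbC.
by case: eqP => _; rewrite ?coef_vect ?mcoeff0.
Qed.

Lemma coef_tmapl B C B' (f : {malg K[B]} -> {malg K[B']}) t b (c : C) :
  lin f -> (tmap f id t)@_(b, c) = (f (slice2 c t))@_b.
Proof.
move=> fl; move: t; apply: (@lin_eq _ K^o) => [||[b' c']].
- exact: lin_comp (lin_coef _) (lin_tmap _ _).
- exact: lin_comp (lin_coef _) (lin_comp fl (lin_linext _)).
rewrite tmap_vect coef_tens coef_vect /slice2 linext_vect /=.
by case: eqP => _; rewrite ?mulr1 // mulr0 (lin0 fl) mcoeff0.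
Qed.

Lemma coef_tmapr B C C' (f : {malg K[C]} -> {malg K[C']}) t (b : B) c :
  lin f -> (tmap id f t)@_(b, c) = (f (slice1 b t))@_c.
Proof.
move=> fl; move: t; apply: (@lin_eq _ K^o) => [||[b' c']].
- exact: lin_comp (lin_coef _) (lin_tmap _ _).
- exact: lin_comp (lin_coef _) (lin_comp fl (lin_linext _)).
rewrite tmap_vect coef_tens coef_vect /slice1 linext_vect /=.
by case: eqP => _; rewrite ?mul1r // mul0r (lin0 fl) mcoeff0.
Qed.

(** Factor f ⊗ g as (f ⊗ id)(id ⊗ g) and test each factor on slices. The restriction to P and Q
    serves inductions in which f and g are known to be injective on part of the basis only. *)
Lemma tmap_inj_on B C B' C' (P : pred B) (Q : pred C)
    (f : {malg K[B]} -> {malg K[B']}) (g : {malg K[C]} -> {malg K[C']}) t :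
  lin f -> lin g ->
  (forall x, {in msupp x, forall b, P b} -> f x = 0 -> x = 0) ->
  (forall y, {in msupp y, forall c, Q c} -> g y = 0 -> y = 0) ->
  {in msupp t, forall p, P p.1 && Q p.2} ->
  tmap f g t = 0 -> t = 0.
Proof.
move=> fl gl finj ginj tPQ fgt0.
have s10 b : ~~ P b -> slice1 b t = 0.
  move=> Pb; apply/malgP=> c; rewrite coef_slice1 mcoeff0 mcoeff_outdom //.
  by apply/negP=> /tPQ /= /andP[]; rewrite (negbTE Pb).
have w0 : tmap id g t = 0.
  apply/malgP=> -[b c]; rewrite mcoeff0 -coef_slice2.
  suff -> : slice2 c (tmap id g t) = 0 by rewrite mcoeff0.
  apply: finj => [b'|].
    rewrite -mcoeff_neq0 coef_slice2 coef_tmapr //; apply: contraNT => /s10 ->.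
    by rewrite (lin0 gl) mcoeff0.
  apply/malgP=> b'; rewrite -coef_tmapl // tmap_comp //.
  by rewrite [tmap _ _ t]fgt0 !mcoeff0.
apply/malgP=> -[b c]; rewrite mcoeff0 -coef_slice1.
suff -> : slice1 b t = 0 by rewrite mcoeff0.
apply: ginj => [c'|].
  by rewrite -mcoeff_neq0 coef_slice1 mcoeff_neq0 => /tPQ /andP[].
by apply/malgP=> c'; rewrite -coef_tmapr // w0 !mcoeff0.
Qed.

Lemma tmap_inj B C B' C' (f : {malg K[B]} -> {malg K[B']})
    (g : {malg K[C]} -> {malg K[C']}) :
  lin f -> lin g -> injective f -> injective g -> injective (tmap f g).
Proof.
move=> fl gl finj ginj t u E; apply/eqP; rewrite -subr_eq0; apply/eqP.
apply: (@tmap_inj_on _ _ _ _ predT predT f g) => //.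
- by move=> x _ /esym; rewrite -[in X in X -> _](lin0 fl) => /finj.
- by move=> x _ /esym; rewrite -[in X in X -> _](lin0 gl) => /ginj.
- by rewrite linB ?E ?subrr //; apply: lin_tmap.
Qed.

(** Iterating a coproduct on the right factor lands in B * (C * E); this rebracketing brings it to
    the type obtained by iterating on the left. *)
Definition tassoc B C E :
    {malg K[(B * (C * E))%type]} -> {malg K[(B * C * E)%type]} :=
  linext (fun p => vect K (p.1, p.2.1, p.2.2)).

Lemma coef_tassoc B C E t (b : B) (c : C) (e : E) :
  (tassoc t)@_(b, c, e) = t@_(b, (c, e)).
Proof.
move: t; apply: (@lin_eq _ K^o) => [||[b' [c' e']]]; try exact: lin_coef.
  exact: lin_comp (lin_coef _) (lin_linext _).
by rewrite /tassoc linext_vect !coef_vect !xpair_eqE andbA.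
Qed.

Lemma tassoc_vect B C E (b : B) (c : C) (e : E) :
  tassoc (vect K (b, (c, e))) = vect K (b, c, e).
Proof. exact: linext_vect. Qed.

Lemma tassoc_tens B C E (x : {malg K[B]}) (t : {malg K[(C * E)%type]}) :
  tassoc (x ⊗ t) = \swd_(y, z <- t) ((x ⊗ y) ⊗ z).
Proof.
move: x t; apply: bilin_eq => [||b [c e]].
- split=> ?; apply: lin_comp (lin_linext _) _.
    exact: lin_bl (bilin_tens _ _) (@lin_id _).
  exact: lin_br (bilin_tens _ _) (@lin_id _).
- split=> [t|x]; last exact: (lin_swd (fun y z => (x ⊗ y) ⊗ z)).
  apply: (lin_swd_param (f := fun x y z => (x ⊗ y) ⊗ z)) => y z.
  refine (lin_tensl _ _).
  exact: (lin_tensl _ (@lin_id _)).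
by rewrite tens_vect /tassoc linext_vect swd_vect !tens_vect.
Qed.

Lemma tassoc_tmap B C E B' C' E' (f : {malg K[B]} -> {malg K[B']})
    (g : {malg K[C]} -> {malg K[C']}) (h : {malg K[E]} -> {malg K[E']}) t :
  lin f -> lin g -> lin h ->
  tassoc (tmap f (tmap g h) t) = tmap (tmap f g) h (tassoc t).
Proof.
move=> fl gl hl; move: t; apply: lin_eq => [||[b [c e]]].
- exact: lin_comp (lin_linext _) (lin_tmap _ _).
- exact: lin_comp (lin_tmap _ _) (lin_linext _).
rewrite tassoc_vect !tmap_vect tassoc_tens swd_tens -?tens_vect ?tmap_tens //.
split=> [v|u]; last exact: (lin_tensr _ (@lin_id _)).
by refine (lin_tensl _ _); apply: (lin_tensr _ (@lin_id _)).
Qed.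

End Linear.

Lemma bilin_mul (K : fieldType) (A : ddData K) : bilin (@dd_mul K A).
Proof. exact: bilin_bilinext. Qed.

Lemma bilin_graft (K : fieldType) (A : ddData K) : bilin (@dd_graft K A).
Proof. exact: bilin_bilinext. Qed.

Lemma lin_prec (K : fieldType) (A : ddData K) : lin (@dd_prec K A).
Proof. exact: (lin_linext (@dd_prec0 K A)). Qed.

Lemma lin_succ (K : fieldType) (A : ddData K) : lin (@dd_succ K A).
Proof. exact: (lin_linext (@dd_succ0 K A)). Qed.

Lemma lin_cop (K : fieldType) (A : ddData K) : lin (@dd_cop K A).
Proof. exact: (lin_add (@lin_prec K A) (@lin_succ K A)). Qed.

(** Directed by the outermost operation. For a binary operation, the alternative that succeeds is
    the one whose other argument does not depend on the variable. *)
Ltac lin_tac :=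
  cbv beta;
  lazymatch goal with
  | |- bilin _ => split; intros ?; lin_tac
  | |- lin (fun x => x) => exact (@lin_id _ _)
  | |- lin (@dd_mul _ ?A ?x) => exact ((@bilin_mul _ A).2 x)
  | |- lin (@dd_graft _ ?A ?x) => exact ((@bilin_graft _ A).2 x)
  | |- lin (@tens _ ?B ?C ?x) => exact ((@bilin_tens _ B C).2 x)
  | |- lin (@dd_prec _ ?A) => exact (@lin_prec _ A)
  | |- lin (@dd_succ _ ?A) => exact (@lin_succ _ A)
  | |- lin (@dd_cop _ ?A) => exact (@lin_cop _ A)
  | |- lin (@tassoc _ _ _ _) => exact (@lin_linext _ _ _ _)
  | |- lin (tmap _ _) => exact (@lin_tmap _ _ _ _ _ _ _)
  | |- lin (@linext _ _ _ _) => exact (@lin_linext _ _ _ _)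
  | |- lin (sweedler ?F) => exact (lin_swd F)
  | |- lin id => exact (@lin_id _ _)
  | |- lin (fun x => @?f x + @?g x) => refine (lin_add _ _); lin_tac
  | |- lin (fun x => @tens _ _ _ _ _) =>
      first [refine (lin_tensl _ _) | refine (lin_tensr _ _)]; lin_tac
  | |- lin (fun x => @dd_mul _ ?A _ _) =>
      first [ refine (lin_bl _ (@bilin_mul _ A) _)
            | refine (lin_br _ (@bilin_mul _ A) _)]; lin_tac
  | |- lin (fun x => @dd_graft _ ?A _ _) =>
      first [ refine (lin_bl _ (@bilin_graft _ A) _)
            | refine (lin_br _ (@bilin_graft _ A) _)]; lin_tac
  | |- lin (fun x => @dd_prec _ ?A (@?f x)) =>
      refine (lin_comp (@lin_prec _ A) _); lin_tac
  | |- lin (fun x => @dd_succ _ ?A (@?f x)) =>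
      refine (lin_comp (@lin_succ _ A) _); lin_tac
  | |- lin (fun x => @dd_cop _ ?A (@?f x)) =>
      refine (lin_comp (@lin_cop _ A) _); lin_tac
  | |- lin (fun x => @tassoc _ _ _ _ (@?f x)) =>
      refine (lin_comp (@lin_linext _ _ _ _) _); lin_tac
  | |- lin (fun x => tmap _ _ _) =>
      refine (lin_comp (@lin_tmap _ _ _ _ _ _ _) _); lin_tac
  | |- lin (fun x => sweedler _ _) =>
      first [ refine (lin_comp (lin_swd _) _); lin_tac
            | refine (@lin_swd_param _ _ _ _ _ _ _ _); intros; lin_tac ]
  | |- lin (fun x => linext _ _) =>
      refine (lin_comp (lin_linext _) _); lin_tac
  | h : lin ?j |- lin (fun x => ?j (@?f x)) =>
      refine (lin_comp h _); lin_tac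
  | |- _ => assumption
  end.

(** * Homogeneous components, and transport of the axioms along an injective morphism *)

Section Morphisms.

Variable K : fieldType.

Lemma swd_tmap (B C B' C' : choiceType) (M : lmodType K)
    (f : {malg K[B]} -> {malg K[B']}) (g : {malg K[C]} -> {malg K[C']})
    (F : {malg K[B']} -> {malg K[C']} -> M) t : bilin F ->
  sweedler F (tmap f g t) = \swd_(x, y <- t) (F (f x) (g y)).
Proof.
move=> Fb; rewrite /tmap lin_swd_out; last exact: lin_swd.
by apply: eq_swd => x y; apply: swd_tens.
Qed.

Lemma swdK (B C : choiceType) (t : {malg K[(B * C)%type]}) :
  \swd_(x, y <- t) (x ⊗ y) = t.
Proof. exact: tmap_id. Qed.

Section Coalgebra.

Variable A : ddData K.
Local Notation Dp := (@dd_prec K A).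
Local Notation Ds := (@dd_succ K A).
Local Notation D := (@dd_cop K A).

Lemma swd_left (f : dd_space A -> dd_space2 A) t :
  \swd_(x, y <- t) \swd_(x1, x2 <- f x) ((x1 ⊗ x2) ⊗ (y : dd_space A))
  = tmap f id t.
Proof.
apply: eq_swd => x y; rewrite -[in RHS](swdK (f x)).
by rewrite (@lin_swd_out _ _ _ _ _ _ (fun z => z ⊗ y)) //; lin_tac.
Qed.

Lemma swd_right (f : dd_space A -> dd_space2 A) t :
  \swd_(x, y <- t) \swd_(y1, y2 <- f y) (((x : dd_space A) ⊗ y1) ⊗ y2)
  = tassoc (tmap id f t).
Proof.
rewrite lin_swd_out; last by lin_tac.
by apply: eq_swd => x y; rewrite tassoc_tens.
Qed.

(** In this form the axioms can be pushed through tensor powers of a morphism and read off slice by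
    slice. *)
Lemma dendriformP : dendriform_coalgebra A <->
  [/\ forall a, tmap Dp id (Dp a) = tassoc (tmap id D (Dp a)),
      forall a, tmap Ds id (Dp a) = tassoc (tmap id Dp (Ds a))
    & forall a, tmap D id (Ds a) = tassoc (tmap id Ds (Ds a))].
Proof.
split=> -[h1 h2 h3]; split=> a.
- exact: (etrans (esym (swd_left Dp (Dp a))) (etrans (h1 a) (swd_right D (Dp a)))).
- exact: (etrans (esym (swd_left Ds (Dp a))) (etrans (h2 a) (swd_right Dp (Ds a)))).
- exact: (etrans (esym (swd_left D (Ds a))) (etrans (h3 a) (swd_right Ds (Ds a)))).
- exact: (etrans (swd_left Dp (Dp a)) (etrans (h1 a) (esym (swd_right D (Dp a))))).
- exact: (etrans (swd_left Ds (Dp a)) (etrans (h2 a) (esym (swd_right Dp (Ds a))))).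
- exact: (etrans (swd_left D (Ds a)) (etrans (h3 a) (esym (swd_right Ds (Ds a))))).
Qed.

End Coalgebra.

Section Homogeneous.

Variables (B C : choiceType) (degB : B -> nat) (degC : C -> nat).

(** The projection onto degree n. Through [homogP], homogeneity becomes a fixed point equation for a
    linear map, stable under sums and linear images. *)
Definition hcomp (E : choiceType) (deg : E -> nat) (n : nat) :
    {malg K[E]} -> {malg K[E]} :=
  linext (fun b => if deg b == n then vect K b else 0).

Lemma lin_hcomp (E : choiceType) (deg : E -> nat) n : lin (hcomp deg n).
Proof. exact: lin_linext. Qed.

Lemma coef_hcomp (E : choiceType) (deg : E -> nat) n x b :
  (hcomp deg n x)@_b = if deg b == n then x@_b else 0.
Proof.
move: x; apply: (@lin_eq _ _ K^o) => [||c].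
- exact: lin_comp (@lin_coef _ _ b) (lin_hcomp _ _).
- by case: (deg b == n); [exact: lin_coef | exact: lin_cst0].
rewrite /hcomp linext_vect coef_vect; case: (eqVneq c b) => [<-|neq_cb].
  by case: eqP => _; rewrite ?coef_vect ?eqxx ?mcoeff0.
rewrite (fun_if (fun z => z@_b)) coef_vect (negbTE neq_cb) mcoeff0.
by do 2!case: ifP.
Qed.

Lemma homogP (E : choiceType) (deg : E -> nat) n (x : {malg K[E]}) :
  homog deg n x <-> hcomp deg n x = x.
Proof.
split=> [hx|<- b].
  apply/malgP=> b; rewrite coef_hcomp; case: eqVneq => // neq.
  by rewrite mcoeff_outdom //; apply: contraNN neq => /hx ->.
by rewrite -mcoeff_neq0 coef_hcomp; case: (deg b =P n) => // _; rewrite eqxx.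
Qed.

Lemma homog_hcomp (E : choiceType) (deg : E -> nat) n (x : {malg K[E]}) :
  homog deg n (hcomp deg n x).
Proof.
by apply/homogP; apply/malgP=> b; rewrite !coef_hcomp; case: (deg b == n).
Qed.

Lemma hcomp_homog (E : choiceType) (deg : E -> nat) m n (x : {malg K[E]}) :
  homog deg m x -> hcomp deg n x = if m == n then x else 0.
Proof.
move=> hx; apply/malgP=> b; rewrite coef_hcomp.
have [xb|xb] := boolP (b \in msupp x); last first.
  by rewrite mcoeff_outdom //; do 2!case: ifP => _; rewrite ?mcoeff0 // mcoeff_outdom.
by rewrite (hx b xb); case: ifP; rewrite ?mcoeff0.
Qed.

Lemma homog_vect (E : choiceType) (deg : E -> nat) b n :
  deg b = n -> homog deg n (vect K b).
Proof.
move=> <- c; rewrite -mcoeff_neq0 coef_vect.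
by case: (b =P c) => [-> //|_]; rewrite eqxx.
Qed.

Lemma homog_sum (E : choiceType) (deg : E -> nat) n (I : Type) (r : seq I)
    (P : pred I) F :
  (forall i, P i -> homog deg n (F i)) ->
  homog deg n (\sum_(i <- r | P i) F i : {malg K[E]}).
Proof.
move=> hF; apply/homogP; rewrite lin_sum; last exact: lin_hcomp.
by apply: eq_bigr => i /hF /homogP.
Qed.

Lemma homogZ (E : choiceType) (deg : E -> nat) n c (x : {malg K[E]}) :
  homog deg n x -> homog deg n (c *: x).
Proof.
by move=> /homogP hx; apply/homogP; rewrite linZ ?hx //; apply: lin_hcomp.
Qed.

Lemma hcomp_lin (f : {malg K[B]} -> {malg K[C]}) : lin f ->
  (forall b, homog degC (degB b) (f (vect K b))) ->
  forall n x, hcomp degC n (f x) = f (hcomp degB n x).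
Proof.
move=> fl fh n; apply: lin_eq => [||b].
- exact: lin_comp (lin_hcomp _ _) fl.
- exact: lin_comp fl (lin_hcomp _ _).
rewrite (hcomp_homog _ (fh b)) /hcomp linext_vect.
by case: eqP => // _; rewrite (lin0 fl).
Qed.

Lemma homog_lin (f : {malg K[B]} -> {malg K[C]}) : lin f ->
  (forall b, homog degC (degB b) (f (vect K b))) ->
  forall n x, homog degB n x -> homog degC n (f x).
Proof.
move=> fl fh n x /homogP hx; apply/homogP.
by rewrite (hcomp_lin fl fh) hx.
Qed.

(** The map f commutes with the projections [hcomp], so being fixed by a projection can be tested
    after f. *)
Lemma homog_lin_inj (f : {malg K[B]} -> {malg K[C]}) : lin f -> injective f ->
  (forall b, homog degC (degB b) (f (vect K b))) ->
  forall n x, homog degC n (f x) -> homog degB n x.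
Proof.
move=> fl finj fh n x /homogP hx; apply/homogP; apply: finj.
by rewrite -(hcomp_lin fl fh).
Qed.

End Homogeneous.

Lemma homog_tens (B C : choiceType) (degB : B -> nat) (degC : C -> nat) m n
    (x : {malg K[B]}) (y : {malg K[C]}) :
  homog degB m x -> homog degC n y ->
  homog (fun p : B * C => degB p.1 + degC p.2)%N (m + n) (x ⊗ y).
Proof.
move=> hx hy -[b c]; rewrite -mcoeff_neq0 coef_tens mulf_eq0 negb_or.
by rewrite !mcoeff_neq0 => /andP[/hx <- /hy <-].
Qed.

Section Transport.

Variables (A B : ddData K) (j : dd_space A -> dd_space B).

Definition dd_morphism : Prop :=
  [/\ lin j,
      forall x y, j (dd_mul x y) = dd_mul (j x) (j y),
      forall x y, j (dd_graft x y) = dd_graft (j x) (j y),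
      forall x, dd_prec (j x) = tmap j j (dd_prec x)
    & forall x, dd_succ (j x) = tmap j j (dd_succ x)].

Definition dd_homogeneous : Prop :=
  forall b, homog (@dd_deg K B) (dd_deg b) (j (vect K b)).

Hypotheses (jm : dd_morphism) (jinj : injective j) (jh : dd_homogeneous).

Lemma tmap_cop : forall x, dd_cop (j x) = tmap j j (dd_cop x).
Proof.
have [_ _ _ jp js] := jm => x.
by rewrite /dd_cop jp js linD //; lin_tac.
Qed.

Lemma tmap3_left (f : dd_space A -> dd_space2 A) (g : dd_space B -> dd_space2 B)
    t : lin f -> lin g -> (forall x, g (j x) = tmap j j (f x)) ->
  tmap (tmap j j) j (tmap f id t) = tmap g id (tmap j j t).
Proof.
have [jl _ _ _ _] := jm => fl gl fg.
have jjl : lin (tmap j j) by lin_tac.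
have idl : lin (fun x : dd_space B => x) by lin_tac.
rewrite (tmap_comp f id t jjl jl) (tmap_comp j j t gl idl).
by apply: eq_tmap => x //=; rewrite fg.
Qed.

Lemma tmap3_right (f : dd_space A -> dd_space2 A) (g : dd_space B -> dd_space2 B)
    t : lin f -> lin g -> (forall x, g (j x) = tmap j j (f x)) ->
  tmap (tmap j j) j (tassoc (tmap id f t)) = tassoc (tmap id g (tmap j j t)).
Proof.
have [jl _ _ _ _] := jm => fl gl fg.
have jjl : lin (tmap j j) by lin_tac.
have idl : lin (fun x : dd_space B => x) by lin_tac.
rewrite -(tassoc_tmap (tmap id f t) jl jl jl) (tmap_comp id f t jl jjl).
rewrite (tmap_comp j j t idl gl).
by apply: (congr1 (@tassoc _ _ _ _)); apply: eq_tmap => x //=; rewrite fg.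
Qed.

#[local] Opaque dd_mul dd_graft dd_prec dd_succ dd_cop sweedler tens tmap tassoc.

(** Each axiom of A, sent to B by j, j ⊗ j or (j ⊗ j) ⊗ j, is the same axiom of B at images under j,
    and these three maps are injective. *)
Lemma transport_dupdend :
  graded_dupdend_bialgebra B -> graded_dupdend_bialgebra A.
Proof.
have [jl jmul jgr jp js] := jm; have jc := tmap_cop.
have jbl y : lin (fun x => j (dd_mul x y)) by lin_tac.
have jjl : lin (tmap j j) by lin_tac.
have jjinj : injective (tmap j j) by apply: tmap_inj.
have j3inj : injective (tmap (tmap j j) j) by apply: tmap_inj.
have jjh p : homog (@dd_deg2 K B) (dd_deg2 p) (tmap j j (vect K p)).
  by case: p => b c; rewrite tmap_vect; apply: homog_tens.
case=> -[dA dG dM] /dendriformP[e1 e2 e3] [c1 c2 c3 c4] [h1 h2 h3 h4].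
have pl : lin (@dd_prec K A) by exact: lin_prec.
have sl : lin (@dd_succ K A) by exact: lin_succ.
have pl' : lin (@dd_prec K B) by exact: lin_prec.
have sl' : lin (@dd_succ K B) by exact: lin_succ.
have cl : lin (@dd_cop K A) by exact: lin_cop.
have cl' : lin (@dd_cop K B) by exact: lin_cop.
split.
- split=> x y z; apply: jinj.
  + apply: (etrans (jmul _ z)); apply: (etrans (congr1 (@dd_mul K B ^~ (j z)) (jmul x y))).
    apply: (etrans (dA _ _ _)); apply: esym; apply: (etrans (jmul x _)).
    exact: (congr1 (@dd_mul K B (j x)) (jmul y z)).
  + apply: (etrans (jgr _ z)); apply: (etrans (congr1 (@dd_graft K B ^~ (j z)) (jgr x y))).
    apply: (etrans (dG _ _ _)); apply: esym; apply: (etrans (jgr x _)).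
    exact: (congr1 (@dd_graft K B (j x)) (jgr y z)).
  + apply: (etrans (jgr _ z)); apply: (etrans (congr1 (@dd_graft K B ^~ (j z)) (jmul x y))).
    apply: (etrans (dM _ _ _)); apply: esym; apply: (etrans (jmul x _)).
    exact: (congr1 (@dd_mul K B (j x)) (jgr y z)).
- apply/dendriformP; split=> a; apply: j3inj.
  + by rewrite (tmap3_left _ pl pl') // (tmap3_right _ cl cl') // -jp e1.
  + by rewrite (tmap3_left _ sl sl') // (tmap3_right _ pl pl') // -jp -js e2.
  + by rewrite (tmap3_left _ cl cl') // (tmap3_right _ sl sl') // -js e3.
- have jjD u v : tmap j j (u + v) = tmap j j u + tmap j j v by exact: linD.
  have jjT u v : tmap j j (u ⊗ v) = j u ⊗ j v by exact: tmap_tens.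
  have congrD (u v w t : dd_space2 B) : u = w -> v = t -> u + v = w + t.
    by move=> -> ->.
  (* Transports one Sweedler term of an axiom; the terms with two nested sums use it twice. *)
  have swdj F F' t t' : t' = tmap j j t -> bilin F' ->
      (forall a b, F' (j a) (j b) = tmap j j (F a b)) ->
    sweedler F' t' = tmap j j (sweedler F t) :> dd_space2 B.
    move=> -> Fb FF; rewrite swd_tmap // (lin_swd_out _ _ jjl).
    exact: eq_swd.
  split=> x y; apply: jjinj.
  + rewrite -[LHS]jp (jmul x y) c1 4!jjD jjT.
    apply: (congrD); [apply: (congrD); [apply: (congrD); [apply: (congrD) => //|]|]|].
    * apply: (swdj) => [||a b]; [exact: jc|by lin_tac|by rewrite jjT jmul].
    * apply: (swdj) => [||a b]; [exact: jp|by lin_tac|by rewrite jjT jmul].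
    * apply: (swdj) => [||a b]; [exact: jp|by lin_tac|by rewrite jjT jmul].
    * apply: (swdj) => [||a b]; [exact: jc|by lin_tac|].
      by apply: (swdj) => [||c d]; [exact: jp|by lin_tac|rewrite jjT !jmul].
  + rewrite -[LHS]js (jmul x y) c2 4!jjD jjT.
    apply: (congrD); [apply: (congrD); [apply: (congrD); [apply: (congrD) => //|]|]|].
    * apply: (swdj) => [||a b]; [exact: jc|by lin_tac|by rewrite jjT jmul].
    * apply: (swdj) => [||a b]; [exact: js|by lin_tac|by rewrite jjT jmul].
    * apply: (swdj) => [||a b]; [exact: js|by lin_tac|by rewrite jjT jmul].
    * apply: (swdj) => [||a b]; [exact: jc|by lin_tac|].
      by apply: (swdj) => [||c d]; [exact: js|by lin_tac|rewrite jjT !jmul].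
  + rewrite -[LHS]jp (jgr x y) c3 4!jjD jjT.
    apply: (congrD); [apply: (congrD); [apply: (congrD); [apply: (congrD) => //|]|]|].
    * apply: (swdj) => [||a b]; [exact: jp|by lin_tac|by rewrite jjT jgr].
    * apply: (swdj) => [||a b]; [exact: jp|by lin_tac|by rewrite jjT jgr].
    * apply: (swdj) => [||a b]; [exact: js|by lin_tac|by rewrite jjT jmul].
    * apply: (swdj) => [||a b]; [exact: js|by lin_tac|].
      by apply: (swdj) => [||c d]; [exact: jp|by lin_tac|rewrite jjT jmul jgr].
  + rewrite -[LHS]js (jgr x y) c4 2!jjD.
    apply: (congrD); [apply: (congrD)|].
    * apply: (swdj) => [||a b]; [exact: js|by lin_tac|by rewrite jjT jgr].
    * apply: (swdj) => [||a b]; [exact: js|by lin_tac|by rewrite jjT jgr].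
    * apply: (swdj) => [||a b]; [exact: js|by lin_tac|].
      by apply: (swdj) => [||c d]; [exact: js|by lin_tac|rewrite jjT jmul jgr].
- split=> [m n x y hx hy|m n x y hx hy|n x hx|n x hx].
  + apply: (homog_lin_inj jl jinj jh); rewrite jmul.
    by apply: h1; apply: (homog_lin jl jh).
  + apply: (homog_lin_inj jl jinj jh); rewrite jgr.
    by apply: h2; apply: (homog_lin jl jh).
  + apply: (homog_lin_inj jjl jjinj jjh); rewrite -jp.
    by apply: h3; apply: (homog_lin jl jh).
  + apply: (homog_lin_inj jjl jjinj jjh); rewrite -js.
    by apply: h4; apply: (homog_lin jl jh).
Qed.

End Transport.

End Morphisms.

(** * Ordered forests *)

Section Ideals.

Variables (V : finType) (e : rel V).
Implicit Types (L S : {set V}) (v w : V).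

(** Edges point towards the roots, so w ranges over the children of v. *)
Definition ideal L : bool :=
  [forall v in L, forall w, e w v ==> (w \in L)].

Lemma idealP L : reflect (forall v w, v \in L -> e w v -> w \in L) (ideal L).
Proof.
apply: (iffP forall_inP) => [h v w vL ewv|h v vL].
  by have /forallP/(_ w)/implyP/(_ ewv) := h v vL.
by apply/forallP=> w; apply/implyP; apply: h.
Qed.

Lemma ideal_connect L v w : ideal L -> connect e w v -> v \in L -> w \in L.
Proof.
move=> /idealP iL /connectP[p]; elim: p w => [w _ -> //|u p IHp w /=].
by move=> /andP[ewu pu] lst vL; apply: iL ewu; apply: IHp.
Qed.

(** The vertices of L closest to the roots: the cut that recovers L. *)
Definition top L : {set V} :=
  [set v in L | [forall w in L, connect e v w ==> (w == v)]].

Lemma topP L v : reflect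
  (v \in L /\ forall w, w \in L -> connect e v w -> w = v) (v \in top L).
Proof.
rewrite inE; apply: (iffP andP) => -[vL h]; split=> //.
  by move=> w wL cvw; apply/eqP; move/forall_inP/(_ w wL)/implyP/(_ cvw): h.
by apply/forall_inP => w wL; apply/implyP => cvw; apply/eqP/h.
Qed.

Lemma leaP S w : reflect (exists2 v, v \in S & connect e w v) (w \in lea e S).
Proof. by rewrite inE; apply: exists_inP. Qed.

Lemma ideal_lea S : ideal (lea e S).
Proof.
apply/idealP=> v w /leaP[s sS cvs] ewv; apply/leaP; exists s => //.
exact: connect_trans (connect1 ewv) cvs.
Qed.

Hypothesis acy : acyclic e.

(** Ranks decrease towards the roots. Among the vertices of L reachable from w, one of minimal rank
    has no proper ancestor in L, hence belongs to [top L]. *)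
Lemma lea_top L : ideal L -> lea e (top L) = L.
Proof.
have [r er] := acyclic_rank acy.
move=> iL; apply/setP=> w; apply/leaP/idP => [[v /topP[vL _] cwv]|wL].
  exact: ideal_connect cwv vL.
have Pw : (w \in L) && connect e w w by rewrite wL connect0.
case: (@arg_minnP _ w (fun v => (v \in L) && connect e w v) r Pw).
move=> v /andP[vL cwv] vmin; exists v => //; apply/topP; split=> // u uL cvu.
apply/eqP/negPn/negP => neq; rewrite eq_sym in neq.
have := rank_connect er cvu neq; rewrite ltnNge vmin //.
by rewrite uL (connect_trans cwv).
Qed.

(** With [lea_top], this makes [lea] and [top] inverse bijections between admissible cuts and
    ideals. *)
Lemma admissible_top S : admissible e S = (top (lea e S) == S).
Proof.
have [r er] := acyclic_rank acy.
apply/idP/eqP => [/forall_inP adm|<-]; last first.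
  apply/forall_inP=> v /topP[_ vmax]; apply/forall_inP=> w /topP[wL _].
  by apply/implyP; apply: contraNN => /(vmax _ wL) ->.
have inL v : v \in S -> v \in lea e S.
  by move=> vS; apply/leaP; exists v => //; apply: connect0.
apply/setP=> v; apply/topP/idP => [[/leaP[s sS cvs] vmax]|vS].
  by rewrite -(vmax s) // inL.
split=> [|w /leaP[s sS cws] cvw]; first exact: inL.
have := adm v vS => /forall_inP/(_ s sS); rewrite (connect_trans cvw cws).
rewrite implybF negbK => /eqP Evs; subst s.
apply/eqP/negPn/negP => neq; have := rank_connect er cws neq.
by rewrite eq_sym in neq; rewrite ltnNge (ltnW (rank_connect er cvw neq)).
Qed.

Definition pideal L : bool := [&& ideal L, L != set0 & L != setT].

Lemma sum_proper_cuts (M : nmodType) (P : pred {set V}) (f : {set V} -> M) :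
  \sum_(S | proper_cut e S && P (lea e S)) f (lea e S)
  = \sum_(L | pideal L && P L) f L.
Proof.
rewrite [RHS](reindex_onto (lea e) top); last first.
  by move=> L /andP[/andP[iL _] _]; apply: lea_top.
apply: eq_bigl => S; rewrite /pideal ideal_lea /= -admissible_top.
have -> : (lea e S != setT) = (roo e S != set0).
  by rewrite /roo -setCT (inj_eq (@setC_inj _)).
rewrite /proper_cut; case: (admissible e S) => /=; last by rewrite andbF.
by rewrite andbT.
Qed.

(** Ideals of a product are pairs of ideals, which fails for proper ideals. The two improper ideals
    split off here produce the isolated terms of the compatibility axioms, such as y ⊗ x; [v0]
    guarantees that they are distinct. *)
Lemma sum_ideals (M : nmodType) (P : pred {set V}) (f : {set V} -> M) (v0 : V) :
  \sum_(L | ideal L && P L) f L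
  = (if P set0 then f set0 else 0) + (if P setT then f setT else 0)
    + \sum_(L | pideal L && P L) f L.
Proof.
have i0 : ideal set0 by apply/idealP=> v w; rewrite inE.
have iT : ideal setT by apply/idealP=> v w; rewrite inE.
have neq : setT != set0 :> {set V} by apply/set0Pn; exists v0; rewrite inE.
rewrite (bigID (fun L => L == set0)) /= -addrA; congr (_ + _).
  case: ifP => P0; last first.
    by apply: big_pred0 => L; case: eqP => [->|]; rewrite ?P0 ?andbF.
  by apply: big_pred1 => L /=; case: (L =P set0) => [->|]; rewrite ?P0 ?i0 ?andbF.
rewrite (bigID (fun L => L == setT)) /=; congr (_ + _); last first.
  apply: eq_bigl => L; rewrite /pideal.
  by case: (ideal L); case: (P L); case: (L == set0); case: (L == setT).
case: ifP => PT; last first.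
  by apply: big_pred0 => L; case: (L =P setT) => [->|]; rewrite ?PT ?andbF.
apply: big_pred1 => L /=.
by case: (L =P setT) => [->|]; rewrite ?PT ?iT ?neq ?andbF.
Qed.

End Ideals.

(** * Ordered forests and their sub-forests in terms of natural numbers *)

Section Values.

Variable n : nat.
Implicit Types A : {set 'I_n}.

(** Increasing lists of naturals can be compared across the ordinal types of different forests. *)
Definition vals A : seq nat := map val (enum A).

Lemma size_vals A : size (vals A) = #|A|.
Proof. by rewrite size_map -cardE. Qed.

Lemma vals_sorted A : sorted ltn (vals A).
Proof.
rewrite /vals sorted_map /enum_mem; apply: sorted_filter.
  by move=> x y z; apply: ltn_trans.
by rewrite -enumT -sorted_map val_enum_ord iota_ltn_sorted.
Qed.

Lemma uniq_vals A : uniq (vals A).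
Proof. by rewrite map_inj_uniq ?enum_uniq //; apply: val_inj. Qed.

Lemma mem_vals A (i : 'I_n) : (val i \in vals A) = (i \in A).
Proof. by rewrite mem_map ?mem_enum //; apply: val_inj. Qed.

Lemma vals_lt A i : i \in vals A -> (i < n)%N.
Proof. by case/mapP=> k _ ->; apply: ltn_ord. Qed.

Lemma vals_eq A s : sorted ltn s -> (forall i, (i < n)%N || (i \notin s)) ->
  (forall i : 'I_n, (val i \in s) = (i \in A)) -> vals A = s.
Proof.
move=> ss sn sA; apply: (irr_sorted_eq ltn_trans ltnn (vals_sorted A) ss) => i.
have [lt_in|ge_in] := ltnP i n; first by rewrite (mem_vals A (Ordinal lt_in)) -sA.
have := sn i; rewrite ltnNge ge_in /= => /negbTE ->.
by apply/negP=> /vals_lt; rewrite ltnNge ge_in.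
Qed.

Lemma vals_setT : vals setT = iota 0 n.
Proof. by rewrite /vals enum_setT -enumT val_enum_ord. Qed.

End Values.

Section Pgraph.

Implicit Types F G : pgraph.

(** The parent function on all naturals, with [None] past the last vertex: by [pgraph_eq], forests
    are compared without casts between ordinals. *)
Definition npar F (i : nat) : option nat :=
  if insub i : option 'I_(tag F).+1 is Some k then omap val (tagged F k)
  else None.

Lemma npar_ord F (k : 'I_(tag F).+1) : npar F k = omap val (tagged F k).
Proof. by rewrite /npar valK. Qed.

Lemma npar_ge F i : (tag F < i)%N -> npar F i = None.
Proof. by move=> lt_Fi; rewrite /npar insubN // -leqNgt. Qed.

Lemma npar_lt F i y : npar F i = Some y -> (y < (tag F).+1)%N.
Proof.
by rewrite /npar; case: insubP => // k _ _; case: (tagged F k) => //= z [<-].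
Qed.

Lemma pgraph_eq F G : tag F = tag G -> (forall i, npar F i = npar G i) -> F = G.
Proof.
case: F G => n f [m g] /= Enm; subst m => Efg; congr existT.
apply/ffunP=> k; have := Efg k; rewrite !npar_ord /=.
by case: (f k) (g k) => [x|] [y|] //= [] /val_inj ->.
Qed.

Lemma npar_mul F G i : npar (pgraph_mul F G) i =
  if (i < (tag F).+1)%N then npar F i
  else omap (addn (tag F).+1) (npar G (i - (tag F).+1)).
Proof.
have [lt_i|ge_i] := ltnP i ((tag F).+1 + (tag G).+1); last first.
  rewrite npar_ge // ltnNge (leq_trans (leq_addr _ _) ge_i) /= npar_ge //.
  by rewrite ltn_subRL -addnS.
rewrite (npar_ord (F := pgraph_mul F G) (Ordinal lt_i)) /= ffunE.
case: splitP => k /= ->; first by rewrite ltn_ord npar_ord; case: (tagged F k).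
by rewrite ltnNge leq_addr addKn npar_ord /=; case: (tagged G k).
Qed.

Lemma npar_graft F G i : npar (pgraph_graft F G) i =
  if (i < (tag F).+1)%N then npar F i
  else if (i < (tag F).+1 + (tag G).+1)%N then
    Some (if npar G (i - (tag F).+1) is Some k then ((tag F).+1 + k)%N else tag F)
  else None.
Proof.
have [lt_i|ge_i] := ltnP i ((tag F).+1 + (tag G).+1); last first.
  by rewrite npar_ge // ltnNge (leq_trans _ ge_i) ?leq_addr.
rewrite (npar_ord (F := pgraph_graft F G) (Ordinal lt_i)) /= ffunE.
case: splitP => k /= ->; first by rewrite ltn_ord npar_ord; case: (tagged F k).
by rewrite ltnNge leq_addr addKn npar_ord /=; case: (tagged G k).
Qed.

(** Renumbers a parent by its rank among the kept vertices s; a parent outside s is forgotten, which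
    creates a root. *)
Definition relabel (s : seq nat) : option nat -> option nat :=
  obind (fun y => if y \in s then Some (index y s) else None).

Lemma npar_sub F (A : {set 'I_(tag F).+1}) i : A != set0 ->
  npar (pgraph_sub A) i =
  if (i < size (vals A))%N then relabel (vals A) (npar F (nth 0%N (vals A) i))
  else None.
Proof.
rewrite -card_gt0 size_vals => A_gt0.
have [lt_i|ge_i] := ltnP i #|A|; last by rewrite npar_ge //= prednK.
have lt_i' : (i < (#|A|.-1).+1)%N by rewrite prednK.
rewrite (npar_ord (F := pgraph_sub A) (Ordinal lt_i')) /= ffunE /=.
rewrite (nth_map ord0) -?cardE // (npar_ord (F := F)).
case: (tagged F _) => [y|] //=; rewrite mem_vals; case: ifP => //= yA.
rewrite inordK ?index_map //; first exact: val_inj.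
by rewrite prednK // cardE index_mem mem_enum.
Qed.

Lemma tag_sub F (A : {set 'I_(tag F).+1}) :
  tag (pgraph_sub A) = (size (vals A)).-1.
Proof. by rewrite size_vals. Qed.

End Pgraph.

(** * Restriction of products and grafts to a set of vertices *)

Section Blocks.

Variables m n : nat.
Implicit Types (A : {set 'I_m}) (B : {set 'I_n}).

(** A set of vertices of a product or of a graft, given by its traces on the two forests. *)
Definition blocks A B : {set 'I_(m + n)} :=
  (@lshift m n @: A) :|: (@rshift m n @: B).

Lemma blocks_l A B i : (lshift n i \in blocks A B) = (i \in A).
Proof.
rewrite in_setU (mem_imset _ _ (@lshift_inj m n)).
case: imsetP => [[j _] /(congr1 val) /= E|_]; last exact: orbF.
by have := ltn_ord i; rewrite E ltnNge leq_addr.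
Qed.

Lemma blocks_r A B i : (rshift m i \in blocks A B) = (i \in B).
Proof.
rewrite in_setU (mem_imset _ _ (@rshift_inj m n)).
case: imsetP => [[j _] /(congr1 val) /= E|_ //].
by have := ltn_ord j; rewrite -E ltnNge leq_addr.
Qed.

Lemma blocks_eq (S : {set 'I_(m + n)}) A B :
  (forall i, (lshift n i \in S) = (i \in A)) ->
  (forall i, (rshift m i \in S) = (i \in B)) -> S = blocks A B.
Proof.
move=> hl hr; apply/setP=> i.
by case: (split_ordP i) => j ->; rewrite ?hl ?hr ?blocks_l ?blocks_r.
Qed.

Lemma blocksC A B : ~: blocks A B = blocks (~: A) (~: B).
Proof. by apply: blocks_eq => i; rewrite !in_setC ?blocks_l ?blocks_r. Qed.

Lemma blocks0 : blocks set0 set0 = set0.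
Proof. by apply/esym/blocks_eq => i; rewrite !in_set0. Qed.

Lemma blocksT : blocks setT setT = setT.
Proof. by apply/esym/blocks_eq => i; rewrite !in_setT. Qed.

Lemma blocks_inj A A' B B' : blocks A B = blocks A' B' -> A = A' /\ B = B'.
Proof.
move=> E; split; apply/setP=> i.
  by rewrite -(blocks_l A B) E blocks_l.
by rewrite -(blocks_r A B) E blocks_r.
Qed.

Lemma sum_blocks (M : nmodType) (P : pred {set 'I_(m + n)}) f :
  \sum_(S | P S) f S
  = \sum_A \sum_(B | P (blocks A B)) f (blocks A B) :> M.
Proof.
rewrite pair_big_dep /=.
rewrite (reindex_onto (fun p : {set 'I_m} * {set 'I_n} => blocks p.1 p.2)
  (fun S => (@lshift m n @^-1: S, @rshift m n @^-1: S))) => /=.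
  apply: eq_bigl => -[A B] /=; apply: andb_idr => _; apply/eqP; congr pair.
    by apply/setP=> i; rewrite inE blocks_l.
  by apply/setP=> i; rewrite inE blocks_r.
by move=> S _; symmetry; apply: blocks_eq => i; rewrite inE.
Qed.

Lemma vals_blocks A B : vals (blocks A B) = vals A ++ map (addn m) (vals B).
Proof.
apply: vals_eq => [|i|i].
- rewrite (sorted_pairwise ltn_trans) pairwise_cat -!(sorted_pairwise ltn_trans).
  rewrite vals_sorted /= sorted_map; apply/andP; split; last first.
    by apply: sub_sorted (vals_sorted B) => x y /=; rewrite ltn_add2l.
  apply/allrelP=> x _ /vals_lt lt_x /mapP[y _ ->].
  exact: leq_trans lt_x (leq_addr _ _).
- have [//|ge_i] := ltnP i (m + n); rewrite mem_cat negb_or.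
  apply/andP; split.
    by apply/negP=> /vals_lt; rewrite ltnNge (leq_trans (leq_addr _ _) ge_i).
  apply/negP=> /mapP[y /vals_lt lt_y Ei].
  by move: ge_i; rewrite Ei leq_add2l leqNgt lt_y.
rewrite mem_cat; case: (split_ordP i) => j -> /=.
  rewrite blocks_l mem_vals; case: (j \in A) => //=.
  by apply/mapP=> -[y _ E]; have := ltn_ord j; rewrite E ltnNge leq_addr.
rewrite blocks_r mem_map; last exact: addnI.
rewrite mem_vals orbC; case: (j \in B) => //=.
by apply/negP=> /vals_lt; rewrite ltnNge leq_addr.
Qed.

End Blocks.

Section RelabelBlocks.

Variables (m : nat) (s1 s2 : seq nat).
Hypothesis s1_lt : {in s1, forall i, (i < m)%N}.

Lemma relabel_catl o : (forall y, o = Some y -> (y < m)%N) ->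
  relabel (s1 ++ map (addn m) s2) o = relabel s1 o.
Proof.
case: o => //= y /(_ y erefl) lt_y; rewrite mem_cat index_cat.
case: (y \in s1) => //=; case: mapP => // -[z _ E].
by move: lt_y; rewrite E ltnNge leq_addr.
Qed.

Lemma relabel_catr o :
  relabel (s1 ++ map (addn m) s2) (omap (addn m) o)
  = omap (addn (size s1)) (relabel s2 o).
Proof.
case: o => //= y; rewrite mem_cat index_cat.
have /negbTE -> /= : (m + y)%N \notin s1.
  by apply/negP=> /s1_lt; rewrite ltnNge leq_addr.
rewrite mem_map ?index_map; try exact: addnI.
by case: ifP.
Qed.

End RelabelBlocks.

(** The greatest vertex of F stays the greatest one in every sub-forest that contains it, so the
    grafting point survives restriction. *)
Lemma index_vals_max n (A : {set 'I_n.+1}) :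
  ord_max \in A -> index n (vals A) = (size (vals A)).-1.
Proof.
rewrite -mem_vals /= => nA.
have sA : (0 < size (vals A))%N by case: (vals A) nA.
apply/eqP; rewrite eqn_leq -ltnS prednK // index_mem nA /= leqNgt.
apply/negP=> lt_n.
have lt_p : ((size (vals A)).-1 < size (vals A))%N by rewrite ltn_predL.
have := sorted_ltn_nth ltn_trans 0%N (vals_sorted A) (index n (vals A)) _ _ lt_p lt_n.
rewrite inE index_mem nth_index // => /(_ nA).
have := vals_lt (mem_nth 0%N lt_p); rewrite ltnS leqNgt => /negP; exact.
Qed.

Section SubBlocks.

Variables F G : pgraph.
Local Notation m := (tag F).+1.
Local Notation n := (tag G).+1.
Implicit Types (A : {set 'I_m}) (B : {set 'I_n}).

Lemma sub_mul A B : A != set0 -> B != set0 ->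
  @pgraph_sub (pgraph_mul F G) (blocks A B)
  = pgraph_mul (pgraph_sub A) (pgraph_sub B).
Proof.
move=> A0 B0; have AB0 : blocks A B != set0.
  case/set0Pn: A0 => i iA; apply/set0Pn; exists (lshift n i).
  by rewrite blocks_l.
have sA : (0 < size (vals A))%N by rewrite size_vals card_gt0.
have sB : (0 < size (vals B))%N by rewrite size_vals card_gt0.
have ltA : {in vals A, forall i, (i < m)%N} by move=> i /vals_lt.
have vAB : @vals (tag (pgraph_mul F G)).+1 (blocks A B)
    = vals A ++ map (addn m) (vals B) by exact: (vals_blocks A B).
have tAB : tag (@pgraph_sub (pgraph_mul F G) (blocks A B))
    = tag (pgraph_mul (pgraph_sub A) (pgraph_sub B)).
  rewrite (@tag_sub (pgraph_mul F G) (blocks A B)) vAB size_cat size_map [RHS]/= -!size_vals.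
  by rewrite prednK // -[in LHS](prednK sA).
apply: pgraph_eq => // i; rewrite (@npar_sub (pgraph_mul F G) (blocks A B)) //.
rewrite [RHS]npar_mul !tag_sub prednK //.
rewrite !npar_sub // vAB size_cat size_map nth_cat.
have [lt_i|ge_i] := ltnP i (size (vals A)).
  rewrite ltn_addr // npar_mul ltA ?mem_nth // relabel_catl // => y.
  exact: npar_lt.
rewrite -ltn_subLR //; case: ifP => // lt_i; rewrite (nth_map 0%N) //.
by rewrite npar_mul ltnNge leq_addr addKn relabel_catr.
Qed.

(** Without the grafting vertex the roots of G lose their new parent, and the graft degenerates into
    a product. This is the origin of the products in the axioms for ↖. *)
Lemma sub_graft_mul A B : A != set0 -> B != set0 -> ord_max \notin A ->
  @pgraph_sub (pgraph_graft F G) (blocks A B)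
  = pgraph_mul (pgraph_sub A) (pgraph_sub B).
Proof.
move=> A0 B0 gA; have AB0 : blocks A B != set0.
  case/set0Pn: A0 => i iA; apply/set0Pn; exists (lshift n i).
  by rewrite blocks_l.
have sA : (0 < size (vals A))%N by rewrite size_vals card_gt0.
have sB : (0 < size (vals B))%N by rewrite size_vals card_gt0.
have ltA : {in vals A, forall i, (i < m)%N} by move=> i /vals_lt.
have vAB : @vals (tag (pgraph_graft F G)).+1 (blocks A B)
    = vals A ++ map (addn m) (vals B) by exact: (vals_blocks A B).
have tAB : tag (@pgraph_sub (pgraph_graft F G) (blocks A B))
    = tag (pgraph_mul (pgraph_sub A) (pgraph_sub B)).
  rewrite (@tag_sub (pgraph_graft F G) (blocks A B)) vAB size_cat size_map [RHS]/= -!size_vals.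
  by rewrite prednK // -[in LHS](prednK sA).
apply: pgraph_eq => // i; rewrite (@npar_sub (pgraph_graft F G) (blocks A B)) //.
rewrite npar_mul !tag_sub prednK //.
rewrite !npar_sub // vAB size_cat size_map nth_cat.
have [lt_i|ge_i] := ltnP i (size (vals A)).
  rewrite ltn_addr // npar_graft ltA ?mem_nth // relabel_catl // => y.
  exact: npar_lt.
rewrite -ltn_subLR //; case: ifP => // lt_i; rewrite (nth_map 0%N) //.
rewrite npar_graft ltnNge leq_addr addKn ltn_add2l (vals_lt (mem_nth _ lt_i)).
set o := npar G _.
have -> : Some (if o is Some k then (m + k)%N else tag F)
    = if o is Some _ then omap (addn m) o else Some (tag F) by case: (o).
case Eo : o => [k|]; first by rewrite -Eo relabel_catr.
rewrite [RHS]/= relabel_catl => [|y [<-] //].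
by rewrite /= (mem_vals A ord_max) (negbTE gA).
Qed.

(** B has to be closed under parents: a vertex of B whose parent is deleted is a root on the
    left-hand side, but would be grafted on the right-hand side. *)
Lemma sub_graft A B : ord_max \in A -> B != set0 ->
  (forall i k, i \in vals B -> npar G i = Some k -> k \in vals B) ->
  @pgraph_sub (pgraph_graft F G) (blocks A B)
  = pgraph_graft (pgraph_sub A) (pgraph_sub B).
Proof.
move=> gA B0 coB.
have A0 : A != set0 by apply/set0Pn; exists ord_max.
have AB0 : blocks A B != set0.
  by apply/set0Pn; exists (lshift n ord_max); rewrite blocks_l.
have sA : (0 < size (vals A))%N by rewrite size_vals card_gt0.
have sB : (0 < size (vals B))%N by rewrite size_vals card_gt0.
have ltA : {in vals A, forall i, (i < m)%N} by move=> i /vals_lt.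
have vAB : @vals (tag (pgraph_graft F G)).+1 (blocks A B)
    = vals A ++ map (addn m) (vals B) by exact: (vals_blocks A B).
have tAB : tag (@pgraph_sub (pgraph_graft F G) (blocks A B))
    = tag (pgraph_graft (pgraph_sub A) (pgraph_sub B)).
  rewrite (@tag_sub (pgraph_graft F G) (blocks A B)) vAB size_cat size_map [RHS]/= -!size_vals.
  by rewrite prednK // -[in LHS](prednK sA).
apply: pgraph_eq => // i; rewrite (@npar_sub (pgraph_graft F G) (blocks A B)) //.
rewrite [RHS]npar_graft !tag_sub !prednK //.
rewrite !npar_sub // vAB size_cat size_map nth_cat.
have [lt_i|ge_i] := ltnP i (size (vals A)).
  rewrite ltn_addr // npar_graft ltA ?mem_nth // relabel_catl // => y.
  exact: npar_lt.
rewrite -ltn_subLR //; case: ifP => // lt_i; rewrite (nth_map 0%N) //.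
rewrite npar_graft ltnNge leq_addr addKn ltn_add2l (vals_lt (mem_nth _ lt_i)).
case Eo : (npar G _) => [k|].
  have kB : k \in vals B by apply: (coB _ _ _ Eo); apply: mem_nth.
  by rewrite (relabel_catr (vals B) ltA (Some k)) /= kB.
rewrite relabel_catl => [|y [<-] //].
by rewrite /= (mem_vals A ord_max) gA index_vals_max.
Qed.

(** P abstracts over the product and the graft, which have the same parents on F. *)
Lemma sub_l P A : tag P = (tag F + n)%N -> A != set0 ->
  (forall i, (i < m)%N -> npar P i = npar F i) ->
  forall S : {set 'I_(tag P).+1}, vals S = vals A ->
  pgraph_sub S = pgraph_sub A.
Proof.
move=> tP A0 hP S vS.
have S0 : S != set0 by rewrite -card_gt0 -size_vals vS size_vals card_gt0.
apply: pgraph_eq => [|i]; first by rewrite !tag_sub vS.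
rewrite !npar_sub // vS; case: ifP => // lt_i; rewrite hP //.
exact: vals_lt (mem_nth _ lt_i).
Qed.

(** P abstracts again over both operations: a root of G may acquire a parent, but only among the
    vertices of F, where B does not see it. *)
Lemma sub_r P B : B != set0 ->
  (forall i k, (i < n)%N -> npar G i = Some k -> npar P (m + i) = Some (m + k)%N) ->
  (forall i k, (i < n)%N -> npar G i = None -> npar P (m + i) = Some k -> (k < m)%N) ->
  forall S : {set 'I_(tag P).+1}, vals S = map (addn m) (vals B) ->
  pgraph_sub S = pgraph_sub B.
Proof.
move=> B0 hP hP' S vS.
have sS : size (vals S) = size (vals B) by rewrite vS size_map.
have S0 : S != set0 by rewrite -card_gt0 -size_vals sS size_vals card_gt0.
apply: pgraph_eq => [|i]; first by rewrite !tag_sub sS.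
rewrite !npar_sub // sS; case: ifP => // lt_i.
have lt_n := vals_lt (mem_nth 0%N lt_i).
rewrite vS (nth_map 0%N) //; case Eo: (npar G _) => [k|].
  have h0 : {in [::], forall j, (j < m)%N} by [].
  rewrite (hP _ _ lt_n Eo); apply: etrans (relabel_catr (vals B) h0 (Some k)) _.
  by case: (relabel _ _).
case Ep: (npar P _) => [k|] //.
have := hP' _ _ lt_n Eo Ep => lt_k.
by rewrite (@relabel_catl m [::] _ (Some k)) // => y [<-].
Qed.

Lemma sub_mull A : A != set0 ->
  @pgraph_sub (pgraph_mul F G) (blocks A (set0 : {set 'I_n})) = pgraph_sub A.
Proof.
move=> A0; apply: sub_l => // [i lt_i|]; first by rewrite npar_mul lt_i.
by rewrite (vals_blocks A (set0 : {set 'I_n})) /vals enum_set0 cats0.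
Qed.

Lemma sub_graftl A : A != set0 ->
  @pgraph_sub (pgraph_graft F G) (blocks A (set0 : {set 'I_n})) = pgraph_sub A.
Proof.
move=> A0; apply: sub_l => // [i lt_i|]; first by rewrite npar_graft lt_i.
by rewrite (vals_blocks A (set0 : {set 'I_n})) /vals enum_set0 cats0.
Qed.

Lemma sub_mulr B : B != set0 ->
  @pgraph_sub (pgraph_mul F G) (blocks (set0 : {set 'I_m}) B) = pgraph_sub B.
Proof.
move=> B0; apply: sub_r => // [i k lt_i E|i k lt_i E|].
- by rewrite npar_mul ltnNge leq_addr addKn E.
- by rewrite npar_mul ltnNge leq_addr addKn E.
by rewrite (vals_blocks (set0 : {set 'I_m}) B) /vals enum_set0.
Qed.

Lemma sub_graftr B : B != set0 ->
  @pgraph_sub (pgraph_graft F G) (blocks (set0 : {set 'I_m}) B) = pgraph_sub B.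
Proof.
move=> B0; apply: sub_r => // [i k lt_i E|i k lt_i E|].
- by rewrite npar_graft ltnNge leq_addr addKn E ltn_add2l lt_i.
- by rewrite npar_graft ltnNge leq_addr addKn E ltn_add2l lt_i => -[<-].
by rewrite (vals_blocks (set0 : {set 'I_m}) B) /vals enum_set0.
Qed.

End SubBlocks.

(** * Sub-forests of sub-forests *)

Section SubSub.

Implicit Types F G : pgraph.

Lemma sub_setT F : @pgraph_sub F setT = F.
Proof.
have T0 : setT != set0 :> {set 'I_(tag F).+1} by apply/set0Pn; exists ord0.
apply: pgraph_eq => [|i]; first by rewrite tag_sub vals_setT size_iota.
rewrite npar_sub // vals_setT size_iota; case: ltnP => [lt_i|ge_i]; last first.
  by rewrite npar_ge.
rewrite nth_iota // add0n; case E: (npar F i) => [y|//].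
have lt_y := npar_lt E; rewrite /relabel /obind /oapp mem_iota add0n lt_y.
have Ey : nth 0%N (iota 0 (tag F).+1) y = y by rewrite nth_iota.
by rewrite -[in index y _]Ey index_uniq ?size_iota ?iota_uniq.
Qed.

(** Vertices of [pgraph_sub A] are positions in [enum A]; this goes back to vertices of F. *)
Definition lift_set F (A : {set 'I_(tag F).+1})
    (B : {set 'I_(tag (pgraph_sub A)).+1}) : {set 'I_(tag F).+1} :=
  (fun i : 'I_(tag (pgraph_sub A)).+1 => nth ord0 (enum A) i) @: B.

Lemma nth_vals F (A : {set 'I_(tag F).+1}) i :
  (i < #|A|)%N -> val (nth ord0 (enum A) i) = nth 0%N (vals A) i.
Proof. by move=> lt_i; rewrite (nth_map ord0) // -cardE. Qed.

Lemma vals_lift F (A : {set 'I_(tag F).+1}) (B : {set 'I_(tag (pgraph_sub A)).+1}) :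
  A != set0 -> vals (lift_set B) = map (nth 0%N (vals A)) (vals B).
Proof.
rewrite -card_gt0 => A0.
have ltB (i : 'I_(tag (pgraph_sub A)).+1) : (i < #|A|)%N.
  by rewrite -[X in (_ < X)%N](prednK A0) ltn_ord.
apply: vals_eq => [|i|i].
- rewrite (homo_sorted_in (e := ltn) (P := [pred i | (i < #|A|)%N])) ?vals_sorted //.
    move=> x y; rewrite !inE => ltx lty /= lt_xy.
    by apply: (sorted_ltn_nth ltn_trans _ (vals_sorted A)); rewrite ?inE ?size_vals.
  by apply/allP=> x /mapP[y _ ->]; apply: ltB.
- rewrite -implyNb -leqNgt; apply/implyP=> ge_i; apply/negP=> /mapP[j /mapP[k _ ->]].
  move=> Ei; move: ge_i; rewrite Ei leqNgt => /negP; apply.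
  by rewrite -nth_vals ?ltB ?ltn_ord.
apply/mapP/imsetP => [[j /mapP[k]]|[k kB ->]].
  rewrite mem_enum => kB -> E; exists k => //; apply: val_inj.
  exact: etrans E (esym (nth_vals (ltB k))).
by exists (val k); rewrite ?mem_vals // nth_vals.
Qed.

Lemma sub_sub F (A : {set 'I_(tag F).+1}) (B : {set 'I_(tag (pgraph_sub A)).+1}) :
  A != set0 -> B != set0 -> pgraph_sub B = pgraph_sub (lift_set B).
Proof.
move=> A0 B0; have vL := vals_lift B A0.
have L0 : lift_set B != set0.
  by case/set0Pn: B0 => i iB; apply/set0Pn; exists (nth ord0 (enum A) i); apply: imset_f.
have ltB i : i \in vals B -> (i < size (vals A))%N.
  by move=> /vals_lt; rewrite tag_sub prednK // size_vals card_gt0.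
apply: pgraph_eq => [|i].
  by rewrite (tag_sub B) (tag_sub (lift_set B)) vL size_map.
rewrite (npar_sub _ L0) vL size_map (npar_sub _ B0); case: ifP => // lt_i.
have lt_ni := ltB _ (mem_nth 0%N lt_i).
rewrite (nth_map 0%N) // npar_sub // lt_ni.
case: (npar F _) => [y|] //=; case: ifP => [yA|yA]; last first.
  case: ifP => // /mapP[j /ltB jB Ey].
  by rewrite Ey mem_nth // in yA.
have inj : {in vals B &, injective (nth 0%N (vals A))}.
  by move=> j k /ltB ltj /ltB ltk E; apply/eqP; rewrite -(nth_uniq 0%N ltj ltk (uniq_vals A)) E.
have Ey : y = nth 0%N (vals A) (index y (vals A)) by rewrite nth_index.
have idx : (y \in map (nth 0%N (vals A)) (vals B)) = (index y (vals A) \in vals B).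
  apply/mapP/idP => [[j jB E]|iB]; last by exists (index y (vals A)).
  by rewrite E index_uniq ?uniq_vals // ltB.
rewrite /= idx; case: ifP => // iB; congr Some.
(* What remains is that mapping a function, injective on the list, preserves the index of an
   element. *)
rewrite [in RHS]Ey; have := iB; move: (index y _) => j {iB} jB.
move: inj jB; elim: (vals B) => //= k s IHs inj jB.
case: (k =P j) => [->|neq]; first by rewrite eqxx.
case: eqP => [E|_]; first by case: neq; apply: inj; rewrite ?mem_head.
congr S; apply: IHs.
  by move=> a b as_ bs; apply: inj; rewrite inE ?as_ ?bs orbT.
by move: jB; rewrite inE eq_sym (introF eqP neq).
Qed.

End SubSub.

Lemma sum_split (M : nmodType) (I : finType) (P Q : pred I) (f : I -> M) :
  \sum_(i | P i) f i = \sum_(i | P i && Q i) f i + \sum_(i | P i && ~~ Q i) f i.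
Proof. exact: bigID. Qed.

(** * Half-coproducts of ordered forests as sums over ideals *)

Section OrderedForests.

Variable K : fieldType.
Implicit Types F G : oforest.

Lemma edge_npar (P : pgraph) (w v : 'I_(tag P).+1) :
  @pgraph_edge P w v = (npar P w == Some (val v)).
Proof.
by rewrite /pgraph_edge npar_ord; case: (tagged P w).
Qed.

(** One formula for three maps: P is [id] for the left half-coproduct, [negb] for the right one, and
    [predT] for their sum. *)
Definition cutsum (P : pred bool) F : {malg K[(oforest * oforest)%type]} :=
  \sum_(L | pideal (@oedge F) L && P (ogreatest F \in L))
    vect K (osub L, osub (~: L)).

Definition osplit (P : pred bool) : dd_space (Ho K) -> dd_space2 (Ho K) :=
  linext (cutsum P).

Lemma lin_osplit P : lin (osplit P). Proof. exact: lin_linext. Qed.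

Lemma osplit_vect P F : osplit P (vect K F) = cutsum P F.
Proof. exact: linext_vect. Qed.

Lemma prec_osplit x : @dd_prec K (Ho K) x = osplit id x.
Proof.
apply: (lin_eq (@lin_prec K (Ho K)) (lin_osplit id)) => F.
apply: (etrans (linext_vect (@dd_prec0 K (Ho K)) F)).
apply: etrans (esym (osplit_vect id F)).
exact: (sum_proper_cuts (valP F) (fun L => ogreatest F \in L)
         (fun L => vect K (osub L, osub (~: L)))).
Qed.

Lemma succ_osplit x : @dd_succ K (Ho K) x = osplit negb x.
Proof.
apply: (lin_eq (@lin_succ K (Ho K)) (lin_osplit negb)) => F.
apply: (etrans (linext_vect (@dd_succ0 K (Ho K)) F)).
apply: etrans (esym (osplit_vect negb F)).
apply: (etrans (sum_proper_cuts (valP F) (fun L => ogreatest F \in ~: L)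
         (fun L => vect K (osub L, osub (~: L))))).
by apply: eq_bigl => L; rewrite in_setC.
Qed.

Lemma cop_osplit x : @dd_cop K (Ho K) x = osplit predT x.
Proof.
rewrite /dd_cop prec_osplit succ_osplit; move: x.
apply: (lin_eq (lin_add (lin_osplit id) (lin_osplit negb)) (lin_osplit predT)) => F.
rewrite 3!osplit_vect; apply: esym.
refine (etrans (sum_split (fun L => pideal (@oedge F) L && true)
  (fun L => ogreatest F \in L) (fun L => vect K (osub L, osub (~: L)))) _).
by congr (_ + _); apply: eq_bigl => L; rewrite andbT.
Qed.

End OrderedForests.

Section Lift.

Variables (F : pgraph) (A : {set 'I_(tag F).+1}).
Hypothesis A0 : A != set0.
Local Notation I := 'I_(tag (pgraph_sub A)).+1.
Implicit Types (B : {set I}) (X : {set 'I_(tag F).+1}).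

Definition emb (i : I) : 'I_(tag F).+1 := nth ord0 (enum A) i.

Lemma sub_ord_lt (i : I) : (i < #|A|)%N.
Proof.
by rewrite -[X in (_ < X)%N]prednK ?card_gt0 // ltn_ord.
Qed.

Lemma emb_inj : injective emb.
Proof.
move=> i j E; apply: val_inj; apply/eqP.
have := nth_uniq ord0 (s := enum A) (i := i) (j := j).
by rewrite -cardE !sub_ord_lt enum_uniq => <- //; apply/eqP.
Qed.

Lemma emb_in i : emb i \in A.
Proof. by rewrite -mem_enum mem_nth // -cardE sub_ord_lt. Qed.

Lemma emb_onto x : x \in A -> exists i, emb i = x.
Proof.
move=> xA; have lt_x : (index x (enum A) < (tag (pgraph_sub A)).+1)%N.
  by rewrite /= prednK ?card_gt0 // cardE index_mem mem_enum.
by exists (Ordinal lt_x); rewrite /emb nth_index ?mem_enum.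
Qed.

Lemma mem_lift B i : (emb i \in lift_set B) = (i \in B).
Proof. exact: (mem_imset _ _ emb_inj). Qed.

Lemma lift_sub B : lift_set B \subset A.
Proof. by apply/subsetP=> x /imsetP[i _ ->]; apply: emb_in. Qed.

Lemma lift_eq B X : X \subset A -> (forall i, (emb i \in X) = (i \in B)) ->
  lift_set B = X.
Proof.
move=> XA BX; apply/setP=> x; apply/imsetP/idP => [[i iB ->]|xX].
  by have := BX i; rewrite iB => ->.
have [i Ei] := emb_onto (subsetP XA x xX); exists i; last by rewrite -Ei.
by rewrite -BX Ei.
Qed.

Lemma lift_setC B : lift_set (~: B) = A :\: lift_set B.
Proof.
apply: lift_eq => [|i]; first exact: subsetDl.
by rewrite in_setD mem_lift emb_in andbT in_setC.
Qed.

Lemma lift_set0 : lift_set (set0 : {set I}) = set0.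
Proof. by apply: lift_eq => [|i]; rewrite ?sub0set ?in_set0. Qed.

Lemma lift_setT : lift_set (setT : {set I}) = A.
Proof. by apply: lift_eq => // i; rewrite emb_in in_setT. Qed.

Lemma lift_inj : injective (@lift_set F A).
Proof. by move=> B C E; apply/setP=> i; rewrite -!mem_lift E. Qed.

Lemma lift_neq0 B : (lift_set B != set0) = (B != set0).
Proof. by rewrite -lift_set0 (inj_eq lift_inj). Qed.

Lemma lift_proper B : (lift_set B \proper A) = (B != setT).
Proof. by rewrite properEneq lift_sub andbT -[X in _ != X]lift_setT (inj_eq lift_inj). Qed.

Lemma sum_lift (M : nmodType) (P : pred {set 'I_(tag F).+1}) f :
  \sum_(B : {set I} | P (lift_set B)) f (lift_set B)
  = \sum_(X : {set 'I_(tag F).+1} | (X \subset A) && P X) f X :> M.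
Proof.
rewrite [RHS](reindex_onto (@lift_set F A) (fun X => [set i | emb i \in X])) => [|X /andP[XA _]].
  apply: eq_bigl => B; rewrite lift_sub /=; apply/esym/andb_idr => _.
  by apply/eqP/setP=> i; rewrite inE mem_lift.
by apply: lift_eq => // i; rewrite inE.
Qed.

Lemma emb_max : ord_max \in A -> emb ord_max = ord_max.
Proof.
move=> gA; have [i Ei] := emb_onto gA; rewrite -Ei; congr emb.
apply: val_inj; apply/eqP; rewrite eqn_leq -[X in _ && X]ltnS ltn_ord andbT /= leqNgt.
apply/negP=> lt_i.
have lt_m : (#|A|.-1 < size (vals A))%N by rewrite size_vals prednK // card_gt0.
have lt_i' : (i < size (vals A))%N by rewrite size_vals sub_ord_lt.
have := sorted_ltn_nth ltn_trans 0%N (vals_sorted A) _ _ lt_i' lt_m lt_i.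
rewrite -(nth_vals (sub_ord_lt i)) -/(emb i) Ei /= ltnNge.
by rewrite -ltnS (vals_lt (mem_nth _ lt_m)).
Qed.

Lemma lift_max B : ord_max \in A -> (ord_max \in B) = (ord_max \in lift_set B).
Proof. by move=> gA; rewrite -mem_lift emb_max. Qed.

Lemma edge_emb w v :
  @pgraph_edge (pgraph_sub A) w v = @pgraph_edge F (emb w) (emb v).
Proof.
rewrite !edge_npar npar_sub // size_vals sub_ord_lt -nth_vals ?sub_ord_lt //.
rewrite -/(emb w); case: (npar F (emb w)) => //= y.
have Ev : index (val (emb v)) (vals A) = v.
  by rewrite nth_vals ?sub_ord_lt // index_uniq ?uniq_vals ?size_vals ?sub_ord_lt.
case: ifP => [yA|/negP yA].
  rewrite !(inj_eq Some_inj) -Ev; apply/eqP/eqP => [E|-> //].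
  by rewrite -(nth_index 0%N yA) E nth_index // mem_vals emb_in.
apply/esym/negP => /eqP[Ey]; apply: yA.
by rewrite Ey mem_vals emb_in.
Qed.

(** The case where A is the Lea of a cut: its ideals are the ideals of F contained in A. *)
Lemma lift_ideal B : ideal (@pgraph_edge F) A ->
  ideal (@pgraph_edge (pgraph_sub A)) B = ideal (@pgraph_edge F) (lift_set B).
Proof.
move=> /idealP iA; apply/idealP/idealP => iB v w.
  move=> /imsetP[i iB' ->] e_wi.
  have [j Ej] := emb_onto (iA _ _ (emb_in i) e_wi).
  by rewrite -Ej mem_lift; apply: (iB i); rewrite // edge_emb Ej.
by rewrite -!mem_lift edge_emb; apply: iB.
Qed.

(** The case where A is the Roo of a cut: its ideals correspond to the ideals of F containing the
    Lea. *)
Lemma lift_ideal_co B : ideal (@pgraph_edge F) (~: A) ->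
  ideal (@pgraph_edge (pgraph_sub A)) B
  = ideal (@pgraph_edge F) (~: A :|: lift_set B).
Proof.
move=> /idealP iA; apply/idealP/idealP => iB v w.
  case/setUP=> [/iA h /h|/imsetP[i iB' ->] e_wi]; first by rewrite in_setU => ->.
  rewrite inE; case: (boolP (w \in A)) => [wA|wA]; last by rewrite inE wA.
  have [j Ej] := emb_onto wA; rewrite -Ej mem_lift orbC.
  by rewrite (iB i) // edge_emb Ej.
rewrite -!mem_lift edge_emb => vB /(iB _ _ _).
by rewrite !inE !emb_in vB /=; apply.
Qed.

End Lift.

Lemma osub_osub (F : oforest) (L : {set overt F}) (B : {set overt (osub L)}) :
  L != set0 -> B != set0 -> osub B = osub (@lift_set (val F) L B : {set overt F}).
Proof.
move=> L0 B0; apply: val_inj; exact: (@sub_sub (val F) L B L0 B0).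
Qed.

(** * Dendriform axioms for ordered forests *)

Section OrderedDendriform.

Variables (K : fieldType) (F : oforest).
Local Notation e := (@oedge F).
Local Notation g := (ogreatest F).
Implicit Types L X : {set overt F}.

(* Both iterated coproducts of F are sums over the pairs of ideals X < L. *)
Definition chain X L : {malg K[(oforest * oforest * oforest)%type]} :=
  vect K (osub X, osub (L :\: X), osub (~: L)).

(** Q is tested on the greatest vertex of [osub L], which is that of F only if L contains it. The
    hypothesis ensures this, or makes the test trivial. *)
Lemma osplit_left (P Q : pred bool) : (P false = false) \/ (forall b, Q b) ->
  tmap (@osplit K Q) id (cutsum K P F)
  = \sum_L \sum_(X | [&& ideal e L, ideal e X, X != set0, X \proper L, L != setT,
                   P (g \in L) & Q (g \in X)]) chain X L.
Proof.
move=> PQ; rewrite /cutsum lin_sum; last exact: lin_tmap.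
rewrite big_mkcond; apply: eq_bigr => L _.
case: ifP => [|nL]; last first.
  rewrite big_pred0 // => X; apply: contraFF nL => /and5P[iL _ X0 XL /and3P[LT gL _]].
  rewrite /pideal iL LT gL /= !andbT.
  by apply: contraTneq XL => ->; rewrite /proper subset0 (negbTE X0).
case/andP=> /and3P[iL L0 LT] gL.
rewrite tmap_vect osplit_vect /cutsum.
have tl : lin (fun t : {malg K[(oforest * oforest)%type]} => t ⊗ vect K (osub (~: L))).
  exact: (lin_tensl _ (@lin_id _ _)).
rewrite (lin_sum _ _ _ tl).
pose R X := [&& ideal e X, X != set0, X \proper L & Q (g \in X)].
transitivity (\sum_(B : {set 'I_(tag (@pgraph_sub (val F) L)).+1} | R (lift_set B))
   chain (lift_set B) L).
  apply: eq_big => [B|B /andP[/and3P[_ B0 BT] _]].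
    rewrite /R /pideal (lift_ideal L0 _ iL) (lift_neq0 L0) (lift_proper L0).
    rewrite -!andbA; do 3!congr (_ && _).
    case: PQ => [P0|QT]; last by rewrite !QT.
    have gL' : ord_max \in L.
      by apply: contraTT gL => /negbTE gL; rewrite /ogreatest gL P0.
    by rewrite -(lift_max L0 B gL').
  have BC0 : ~: B != set0 by rewrite -setCT (inj_eq (@setC_inj _)).
  rewrite tens_vect /chain -(lift_setC L0).
  by rewrite (@osub_osub F L B L0 B0) (@osub_osub F L _ L0 BC0).
rewrite (sum_lift L0 R (fun X => chain X L)); apply: eq_bigl => X.
rewrite /R iL gL LT /=; case: (boolP (X \proper L)) => XL.
  by rewrite (proper_sub XL).
by rewrite !andbF.
Qed.

(** Here the greatest vertex of F has to lie in Roo. An ideal Y of Roo is encoded by the ideal L = X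
    :|: Y of F, so that both iterated coproducts run over the same chains. *)
Lemma osplit_right (P Q : pred bool) : (P true = false) \/ (forall b, Q b) ->
  tassoc (tmap id (@osplit K Q) (cutsum K P F))
  = \sum_X \sum_(L | [&& ideal e L, ideal e X, X != set0, X \proper L, L != setT,
                   P (g \in X) & Q (g \in L)]) chain X L.
Proof.
move=> PQ; have tal : lin (fun t : {malg K[(oforest * oforest)%type]} => tassoc (tmap id (@osplit K Q) t)).
  exact: (lin_comp (lin_linext _) (lin_tmap _ _)).
rewrite /cutsum (lin_sum _ _ _ tal).
rewrite big_mkcond; apply: eq_bigr => X _.
case: ifP => [|nX]; last first.
  rewrite big_pred0 // => L; apply: contraFF nX => /and5P[_ iX X0 XL /and3P[_ gX _]].
  rewrite /pideal iX X0 gX /= !andbT.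
  by apply: contraTneq XL => ->; rewrite /proper subsetT andbF.
case/andP=> /and3P[iX X0 XT] gX.
have C0 : ~: X != set0 by rewrite -setCT (inj_eq (@setC_inj _)).
have iX' : ideal e (~: ~: X) by rewrite setCK.
rewrite tmap_vect osplit_vect /cutsum.
have tl : lin (fun t : {malg K[(oforest * oforest)%type]} => tassoc (vect K (osub X) ⊗ t)).
  exact: (lin_comp (lin_linext _) (lin_tensr _ (@lin_id _ _))).
rewrite (lin_sum _ _ _ tl).
pose R Y := [&& ideal e (X :|: Y), Y != set0, Y \proper ~: X & Q (g \in X :|: Y)].
have unC (Y : {set overt F}) : Y \subset ~: X -> ~: X :\: Y = ~: (X :|: Y).
  by rewrite setCU setDE.
have unX (Y : {set overt F}) : Y \subset ~: X -> (X :|: Y) :\: X = Y.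
  move=> YX; rewrite setDUl setDv set0U; apply/setDidPl.
  by rewrite disjoints_subset.
transitivity (\sum_(B : {set 'I_(tag (@pgraph_sub (val F) (~: X))).+1} | R (lift_set B))
   chain X (X :|: lift_set B)).
  apply: eq_big => [B|B /andP[/and3P[_ B0 BT] _]].
    rewrite /R /pideal (lift_ideal_co C0 _ iX') (lift_neq0 C0) (lift_proper C0).
    rewrite -!andbA setCK; do 3!congr (_ && _).
    case: PQ => [P0|QT]; last by rewrite !QT.
    have gX' : g \notin X by apply: contraTN gX => ->; rewrite P0.
    have gC : ord_max \in ~: X by rewrite in_setC.
    by rewrite in_setU (negbTE gX') -(lift_max C0 B gC).
  have BC0 : ~: B != set0 by rewrite -setCT (inj_eq (@setC_inj _)).
  rewrite tens_vect tassoc_vect /chain (unX _ (lift_sub C0 B)) -(unC _ (lift_sub C0 B)).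
  rewrite -(lift_setC C0).
  by rewrite (@osub_osub F (~: X) B C0 B0) (@osub_osub F (~: X) _ C0 BC0).
rewrite (sum_lift C0 R (fun Y => chain X (X :|: Y))).
rewrite [RHS](reindex_onto (fun Y => X :|: Y) (fun L => L :\: X)) /=; last first.
  move=> L /and5P[_ _ _ /proper_sub XL _]; apply/setP=> x; rewrite !inE.
  by case: (boolP (x \in X)) => //= /(subsetP XL).
apply: eq_bigl => Y; rewrite /R iX X0 gX /=.
have [YX|nYX] := boolP (Y \subset ~: X); last first.
  apply/esym/negbTE; apply: contraNN nYX => /andP[_ /eqP <-].
  by rewrite setDE subsetIr.
rewrite (unX _ YX) eqxx andbT /=; congr (_ && _).
rewrite properEneq YX andbT [X \proper _]properEneq subsetUl andbT.
have -> : (X != X :|: Y) = (Y != set0).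
  congr negb; apply/eqP/eqP => [E|->]; last by rewrite setU0.
  by rewrite -(unX _ YX) -E setDv.
have -> // : (Y != ~: X) = (X :|: Y != setT).
congr negb; apply/eqP/eqP => [->|E]; first by rewrite setUCr.
by rewrite -(unX _ YX) E setTD.
Qed.

End OrderedDendriform.

Lemma sum_exchange (M : nmodType) (I J : finType) (P Q : I -> J -> bool)
    (f : I -> J -> M) : (forall i j, P i j = Q i j) ->
  \sum_i \sum_(j | P i j) f i j = \sum_j \sum_(i | Q i j) f i j.
Proof.
move=> PQ; rewrite (exchange_big_dep xpredT) //; apply: eq_bigr => j _.
by apply: eq_bigl => i; rewrite /= PQ.
Qed.

Theorem Ho_dendriform (K : fieldType) : dendriform_coalgebra (Ho K).
Proof.
have tl (f : dd_space (Ho K) -> dd_space2 (Ho K)) P :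
  lin (fun x => tmap f id (@osplit K P x)) by exact: (lin_comp (lin_tmap _ _) (lin_osplit _)).
have tr (f : dd_space (Ho K) -> dd_space2 (Ho K)) P :
  lin (fun x => tassoc (tmap id f (@osplit K P x))).
  exact: (lin_comp (lin_linext _) (lin_comp (lin_tmap _ _) (lin_osplit _))).
(* On a chain X < L, the greatest vertex lies in L as soon as it lies in X. With this implication,
   each axiom reduces to a tautology on two Booleans. *)
have main (P Q P' Q' : pred bool) : (P false = false) \/ (forall b, Q b) ->
    (P' true = false) \/ (forall b, Q' b) ->
    (forall a b, (a ==> b) -> P b && Q a = P' a && Q' b) ->
  forall a, tmap (@osplit K Q) id (@osplit K P a)
    = tassoc (tmap id (@osplit K Q') (@osplit K P' a)).
  move=> hP hP' PQ; apply: (lin_eq (tl _ _) (tr _ _)) => F.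
  apply: (etrans (congr1 (tmap (@osplit K Q) id) (osplit_vect K P F))).
  apply: esym; apply: (etrans (congr1 (fun t => tassoc (tmap id (@osplit K Q') t)) (osplit_vect K P' F))).
  apply: (etrans (osplit_right K F hP')); apply: esym; apply: (etrans (osplit_left K F hP)).
  apply: sum_exchange => L X.
  rewrite -!andbA; do 3!congr (_ && _).
  apply: andb_id2l => XL; do 2!congr (_ && _).
  apply: (PQ (ogreatest F \in X) (ogreatest F \in L)); apply/implyP.
  exact: (subsetP XL).
have E1 : @dd_prec K (Ho K) = @osplit K id by apply/funext => x; rewrite prec_osplit.
have E2 : @dd_succ K (Ho K) = @osplit K negb by apply/funext => x; rewrite succ_osplit.
have E3 : @dd_cop K (Ho K) = @osplit K predT by apply/funext => x; rewrite cop_osplit.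
apply/dendriformP; rewrite E1 E2 E3; split.
- apply: main; [by left|by right|by case=> -[]].
- apply: main; [by left|by left|by case=> -[]].
- apply: main; [by right|by left|by case=> -[]].
Qed.

(** * Compatibility axioms for ordered forests *)

Section BlockIdeals.

Variables F G : pgraph.
Local Notation m := (tag F).+1.
Local Notation n := (tag G).+1.
Implicit Types (A : {set 'I_m}) (B : {set 'I_n}).

Lemma ideal_mul A B :
  ideal (@pgraph_edge (pgraph_mul F G)) (blocks A B)
  = ideal (@pgraph_edge F) A && ideal (@pgraph_edge G) B.
Proof.
have ll (i j : 'I_m) : @pgraph_edge (pgraph_mul F G) (lshift n i) (lshift n j) = pgraph_edge i j.
  by rewrite !edge_npar npar_mul /= ltn_ord.
have lr (i : 'I_m) (j : 'I_n) : @pgraph_edge (pgraph_mul F G) (lshift n i) (rshift m j) = false.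
  rewrite !edge_npar npar_mul /= ltn_ord; apply/eqP=> /npar_lt.
  by rewrite ltnNge leq_addr.
have rl (i : 'I_n) (j : 'I_m) : @pgraph_edge (pgraph_mul F G) (rshift m i) (lshift n j) = false.
  rewrite !edge_npar npar_mul /= ltnNge leq_addr addKn; case: (npar G i) => //= y.
  by apply/eqP=> -[E]; have := ltn_ord j; rewrite -E ltnNge leq_addr.
have rr (i j : 'I_n) : @pgraph_edge (pgraph_mul F G) (rshift m i) (rshift m j) = pgraph_edge i j.
  rewrite !edge_npar npar_mul /= ltnNge leq_addr addKn; case: (npar G i) => //= y.
  by rewrite !(inj_eq Some_inj) eqn_add2l.
apply/idealP/andP => [iAB|[/idealP iA /idealP iB] v w].
  split; apply/idealP => v w.
    by rewrite -ll -!(blocks_l A B); apply: iAB.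
  by rewrite -rr -!(blocks_r A B); apply: iAB.
case: (@split_ordP m n v) => j ->; case: (@split_ordP m n w) => i ->.
- by rewrite ll (blocks_l A B j) (blocks_l A B i); apply: iA.
- by rewrite rl.
- by rewrite lr.
- by rewrite rr (blocks_r A B j) (blocks_r A B i); apply: iB.
Qed.

(** All vertices of G descend from the grafting vertex, so an ideal that contains this vertex
    contains G. *)
Lemma ideal_graft A B : acyclic (@pgraph_edge G) ->
  ideal (@pgraph_edge (pgraph_graft F G)) (blocks A B)
  = [&& ideal (@pgraph_edge F) A, ideal (@pgraph_edge G) B
      & (ord_max \in A) ==> (B == setT)].
Proof.
move=> acy.
have ll (i j : 'I_m) : @pgraph_edge (pgraph_graft F G) (lshift n i) (lshift n j) = pgraph_edge i j.
  by rewrite !edge_npar npar_graft /= ltn_ord.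
have lr (i : 'I_m) (j : 'I_n) : @pgraph_edge (pgraph_graft F G) (lshift n i) (rshift m j) = false.
  rewrite !edge_npar npar_graft /= ltn_ord; apply/eqP=> /npar_lt.
  by rewrite ltnNge leq_addr.
have rl (i : 'I_n) (j : 'I_m) : @pgraph_edge (pgraph_graft F G) (rshift m i) (lshift n j)
    = (npar G i == None) && (j == ord_max).
  rewrite !edge_npar npar_graft /= ltnNge leq_addr addKn ltn_add2l ltn_ord.
  case: (npar G i) => [y|] /=; last by rewrite (inj_eq Some_inj) eq_sym.
  by apply/eqP=> -[E]; have := ltn_ord j; rewrite -E ltnNge leq_addr.
have rr (i j : 'I_n) : @pgraph_edge (pgraph_graft F G) (rshift m i) (rshift m j) = pgraph_edge i j.
  rewrite !edge_npar npar_graft /= ltnNge leq_addr addKn ltn_add2l ltn_ord.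
  case: (npar G i) => [y|] /=; first by rewrite !(inj_eq Some_inj) eqn_add2l.
  by apply/eqP=> -[E]; have := leq_addr j m; rewrite -E ltnn.
apply/idealP/and3P => [iAB|[/idealP iA /idealP iB gAB] v w].
  have iB : ideal (@pgraph_edge G) B.
    by apply/idealP => v w; rewrite -rr -!(blocks_r A B); apply: iAB.
  split=> //; first by apply/idealP => v w; rewrite -ll -!(blocks_l A B); apply: iAB.
  apply/implyP=> gA; rewrite eqEsubset subsetT /=; apply/subsetP=> v _.
  (* By induction on the rank: a root of G is a child of the grafting vertex, and any other vertex
     has a parent of smaller rank. *)
  have [r er] := acyclic_rank acy; have [k] := ubnP (r v).
  elim: k v => // k IHk v lt_v; case E: (npar G v) => [y|].
    have e_vy : @pgraph_edge G v (Ordinal (npar_lt E)) by rewrite edge_npar E.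
    apply: (idealP _ _ iB _ _ _ e_vy); apply: IHk.
    by apply: leq_trans (er _ _ e_vy) _.
  rewrite -(blocks_r A B); apply: (iAB (lshift n ord_max)); first by rewrite (blocks_l A B).
  by rewrite rl E !eqxx.
case: (@split_ordP m n v) => j ->; case: (@split_ordP m n w) => i ->.
- by rewrite ll (blocks_l A B j) (blocks_l A B i); apply: iA.
- rewrite rl (blocks_l A B j) (blocks_r A B i) => jA /andP[_ /eqP Ej]; subst j.
  by rewrite (eqP (implyP gAB jA)) in_setT.
- by rewrite lr.
- by rewrite rr (blocks_r A B j) (blocks_r A B i); apply: iB.
Qed.

Lemma blocks_max A B :
  ((ord_max : 'I_(tag (pgraph_mul F G)).+1) \in (blocks A B : {set 'I_(m + n)}))
  = (ord_max \in B).
Proof.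
have -> : (ord_max : 'I_(tag (pgraph_mul F G)).+1) = @rshift m n ord_max.
  by apply: val_inj; rewrite /= addSn addnS.
exact: blocks_r.
Qed.

Lemma blocks_eq0 A B : (blocks A B == set0) = (A == set0) && (B == set0).
Proof.
apply/eqP/andP => [|[/eqP -> /eqP ->]]; last exact: blocks0.
by rewrite -blocks0 => /blocks_inj[-> ->].
Qed.

Lemma blocks_eqT A B : (blocks A B == setT) = (A == setT) && (B == setT).
Proof.
apply/eqP/andP => [|[/eqP -> /eqP ->]]; last exact: blocksT.
by rewrite -blocksT => /blocks_inj[-> ->].
Qed.

End BlockIdeals.

Section OrderedCompat.

Variable K : fieldType.
Implicit Types F G : oforest.

Definition oblocks F G (A : {set overt F}) (B : {set overt G}) :
  {set overt (omul F G)} := blocks A B.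
Definition gblocks F G (A : {set overt F}) (B : {set overt G}) :
  {set overt (ograft F G)} := blocks A B.

Section OneCut.
Variables (F G : oforest) (A : {set overt F}) (B : {set overt G}).

Lemma osub_setT (H : oforest) : osub (setT : {set overt H}) = H.
Proof. by apply: val_inj; apply: (@sub_setT (val H)). Qed.

Lemma osub_mul : A != set0 -> B != set0 ->
  osub (oblocks A B) = omul (osub A) (osub B).
Proof. by move=> A0 B0; apply: val_inj; apply: (@sub_mul (val F) (val G) A B A0 B0). Qed.

Lemma osub_mull : A != set0 -> osub (oblocks A (set0 : {set overt G})) = osub A.
Proof. by move=> A0; apply: val_inj; apply: (@sub_mull (val F) (val G) A A0). Qed.

Lemma osub_mulr : B != set0 -> osub (oblocks (set0 : {set overt F}) B) = osub B.
Proof. by move=> B0; apply: val_inj; apply: (@sub_mulr (val F) (val G) B B0). Qed.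

Lemma osub_graftl : A != set0 -> osub (gblocks A (set0 : {set overt G})) = osub A.
Proof. by move=> A0; apply: val_inj; apply: (@sub_graftl (val F) (val G) A A0). Qed.

Lemma osub_graftr : B != set0 -> osub (gblocks (set0 : {set overt F}) B) = osub B.
Proof. by move=> B0; apply: val_inj; apply: (@sub_graftr (val F) (val G) B B0). Qed.

Lemma osub_graft_mul : A != set0 -> B != set0 -> ogreatest F \notin A ->
  osub (gblocks A B) = omul (osub A) (osub B).
Proof.
move=> A0 B0 gA; apply: val_inj.
exact: (@sub_graft_mul (val F) (val G) A B A0 B0 gA).
Qed.

Lemma osub_graft : ogreatest F \in A -> B != set0 -> ideal (@oedge G) (~: B) ->
  osub (gblocks A B) = ograft (osub A) (osub B).
Proof.
move=> gA B0 /idealP iB; apply: val_inj.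
apply: (@sub_graft (val F) (val G) A B gA B0) => i k iB' Ei.
have lt_i := vals_lt iB'; have lt_k := npar_lt Ei.
apply/negPn/negP => kB.
have := iB (Ordinal lt_k) (Ordinal lt_i).
rewrite !in_setC -!mem_vals /= kB iB' => /(_ isT).
by rewrite /oedge edge_npar Ei eqxx => /(_ isT).
Qed.

End OneCut.
End OrderedCompat.

Section SumBlocks.

Variables (M : nmodType) (F G : oforest) (P : pred bool).
Implicit Types (A : {set overt F}) (B : {set overt G}).
Local Notation p := pideal.

Lemma pidealC (V : finType) (e : rel V) L : p e L -> L != set0 /\ ~: L != set0.
Proof. by case/and3P=> _ -> LT; rewrite -setCT (inj_eq (@setC_inj _)). Qed.

Lemma oset0T (H : oforest) : (set0 == setT :> {set overt H}) = false.
Proof.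
by apply/eqP/setP => /(_ ord_max); rewrite in_set0 in_setT.
Qed.

(** The hypotheses on P say that it is [id] or [negb] according to b, so exactly one improper ideal
    B is allowed. Letting A be empty, full or proper and discarding the two improper ideals of the
    product leaves the five terms of the axiom. *)
Lemma sum_mul_ideals (b : bool) (f : {set overt F} -> {set overt G} -> M)
    (h : {set overt (omul F G)} -> M) :
  P b -> P (~~ b) = false -> (forall A B, h (oblocks A B) = f A B) ->
  \sum_(S | p (@oedge (omul F G)) S && P (ogreatest (omul F G) \in S)) h S
  = (if b then f set0 setT else f setT set0)
    + \sum_(A | p (@oedge F) A && true) f A (if b then setT else set0)
    + \sum_(B | p (@oedge G) B && P (ogreatest G \in B)) f set0 B
    + \sum_(B | p (@oedge G) B && P (ogreatest G \in B)) f setT B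
    + \sum_(A | p (@oedge F) A && true)
        \sum_(B | p (@oedge G) B && P (ogreatest G \in B)) f A B.
Proof.
move=> Pb PNb hf.
pose ok A B := ~~ ((A == set0) && (B == set0)) && ~~ ((A == setT) && (B == setT)).
transitivity (\sum_(A : {set overt F} | ideal (@oedge F) A && true)
   \sum_(B : {set overt G} | ideal (@oedge G) B && P (ogreatest G \in B))
     (if ok A B then f A B else 0)).
  rewrite (@sum_blocks (tag (val F)).+1 (tag (val G)).+1) [RHS]big_mkcond.
  apply: eq_bigr => A _; rewrite big_mkcond andbT; case: ifP => iA; last first.
    by rewrite big1 // => B _; rewrite /pideal [ideal _ _](@ideal_mul (val F) (val G)) iA.
  rewrite [RHS]big_mkcond; apply: eq_bigr => B _.
  rewrite /pideal [ideal _ _](@ideal_mul (val F) (val G)) iA /=.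
  rewrite [_ \in blocks A B](@blocks_max (val F) (val G)).
  rewrite [blocks A B == set0]blocks_eq0 [blocks A B == setT]blocks_eqT -hf /ok.
  by case: (ideal _ B); case: (P _); rewrite ?andbF ?andbT.
have inner (k : {set overt G} -> M) :
    \sum_(B | ideal (@oedge G) B && P (ogreatest G \in B)) k B
    = k (if b then setT else set0)
      + \sum_(B | p (@oedge G) B && P (ogreatest G \in B)) k B.
  rewrite (@sum_ideals _ _ _ (fun B => P (ogreatest G \in B)) k (ogreatest G)).
  rewrite in_set0 in_setT; congr (_ + _).
  by case: (b) Pb PNb => /= -> ->; rewrite ?add0r ?addr0.
rewrite (@sum_ideals _ _ _ xpredT _ (ogreatest F)) !inner.
have okp A B : p (@oedge F) A -> ok A B.
  by rewrite /ok => /and3P[_ /negbTE -> /negbTE ->].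
have okp' A B : p (@oedge G) B -> ok A B.
  by rewrite /ok => /and3P[_ /negbTE -> /negbTE ->]; rewrite !andbF.
have sumok A : \sum_(B | p (@oedge G) B && P (ogreatest G \in B))
    (if ok A B then f A B else 0)
  = \sum_(B | p (@oedge G) B && P (ogreatest G \in B)) f A B.
  by apply: eq_bigr => B /andP[pB _]; rewrite okp'.
rewrite !sumok; set TB := if b then setT else set0.
have -> : \sum_(A | p (@oedge F) A && true) \sum_(B | ideal (@oedge G) B && P (ogreatest G \in B))
     (if ok A B then f A B else 0)
  = \sum_(A | p (@oedge F) A && true) f A TB
  + \sum_(A | p (@oedge F) A && true) \sum_(B | p (@oedge G) B && P (ogreatest G \in B)) f A B.
  rewrite -big_split; apply: eq_bigr => A /andP[pA _] /=.
  by rewrite inner sumok okp.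
have -> : (if ok set0 TB then f set0 TB else 0) + \sum_(B | p (@oedge G) B && P (ogreatest G \in B)) f set0 B
    + ((if ok setT TB then f setT TB else 0) + \sum_(B | p (@oedge G) B && P (ogreatest G \in B)) f setT B)
  = (if b then f set0 setT else f setT set0) + \sum_(B | p (@oedge G) B && P (ogreatest G \in B)) f set0 B
    + \sum_(B | p (@oedge G) B && P (ogreatest G \in B)) f setT B.
  rewrite addrACA -[RHS]addrA; congr (_ + _).
  rewrite /ok /TB; case: (b); rewrite !eqxx !oset0T /= ?[setT == set0]eq_sym ?oset0T /=.
    by rewrite addr0.
  by rewrite add0r.
rewrite addrA; congr (_ + _); rewrite addrAC; congr (_ + _).
by rewrite addrAC.
Qed.

(** An ideal A containing the grafting vertex forces B to be full, which P accepts only if b holds.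
    The sums over proper A therefore split according to this vertex, which is why the axioms for ↖
    separate the two half-coproducts of x. *)
Lemma sum_graft_ideals (b : bool) (f : {set overt F} -> {set overt G} -> M)
    (h : {set overt (ograft F G)} -> M) :
  P b -> P (~~ b) = false -> (forall A B, h (gblocks A B) = f A B) ->
  \sum_(S | p (@oedge (ograft F G)) S && P (ogreatest (ograft F G) \in S)) h S
  = (if b then f set0 setT else 0)
    + \sum_(B | p (@oedge G) B && P (ogreatest G \in B)) f set0 B
    + (if b then \sum_(A | p (@oedge F) A && (ogreatest F \in A)) f A setT else 0)
    + \sum_(A | p (@oedge F) A && ~~ (ogreatest F \in A)) f A (if b then setT else set0)
    + \sum_(A | p (@oedge F) A && ~~ (ogreatest F \in A))
        \sum_(B | p (@oedge G) B && P (ogreatest G \in B)) f A B.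
Proof.
move=> Pb PNb hf.
pose ok A B := [&& (ogreatest F \in A) ==> (B == setT), ~~ ((A == set0) && (B == set0))
  & ~~ ((A == setT) && (B == setT))].
transitivity (\sum_(A : {set overt F} | ideal (@oedge F) A && true)
   \sum_(B : {set overt G} | ideal (@oedge G) B && P (ogreatest G \in B))
     (if ok A B then f A B else 0)).
  rewrite (@sum_blocks (tag (val F)).+1 (tag (val G)).+1) [RHS]big_mkcond.
  apply: eq_bigr => A _; rewrite big_mkcond andbT; case: ifP => iA; last first.
    by rewrite big1 // => B _; rewrite /pideal [ideal _ _](@ideal_graft (val F) (val G) _ _ (valP G)) iA.
  rewrite [RHS]big_mkcond; apply: eq_bigr => B _.
  rewrite /pideal [ideal _ _](@ideal_graft (val F) (val G) _ _ (valP G)) iA /=.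
  rewrite [_ \in blocks A B](@blocks_max (val F) (val G)).
  rewrite [blocks A B == set0]blocks_eq0 [blocks A B == setT]blocks_eqT -hf /ok.
  by case: (ideal _ B); case: (P _); rewrite ?andbF ?andbT // -andbA.
have inner (k : {set overt G} -> M) :
    \sum_(B | ideal (@oedge G) B && P (ogreatest G \in B)) k B
    = k (if b then setT else set0)
      + \sum_(B | p (@oedge G) B && P (ogreatest G \in B)) k B.
  rewrite (@sum_ideals _ _ _ (fun B => P (ogreatest G \in B)) k (ogreatest G)).
  rewrite in_set0 in_setT; congr (_ + _).
  by case: (b) Pb PNb => /= -> ->; rewrite ?add0r ?addr0.
have inT (H : oforest) : (setT == set0 :> {set overt H}) = false.
  by rewrite eq_sym oset0T.
have sumg A : ogreatest F \in A -> \sum_(B | p (@oedge G) B && P (ogreatest G \in B))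
    (if ok A B then f A B else 0) = 0.
  move=> gA; rewrite big1 // => B /andP[/and3P[_ _ BT] _].
  by rewrite /ok gA (negbTE BT).
have sumok A : ogreatest F \notin A -> \sum_(B | p (@oedge G) B && P (ogreatest G \in B))
    (if ok A B then f A B else 0)
  = \sum_(B | p (@oedge G) B && P (ogreatest G \in B)) f A B.
  move=> gA; apply: eq_bigr => B /andP[/and3P[_ /negbTE B0 /negbTE BT] _].
  by rewrite /ok (negbTE gA) B0 BT !andbF.
rewrite (@sum_ideals _ _ _ xpredT _ (ogreatest F)) !inner.
rewrite sumok ?in_set0 // sumg ?in_setT // addr0 -!addrA; congr (_ + _).
  by case: (b); rewrite /ok in_set0 /= ?inT !eqxx ?oset0T.
congr (_ + _).
have -> : (if ok setT (if b then setT else set0) then f setT (if b then setT else set0) else 0) = 0.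
  by case: (b); rewrite /ok in_setT /= ?inT !eqxx ?oset0T.
rewrite add0r (sum_split _ (fun A => ogreatest F \in A) _).
have pT A : p (@oedge F) A && true && (ogreatest F \in A) = p (@oedge F) A && (ogreatest F \in A).
  by rewrite andbT.
have pN A : p (@oedge F) A && true && ~~ (ogreatest F \in A) = p (@oedge F) A && ~~ (ogreatest F \in A).
  by rewrite andbT.
rewrite (eq_bigl _ _ pT) (eq_bigl _ _ pN); congr (_ + _).
  case: b Pb PNb inner => Pb PNb inner.
    apply: eq_bigr => A /andP[pA gA]; rewrite inner sumg // /ok gA eqxx addr0.
    by case/and3P: pA => _ /negbTE -> /negbTE ->.
  apply: big1 => A /andP[pA gA]; rewrite inner sumg // /ok gA eq_sym.
  by rewrite inT addr0.
rewrite -big_split; apply: eq_bigr => A /andP[pA gA] /=.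
rewrite inner sumok // /ok (negbTE gA) /=.
by case/and3P: pA => _ /negbTE -> /negbTE ->.
Qed.

End SumBlocks.

(** The third and fourth terms are exchanged: [sum_mul_ideals] lists A empty before A full, and the
    axiom does the opposite. *)
Lemma congrD5 (M : nmodType) (a1 a2 a3 a4 a5 b1 b2 b3 b4 b5 : M) :
  a1 = b1 -> a2 = b2 -> a3 = b4 -> a4 = b3 -> a5 = b5 ->
  a1 + a2 + a3 + a4 + a5 = b1 + b2 + b3 + b4 + b5.
Proof. by move=> -> -> -> -> ->; rewrite [b1 + b2 + _ + _]addrAC. Qed.

Section CutPairs.

Variables (F G : oforest) (A : {set overt F}) (B : {set overt G}).

Definition opair (H : oforest) (S : {set overt H}) : oforest * oforest :=
  (osub S, osub (~: S)).

Lemma oblocksC : ~: oblocks A B = oblocks (~: A) (~: B).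
Proof. exact: (@blocksC (tag (val F)).+1 (tag (val G)).+1). Qed.

Lemma gblocksC : ~: gblocks A B = gblocks (~: A) (~: B).
Proof. exact: (@blocksC (tag (val F)).+1 (tag (val G)).+1). Qed.

Lemma osetT0 (H : oforest) : setT != set0 :> {set overt H}.
Proof. by rewrite eq_sym oset0T. Qed.

End CutPairs.

Section CutPairsMul.

Variables F G : oforest.
Implicit Types (A : {set overt F}) (B : {set overt G}).

(** In the names of this family, the suffix describes the traces on F and G: [0] empty, [T] full,
    [A] and [B] proper, and [N] a proper trace on F that avoids the greatest vertex. In
    [opair_graft_AT], the trace contains this vertex. *)
Lemma opair_mul_0T : opair (oblocks (set0 : {set overt F}) (setT : {set overt G})) = (G, F).
Proof.
rewrite /opair oblocksC setC0 setCT (osub_mulr F (osetT0 G)) (osub_setT G).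
by rewrite (osub_mull G (osetT0 F)) (osub_setT F).
Qed.

Lemma opair_mul_T0 : opair (oblocks (setT : {set overt F}) (set0 : {set overt G})) = (F, G).
Proof.
rewrite /opair oblocksC setC0 setCT (osub_mulr F (osetT0 G)) (osub_setT G).
by rewrite (osub_mull G (osetT0 F)) (osub_setT F).
Qed.

Lemma opair_mul_AT A : A != set0 -> ~: A != set0 ->
  opair (oblocks A (setT : {set overt G})) = (omul (osub A) G, osub (~: A)).
Proof.
move=> A0 Ac; rewrite /opair oblocksC setCT (osub_mul A0 (osetT0 G)) (osub_setT G).
by rewrite (osub_mull G Ac).
Qed.

Lemma opair_mul_A0 A : A != set0 -> ~: A != set0 ->
  opair (oblocks A (set0 : {set overt G})) = (osub A, omul (osub (~: A)) G).
Proof.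
move=> A0 Ac; rewrite /opair oblocksC setC0 (osub_mul Ac (osetT0 G)) (osub_setT G).
by rewrite (osub_mull G A0).
Qed.

Lemma opair_mul_0B B : B != set0 -> ~: B != set0 ->
  opair (oblocks (set0 : {set overt F}) B) = (osub B, omul F (osub (~: B))).
Proof.
move=> B0 Bc; rewrite /opair oblocksC setC0 (osub_mul (osetT0 F) Bc) (osub_setT F).
by rewrite (osub_mulr F B0).
Qed.

Lemma opair_mul_TB B : B != set0 -> ~: B != set0 ->
  opair (oblocks (setT : {set overt F}) B) = (omul F (osub B), osub (~: B)).
Proof.
move=> B0 Bc; rewrite /opair oblocksC setCT (osub_mul (osetT0 F) B0) (osub_setT F).
by rewrite (osub_mulr F Bc).
Qed.

Lemma opair_mul_AB A B : A != set0 -> ~: A != set0 -> B != set0 -> ~: B != set0 ->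
  opair (oblocks A B) = (omul (osub A) (osub B), omul (osub (~: A)) (osub (~: B))).
Proof.
by move=> A0 Ac B0 Bc; rewrite /opair oblocksC (osub_mul A0 B0) (osub_mul Ac Bc).
Qed.

Lemma opair_graft_0T : opair (gblocks (set0 : {set overt F}) (setT : {set overt G})) = (G, F).
Proof.
rewrite /opair gblocksC setC0 setCT (osub_graftr F (osetT0 G)) (osub_setT G).
by rewrite (osub_graftl G (osetT0 F)) (osub_setT F).
Qed.

Lemma opair_graft_0B B : B != set0 -> ~: B != set0 -> ideal (@oedge G) B ->
  opair (gblocks (set0 : {set overt F}) B) = (osub B, ograft F (osub (~: B))).
Proof.
move=> B0 Bc iB; rewrite /opair gblocksC setC0 (osub_graftr F B0).
by rewrite (@osub_graft F G setT (~: B)) ?in_setT ?setCK // (osub_setT F).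
Qed.

Lemma opair_graft_AT A : ogreatest F \in A -> ~: A != set0 ->
  opair (gblocks A (setT : {set overt G})) = (ograft (osub A) G, osub (~: A)).
Proof.
move=> gA Ac; rewrite /opair gblocksC setCT (osub_graftl G Ac).
rewrite (@osub_graft F G A setT gA (osetT0 G)) ?(osub_setT G) //.
by rewrite setCT; apply/idealP => v w; rewrite in_set0.
Qed.

Lemma opair_graft_NT A : ogreatest F \notin A -> A != set0 -> ~: A != set0 ->
  opair (gblocks A (setT : {set overt G})) = (omul (osub A) G, osub (~: A)).
Proof.
move=> gA A0 Ac; rewrite /opair gblocksC setCT (osub_graftl G Ac).
by rewrite (osub_graft_mul A0 (osetT0 G) gA) (osub_setT G).
Qed.

Lemma opair_graft_N0 A : ogreatest F \notin A -> A != set0 -> ~: A != set0 ->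
  opair (gblocks A (set0 : {set overt G})) = (osub A, ograft (osub (~: A)) G).
Proof.
move=> gA A0 Ac; rewrite /opair gblocksC setC0 (osub_graftl G A0).
rewrite (@osub_graft F G (~: A) setT) ?(osub_setT G) ?in_setC ?osetT0 //.
by rewrite setCT; apply/idealP => v w; rewrite in_set0.
Qed.

Lemma opair_graft_NB A B : ogreatest F \notin A -> A != set0 -> ~: A != set0 ->
  B != set0 -> ~: B != set0 -> ideal (@oedge G) B ->
  opair (gblocks A B) = (omul (osub A) (osub B), ograft (osub (~: A)) (osub (~: B))).
Proof.
move=> gA A0 Ac B0 Bc iB; rewrite /opair gblocksC (osub_graft_mul A0 B0 gA).
by rewrite (@osub_graft F G (~: A) (~: B)) ?in_setC ?setCK.
Qed.

End CutPairsMul.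

Lemma congrD5' (M : nmodType) (a1 a2 a3 a4 a5 b1 b2 b3 b4 b5 : M) :
  a1 = b1 -> a2 = b2 -> a3 = b3 -> a4 = b4 -> a5 = b5 ->
  a1 + a2 + a3 + a4 + a5 = b1 + b2 + b3 + b4 + b5.
Proof. by move=> -> -> -> -> ->. Qed.

Section HoCompat.

Variable K : fieldType.
Local Notation "x ∙ y" := (@dd_mul K (Ho K) x y) (at level 40, left associativity).
Local Notation "x ↖ y" := (@dd_graft K (Ho K) x y)
  (at level 40, left associativity).
Local Notation "<< F >>" := (vect K (F : oforest)).
Implicit Types F G : oforest.

Lemma Ho_mul F G : <<F>> ∙ <<G>> = <<omul F G>>.
Proof. exact: (bilinext_vect (@dd_mul0 K (Ho K))). Qed.

Lemma Ho_graft F G : <<F>> ↖ <<G>> = <<ograft F G>>.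
Proof. exact: (bilinext_vect (@dd_graft0 K (Ho K))). Qed.

Lemma swd_osplit (M : lmodType K) (h : dd_space (Ho K) -> dd_space (Ho K) -> M) P F :
  sweedler h (@osplit K P <<F>>)
  = \sum_(A | pideal (@oedge F) A && P (ogreatest F \in A))
      h <<osub A>> <<osub (~: A)>>.
Proof.
rewrite osplit_vect /cutsum lin_sum; last exact: lin_swd.
by apply: eq_bigr => A _; rewrite swd_vect.
Qed.

Lemma mul_tens_mul a b c d :
  (<<a>> ∙ <<b>>) ⊗ (<<c>> ∙ <<d>>) = vect K (omul a b, omul c d).
Proof. exact: (etrans (congr2 _ (Ho_mul a b) (Ho_mul c d)) (tens_vect K _ _)). Qed.

Lemma mul_tens_graft a b c d :
  (<<a>> ∙ <<b>>) ⊗ (<<c>> ↖ <<d>>) = vect K (omul a b, ograft c d).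
Proof. exact: (etrans (congr2 _ (Ho_mul a b) (Ho_graft c d)) (tens_vect K _ _)). Qed.

Lemma osplit_mul (b : bool) (P : pred bool) F G :
  P b -> P (~~ b) = false ->
  @osplit K P (<<F>> ∙ <<G>>)
  = (if b then <<G>> ⊗ <<F>> else <<F>> ⊗ <<G>>)
    + \swd_(x1, x2 <- @osplit K predT <<F>>)
        (if b then (x1 ∙ <<G>>) ⊗ x2 else x1 ⊗ (x2 ∙ <<G>>))
    + \swd_(y1, y2 <- @osplit K P <<G>>) ((<<F>> ∙ y1) ⊗ y2)
    + \swd_(y1, y2 <- @osplit K P <<G>>) (y1 ⊗ (<<F>> ∙ y2))
    + \swd_(x1, x2 <- @osplit K predT <<F>>) \swd_(y1, y2 <- @osplit K P <<G>>)
        ((x1 ∙ y1) ⊗ (x2 ∙ y2)).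
Proof.
move=> Pb PNb.
pose h (S : {set overt (omul F G)}) : {malg K[(oforest * oforest)%type]} :=
  vect K (opair S).
pose f (A : {set overt F}) (B : {set overt G}) := h (oblocks A B).
apply: (etrans (congr1 (@osplit K P) (Ho_mul F G))).
apply: (etrans (osplit_vect K P (omul F G))).
apply: (etrans (@sum_mul_ideals _ F G P b f h Pb PNb (fun A B => erefl))).
apply: congrD5.
- case: (b); rewrite (tens_vect K).
    by rewrite /f /h opair_mul_0T.
  by rewrite /f /h opair_mul_T0.
- apply: esym; apply: (etrans (swd_osplit _ predT F)).
  apply: eq_bigr => A /andP[/pidealC[A0 Ac] _]; case: (b).
    rewrite (Ho_mul (osub A) G) (tens_vect K).
    by rewrite /f /h (opair_mul_AT G A0 Ac).
  rewrite (Ho_mul (osub (~: A)) G) (tens_vect K).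
  by rewrite /f /h (opair_mul_A0 G A0 Ac).
- apply: esym; apply: (etrans (swd_osplit _ P G)).
  apply: eq_bigr => B /andP[/pidealC[B0 Bc] _]; rewrite (Ho_mul F (osub (~: B))) (tens_vect K).
  by rewrite /f /h (opair_mul_0B F B0 Bc).
- apply: esym; apply: (etrans (swd_osplit _ P G)).
  apply: eq_bigr => B /andP[/pidealC[B0 Bc] _]; rewrite (Ho_mul F (osub B)) (tens_vect K).
  by rewrite /f /h (opair_mul_TB F B0 Bc).
apply: esym; apply: (etrans (swd_osplit _ predT F)).
apply: eq_bigr => A /andP[/pidealC[A0 Ac] _]; apply: (etrans (swd_osplit _ P G)).
apply: eq_bigr => B /andP[/pidealC[B0 Bc] _].
apply: (etrans (mul_tens_mul _ _ _ _)).
by rewrite /f /h (opair_mul_AB A0 Ac B0 Bc).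
Qed.

Lemma osplit_graft (b : bool) (P : pred bool) F G :
  P b -> P (~~ b) = false ->
  @osplit K P (<<F>> ↖ <<G>>)
  = (if b then <<G>> ⊗ <<F>> else 0)
    + \swd_(y1, y2 <- @osplit K P <<G>>) (y1 ⊗ (<<F>> ↖ y2))
    + (if b then \swd_(x1, x2 <- @osplit K id <<F>>) ((x1 ↖ <<G>>) ⊗ x2) else 0)
    + \swd_(x1, x2 <- @osplit K negb <<F>>)
        (if b then (x1 ∙ <<G>>) ⊗ x2 else x1 ⊗ (x2 ↖ <<G>>))
    + \swd_(x1, x2 <- @osplit K negb <<F>>) \swd_(y1, y2 <- @osplit K P <<G>>)
        ((x1 ∙ y1) ⊗ (x2 ↖ y2)).
Proof.
move=> Pb PNb.
pose h (S : {set overt (ograft F G)}) : {malg K[(oforest * oforest)%type]} :=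
  vect K (opair S).
pose f (A : {set overt F}) (B : {set overt G}) := h (gblocks A B).
apply: (etrans (congr1 (@osplit K P) (Ho_graft F G))).
apply: (etrans (osplit_vect K P (ograft F G))).
apply: (etrans (@sum_graft_ideals _ F G P b f h Pb PNb (fun A B => erefl))).
apply: congrD5'.
- by case: (b) => //; rewrite (tens_vect K) /f /h opair_graft_0T.
- apply: esym; apply: (etrans (swd_osplit _ P G)).
  apply: eq_bigr => B /andP[pB _]; have [B0 Bc] := pidealC pB.
  have /and3P[iB _ _] := pB; rewrite (Ho_graft F (osub (~: B))) (tens_vect K).
  by rewrite /f /h (opair_graft_0B F B0 Bc iB).
- case: (b) => //; apply: esym; apply: (etrans (swd_osplit _ id F)).
  apply: eq_bigr => A /andP[/pidealC[A0 Ac] gA]; rewrite (Ho_graft (osub A) G) (tens_vect K).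
  by rewrite /f /h (opair_graft_AT G gA Ac).
- apply: esym; apply: (etrans (swd_osplit _ negb F)).
  apply: eq_bigr => A /andP[/pidealC[A0 Ac] gA]; case: (b).
    by rewrite (Ho_mul (osub A) G) (tens_vect K) /f /h (opair_graft_NT G gA A0 Ac).
  by rewrite (Ho_graft (osub (~: A)) G) (tens_vect K) /f /h (opair_graft_N0 G gA A0 Ac).
apply: esym; apply: (etrans (swd_osplit _ negb F)).
apply: eq_bigr => A /andP[/pidealC[A0 Ac] gA]; apply: (etrans (swd_osplit _ P G)).
apply: eq_bigr => B /andP[pB _]; have [B0 Bc] := pidealC pB.
have /and3P[iB _ _] := pB; apply: (etrans (mul_tens_graft _ _ _ _)).
by rewrite /f /h (opair_graft_NB gA A0 Ac B0 Bc iB).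
Qed.

End HoCompat.

(** * Duplicial axioms and grading for ordered forests *)

Lemma pgraph_mulA : associative pgraph_mul.
Proof.
move=> F G H; apply: pgraph_eq => /= [|i]; first by rewrite !addnS addnA.
rewrite !npar_mul [(tag (pgraph_mul F G)).+1]/= -addSn.
have [lt_i|ge_i] := ltnP i (tag F).+1; first by rewrite ltn_addr.
rewrite ltn_subLR // subnDA; case: ifP => // _.
by case: (npar H _) => //= y; rewrite addnA.
Qed.

Lemma pgraph_graftA : associative pgraph_graft.
Proof.
move=> F G H; apply: pgraph_eq => /= [|i]; first by rewrite !addnS addnA.
rewrite !npar_graft [(tag (pgraph_graft F G)).+1]/= [(tag (pgraph_graft G H)).+1]/=.
rewrite -subnDA; set f := (tag F).+1; set g := (tag G).+1; set h := (tag H).+1.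
have -> : (tag F + g).+1 = (f + g)%N by [].
have -> : (tag G + h).+1 = (g + h)%N by [].
have [lt_f|ge_f] := ltnP i f; first by rewrite ltn_addr.
rewrite -addnA !ltn_subLR //; case: (ltnP i (f + g)) => [lt_fg|ge_fg].
  by rewrite ifT //; lia.
case: (ltnP i (f + (g + h))) => // _.
by case: (npar H _) => [k|] /=; congr Some; rewrite /f /g; lia.
Qed.

Lemma pgraph_mul_graft F G H :
  pgraph_graft (pgraph_mul F G) H = pgraph_mul F (pgraph_graft G H).
Proof.
apply: pgraph_eq => /= [|i]; first by rewrite !addnS addnA.
rewrite npar_graft !npar_mul npar_graft -subnDA.
set f := (tag F).+1; set g := (tag G).+1; set h := (tag H).+1.
have -> : (tag (pgraph_mul F G)).+1 = (f + g)%N by [].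
have [lt_f|ge_f] := ltnP i f; first by rewrite ltn_addr.
rewrite -addnA !ltn_subLR //; case: ltnP => // ge_fg; case: ltnP => // lt_fgh /=.
by case: (npar H _) => [k|] /=; congr Some; rewrite ?addnA ?addnS.
Qed.

Lemma Ho_duplicial (K : fieldType) : duplicial_algebra (Ho K).
Proof.
(* The three axioms share the shape (x op y) op' z = x op (y op' z), checked on forests and extended
   by linearity. *)
have E3 (op op' : dd_space (Ho K) -> dd_space (Ho K) -> dd_space (Ho K))
    (o o' : oforest -> oforest -> oforest) :
    bilin op -> bilin op' ->
    (forall F G, op (vect K F) (vect K G) = vect K (o F G)) ->
    (forall F G, op' (vect K F) (vect K G) = vect K (o' F G)) ->
    (forall F G H, o' (o F G) H = o F (o' G H)) ->
  forall x y z, op' (op x y) z = op x (op' y z).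
  move=> [opl opr] [opl' opr'] ho ho' oo x y z.
  apply: (lin_eq (f := fun x => op' (op x y) z) (g := fun x => op x (op' y z))) => [||F].
  - exact: lin_comp (opl' z) (opl y).
  - exact: opl.
  apply: (lin_eq (f := fun y => op' (op (vect K F) y) z)
    (g := fun y => op (vect K F) (op' y z))) => [||G].
  - exact: lin_comp (opl' z) (opr _).
  - exact: lin_comp (opr _) (opl' z).
  apply: (lin_eq (f := fun z => op' (op (vect K F) (vect K G)) z)
    (g := fun z => op (vect K F) (op' (vect K G) z))) => [||H].
  - exact: opr'.
  - exact: lin_comp (opr _) (opr' _).
  apply: (etrans (congr1 (fun t => op' t (vect K H)) (ho F G))).
  apply: (etrans (ho' _ H)); rewrite oo; apply: esym.
  exact: (etrans (congr1 (op (vect K F)) (ho' G H)) (ho F _)).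
have mb := @bilin_mul K (Ho K); have gb := @bilin_graft K (Ho K).
have mv := @Ho_mul K; have gv := @Ho_graft K.
split.
- apply: (E3 _ _ _ _ mb mb mv mv) => F G H; apply: val_inj.
  exact: esym (pgraph_mulA (val F) (val G) (val H)).
- apply: (E3 _ _ _ _ gb gb gv gv) => F G H; apply: val_inj.
  exact: esym (pgraph_graftA (val F) (val G) (val H)).
- apply: (E3 _ _ _ _ mb gb mv gv) => F G H; apply: val_inj.
  exact: (pgraph_mul_graft (val F) (val G) (val H)).
Qed.

Lemma Ho_compat (K : fieldType) : dupdend_compat (Ho K).
Proof.
have E1 : @dd_prec K (Ho K) = @osplit K id by apply/funext => x; rewrite prec_osplit.
have E2 : @dd_succ K (Ho K) = @osplit K negb by apply/funext => x; rewrite succ_osplit.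
have E3 : @dd_cop K (Ho K) = @osplit K predT by apply/funext => x; rewrite cop_osplit.
have l1 := @lin_osplit K id; have l2 := @lin_osplit K negb.
have l3 := @lin_osplit K predT.
have m1 F G := @osplit_mul K true id F G isT erefl.
have m2 F G := @osplit_mul K false negb F G isT erefl.
have g1 F G := @osplit_graft K true id F G isT erefl.
have g2 F G := @osplit_graft K false negb F G isT erefl.
rewrite /dupdend_compat E1 E2 E3; move: l1 l2 l3 m1 m2 g1 g2.
(* Generalized, the three maps are known to [lin_tac] only through the linearity hypotheses in the
   context. *)
move: (@osplit K id) (@osplit K negb) (@osplit K predT) => p s c lp ls lc.
move=> m1 m2 g1 g2; split=> x y; move: x y; apply: bilin_eq.
- by lin_tac.
- by lin_tac.
- exact: m1.
- by lin_tac.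
- by lin_tac.
- exact: m2.
- by lin_tac.
- by lin_tac.
- exact: g1.
- by lin_tac.
- by lin_tac.
- by move=> F G; have := g2 F G; rewrite add0r addr0.
Qed.

Lemma homog_bilin (K : fieldType) (B C E : choiceType) (dB : B -> nat)
    (dC : C -> nat) (dE : E -> nat) (op : {malg K[B]} -> {malg K[C]} -> {malg K[E]}) :
  bilin op -> (forall b c, homog dE (dB b + dC c) (op (vect K b) (vect K c))) ->
  forall m n x y, homog dB m x -> homog dC n y -> homog dE (m + n) (op x y).
Proof.
move=> [opl opr] oph m n x y hx hy; rewrite (linE (opl y)).
rewrite big_seq; apply: homog_sum => b xb; apply: homogZ.
rewrite (linE (opr _)) big_seq; apply: homog_sum => c yc; apply: homogZ.
by rewrite -(hx b xb) -(hy c yc).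
Qed.

Lemma osize_sub (F : oforest) (A : {set overt F}) : A != set0 ->
  osize (osub A) = #|A|.
Proof. by move=> A0; rewrite /osize /= prednK // card_gt0. Qed.

Lemma homog_cutsum (K : fieldType) P F :
  homog (@dd_deg2 K (Ho K)) (osize F) (cutsum K P F).
Proof.
apply: homog_sum => A /andP[/pidealC[A0 Ac] _]; apply: homog_vect.
rewrite /dd_deg2 /= (osize_sub A0) (osize_sub Ac).
by rewrite cardsC card_ord.
Qed.

Lemma Ho_homogeneous (K : fieldType) : homogeneous_maps (Ho K).
Proof.
split.
- apply: (homog_bilin (@bilin_mul K (Ho K))) => F G.
  rewrite Ho_mul; apply: homog_vect.
  by rewrite /= /osize /= !addSn.
- apply: (homog_bilin (@bilin_graft K (Ho K))) => F G.
  rewrite Ho_graft; apply: homog_vect.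
  by rewrite /= /osize /= !addSn.
- apply: homog_lin => [|F]; first exact: lin_prec.
  by rewrite prec_osplit osplit_vect; apply: homog_cutsum.
- apply: homog_lin => [|F]; first exact: lin_succ.
  by rewrite succ_osplit osplit_vect; apply: homog_cutsum.
Qed.

Theorem Ho_bialgebra (K : fieldType) : graded_dupdend_bialgebra (Ho K).
Proof.
split; [exact: Ho_duplicial|exact: Ho_dendriform|exact: Ho_compat|].
exact: Ho_homogeneous.
Qed.

(** * Heap-ordered forests *)

Section BasisMap.

Variables (K : fieldType) (B C : choiceType) (f : B -> C).

Definition bmap : {malg K[B]} -> {malg K[C]} := linext (fun b => vect K (f b)).

Lemma lin_bmap : lin bmap. Proof. exact: lin_linext. Qed.

Lemma bmap_vect b : bmap (vect K b) = vect K (f b).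
Proof. exact: linext_vect. Qed.

Lemma bmap_inj : injective f -> injective bmap.
Proof.
move=> finj x y E; apply/malgP=> b.
have coef z : (bmap z)@_(f b) = z@_b.
  move: z; apply: (@lin_eq _ _ K^o) => [||c].
  - exact: lin_comp (@lin_coef _ _ (f b)) lin_bmap.
  - exact: lin_coef.
  by rewrite bmap_vect !coef_vect (inj_eq finj).
by rewrite -!coef E.
Qed.

End BasisMap.

Section HeapOrdered.

Variable K : fieldType.

(** The inclusion, along which [transport_dupdend] brings back all the axioms of [Ho]. *)
Definition Hho_val : dd_space (Hho K) -> dd_space (Ho K) :=
  @bmap K hoforest oforest val.

Lemma Hho_val_cut (P : forall F : oforest, pred {set overt F}) (F : hoforest) :
  \sum_(S | P (val F) S) vect K (osub (lea (@oedge (val F)) S), osub (roo (@oedge (val F)) S))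
  = tmap Hho_val Hho_val (\sum_(S | P (val F) S)
      vect K (hosub (lea (@oedge (val F)) S), hosub (roo (@oedge (val F)) S))).
Proof.
rewrite lin_sum; last exact: lin_tmap.
apply: eq_bigr => S _; rewrite tmap_vect.
rewrite -(tens_vect K (osub _) (osub _)).
by rewrite -(bmap_vect K val (hosub (lea _ S))) -(bmap_vect K val (hosub (roo _ S))).
Qed.

Lemma Hho_morphism : dd_morphism Hho_val.
Proof.
have jl : lin Hho_val by exact: lin_bmap.
split=> //.
- apply: bilin_eq; [by lin_tac|by lin_tac|] => F G.
  apply: (etrans (congr1 Hho_val (bilinext_vect (@dd_mul0 K (Hho K)) F G))).
  apply: (etrans (bmap_vect K val (homul F G))).
  apply: esym; apply: (etrans (congr2 _ (bmap_vect K val F) (bmap_vect K val G))).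
  exact: Ho_mul.
- apply: bilin_eq; [by lin_tac|by lin_tac|] => F G.
  apply: (etrans (congr1 Hho_val (bilinext_vect (@dd_graft0 K (Hho K)) F G))).
  apply: (etrans (bmap_vect K val (hograft F G))).
  apply: esym; apply: (etrans (congr2 _ (bmap_vect K val F) (bmap_vect K val G))).
  exact: Ho_graft.
- apply: lin_eq; [by lin_tac|by lin_tac|] => F.
  apply: (etrans (congr1 _ (bmap_vect K val F))).
  apply: (etrans (linext_vect (@dd_prec0 K (Ho K)) (val F))).
  apply: esym; apply: (etrans (congr1 _ (linext_vect (@dd_prec0 K (Hho K)) F))).
  apply: esym; exact: (Hho_val_cut (fun F S => proper_cut (@oedge F) S
     && (ogreatest F \in lea (@oedge F) S)) F).
- apply: lin_eq; [by lin_tac|by lin_tac|] => F.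
  apply: (etrans (congr1 _ (bmap_vect K val F))).
  apply: (etrans (linext_vect (@dd_succ0 K (Ho K)) (val F))).
  apply: esym; apply: (etrans (congr1 _ (linext_vect (@dd_succ0 K (Hho K)) F))).
  apply: esym; exact: (Hho_val_cut (fun F S => proper_cut (@oedge F) S
     && (ogreatest F \in roo (@oedge F) S)) F).
Qed.

Theorem Hho_bialgebra : graded_dupdend_bialgebra (Hho K).
Proof.
apply: (transport_dupdend Hho_morphism); last exact: Ho_bialgebra.
  by apply: bmap_inj; apply: val_inj.
move=> F; rewrite /Hho_val (bmap_vect K val F); exact: homog_vect.
Qed.

End HeapOrdered.

(** * Planar forests *)

Section PlanarCuts.

Variable D : choiceType.
Local Notation tree := (ptree D).
Local Notation forest := (seq tree).

(** Mutual induction, which reaches the subtrees nested in the list of children. *)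
Lemma ptree_forest_ind (P : tree -> Prop) (Q : forest -> Prop) :
  (forall d ts, Q ts -> P (PNode d ts)) -> Q [::] ->
  (forall t ts, P t -> Q ts -> Q (t :: ts)) ->
  (forall t, P t) /\ (forall ts, Q ts).
Proof.
move=> hP h0 hc; suff PT t : P t by split=> //; elim=> // t ts; apply: hc.
move: t; fix IH 1; case=> d ts; apply: hP.
by elim: ts => // t ts IHts; apply: hc.
Qed.

(** The starting index is a parameter because removing the first tree of a forest shifts the
    addresses of the others. *)
Definition fverts (i : nat) (F : forest) : seq (seq nat) :=
  flatmapi (fun i u => map (cons i) (tree_verts u)) i F.
Definition fsub (P : pred (seq nat)) (i : nat) (F : forest) : forest :=
  flatmapi (fun i u => tree_sub (fun a => P (i :: a)) u) i F.
Definition frleaf (i : nat) (F : forest) : seq nat :=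
  rightmost_from (@tree_rleaf D) i F.

Arguments fverts : simpl never.
Arguments fsub : simpl never.
Arguments frleaf : simpl never.

Lemma fverts_cons i t F :
  fverts i (t :: F) = map (cons i) (tree_verts t) ++ fverts i.+1 F.
Proof. by []. Qed.

Lemma fsub_cons P i t F :
  fsub P i (t :: F) = tree_sub (fun a => P (i :: a)) t ++ fsub P i.+1 F.
Proof. by []. Qed.

Lemma frleaf_cons i t F : F != [::] -> frleaf i (t :: F) = frleaf i.+1 F.
Proof. by case: F. Qed.

Lemma fverts_ge i F a : a \in fverts i F -> exists j b, a = j :: b /\ (i <= j)%N.
Proof.
elim: F i => // t F IHF i; rewrite fverts_cons mem_cat => /orP[/mapP[b _ ->]|].
  by exists i, b.
by case/IHF=> j [b [-> lt_ij]]; exists j, b; split=> //; apply: ltnW.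
Qed.

Lemma fverts_cons0 i t F b : (i :: b \in fverts i (t :: F)) = (b \in tree_verts t).
Proof.
rewrite fverts_cons mem_cat mem_map => [|x y [] //].
by apply/orb_idr => /fverts_ge[j [c [[<- _]]]]; rewrite ltnn.
Qed.

Lemma fverts_consS i t F j b : (i < j)%N ->
  (j :: b \in fverts i (t :: F)) = (j :: b \in fverts i.+1 F).
Proof.
move=> lt_ij; rewrite fverts_cons mem_cat; case: mapP => // -[c _ [E]].
by rewrite E ltnn in lt_ij.
Qed.

Lemma verts_uniq : (forall t : tree, uniq (tree_verts t)) /\ (forall (F : forest) i, uniq (fverts i F)).
Proof.
apply: ptree_forest_ind => [d ts IH|//|t ts IHt IHts i].
  rewrite /= -/(fverts 0 ts) IH andbT.
  by apply/negP=> /fverts_ge[j [b []]].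
rewrite fverts_cons cat_uniq (map_inj_uniq) ?IHt ?IHts ?andbT => [|x y [] //].
apply/hasPn=> a /fverts_ge[j [b [-> lt_ij]]]; apply/mapP=> -[c _ [E]].
by rewrite E ltnn in lt_ij.
Qed.

Lemma verts_prefix : (forall (t : tree) a k, rcons a k \in tree_verts t -> a \in tree_verts t) /\
  (forall (F : forest) i a k, rcons a k \in fverts i F -> a = [::] \/ a \in fverts i F).
Proof.
apply: ptree_forest_ind => [d ts IH a k|//|t ts IHt IHts i a k].
  rewrite !inE -/(fverts 0 ts) => /orP[/eqP|/IH[->|->]]; rewrite ?eqxx ?orbT //.
  by case: a.
case: a => [|j a]; first by left.
rewrite rcons_cons => aV; right; have [l [b [[Ej _] le_il]]] := fverts_ge aV.
subst l; move: le_il; rewrite leq_eqVlt => /orP[/eqP Ei|lt_ij].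
  by subst j; move: aV; rewrite !fverts_cons0; apply: IHt.
by move: aV; rewrite !fverts_consS // => /(IHts _ (j :: a))[].
Qed.

Lemma rleaf_verts : (forall t : tree, tree_rleaf t \in tree_verts t) /\
  (forall (F : forest) i, F != [::] -> frleaf i F \in fverts i F).
Proof.
apply: ptree_forest_ind => [d ts IH|//|t ts IHt IHts i _].
  rewrite inE -/(fverts 0 ts) /= -/(frleaf 0 ts).
  by case: ts IH => //= t ts IH; rewrite IH ?orbT.
have [->|ts0] := eqVneq ts [::].
  by have := fverts_cons0 i t [::] (tree_rleaf t); rewrite IHt.
by rewrite frleaf_cons // fverts_cons mem_cat IHts ?orbT.
Qed.

Lemma sub_all : (forall (t : tree) P, all P (tree_verts t) -> tree_sub P t = [:: t]) /\
  (forall (F : forest) P i, all P (fverts i F) -> fsub P i F = F).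
Proof.
apply: ptree_forest_ind => [d ts IH P|//|t ts IHt IHts P i].
  by rewrite /= -/(fverts 0 ts) -/(fsub P 0 ts) => /andP[-> /IH ->].
rewrite fverts_cons all_cat all_map fsub_cons => /andP[Pt Pts].
by rewrite IHt // IHts.
Qed.

Lemma sub_none : (forall (t : tree) P, ~~ has P (tree_verts t) -> tree_sub P t = [::]) /\
  (forall (F : forest) P i, ~~ has P (fverts i F) -> fsub P i F = [::]).
Proof.
apply: ptree_forest_ind => [d ts IH P|//|t ts IHt IHts P i].
  by rewrite /= -/(fverts 0 ts) -/(fsub P 0 ts) negb_or => /andP[/negbTE -> /IH ->].
rewrite fverts_cons has_cat has_map fsub_cons negb_or => /andP[Pt Pts].
by rewrite IHt // IHts.
Qed.

(* A cut (l, r, b) consists of Lea, Roo, and whether the rightmost leaf is in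
   Lea (b is false for the empty forest); it comes with the indicator of Lea
   along the list of vertices. *)
Definition cut : Type := (forest * forest * bool)%type.

(** [last] tells that no tree follows the first one, which then contains the rightmost leaf. *)
Definition join_cuts (last : bool) (c1 c2 : bitseq * cut) : bitseq * cut :=
  let: (m1, (l1, r1, b1)) := c1 in
  let: (m2, (l2, r2, b2)) := c2 in
  (m1 ++ m2, (l1 ++ l2, r1 ++ r2, if last then b1 else b2)).

(** The root stays in Roo. For a childless root, the value false carried by the empty forest is
    right: the rightmost leaf is this root. *)
Definition root_cut (d : D) (c : bitseq * cut) : bitseq * cut :=
  let: (m, (l, r, b)) := c in (false :: m, (l, [:: PNode d r], b)).

Definition fcuts_of (tc : tree -> seq (bitseq * cut)) :=
  fix loop (F : forest) : seq (bitseq * cut) :=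
    if F is t :: F'
    then [seq join_cuts (nilp F') c1 c2 | c1 <- tc t, c2 <- loop F']
    else [:: ([::], ([::], [::], false))].

(** Either the root is in Lea, and the whole tree with it, or it stays and the cut is one of the
    forest of its children. *)
Fixpoint tcuts (t : tree) : seq (bitseq * cut) :=
  let: PNode d ts := t in
  (nseq (size (tree_verts t)) true, ([:: t], [::], true))
  :: map (root_cut d) (fcuts_of tcuts ts).

Definition fcuts : forest -> seq (bitseq * cut) := fcuts_of tcuts.

Lemma fcuts_cons t F : fcuts (t :: F)
  = [seq join_cuts (nilp F) c1 c2 | c1 <- tcuts t, c2 <- fcuts F].
Proof. by []. Qed.

Lemma tcuts_node d ts : tcuts (PNode d ts)
  = (nseq (size (fverts 0 ts)).+1 true, ([:: PNode d ts], [::], true))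
    :: map (root_cut d) (fcuts ts).
Proof. by []. Qed.

(** P and P' are known only through their values along V, which is stable under the composition with
    [cons i] in the recursion. The guard on n exempts the empty forest, which has no rightmost
    leaf. *)
Definition sub_spec (n : nat) (V : seq (seq nat)) (sub : pred (seq nat) -> forest) (leaf : seq nat)
    (c : bitseq * cut) : Prop :=
  forall P P' : pred (seq nat), map P V = c.1 -> map P' V = map negb c.1 ->
  [/\ sub P = c.2.1.1, sub P' = c.2.1.2 & (0 < n)%N -> P leaf = c.2.2].

Lemma cuts_sub :
  (forall t : tree, {in tcuts t, forall c,
     size c.1 = size (tree_verts t) /\
     sub_spec 1 (tree_verts t) (fun P => tree_sub P t) (tree_rleaf t) c}) /\
  (forall (F : forest) i, {in fcuts F, forall c,
     size c.1 = size (fverts i F) /\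
     sub_spec (size F) (fverts i F) (fun P => fsub P i F) (frleaf i F) c}).
Proof.
apply: ptree_forest_ind => [d ts IH|i c|t ts IHt IHts i].
- move=> c; rewrite tcuts_node inE => /orP[/eqP ->|/mapP[c' c'ts ->]].
    split=> [|P P' hP hP']; first by rewrite size_nseq.
    have PT : all P (tree_verts (PNode d ts)).
      have : all id (map P (tree_verts (PNode d ts))) by rewrite hP all_nseq orbT.
      by rewrite all_map.
    have P'T : ~~ has P' (tree_verts (PNode d ts)).
      have : ~~ has id (map P' (tree_verts (PNode d ts))).
        by rewrite hP' has_map has_nseq andbF.
      by rewrite has_map.
    rewrite (sub_all.1 _ _ PT) (sub_none.1 _ _ P'T); split=> // _.
    exact: (allP PT _ (rleaf_verts.1 _)).
  have [sz H] := IH 0%N c' c'ts.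
  case: c' => m [[l r] b] /= in c'ts sz H *.
  split=> [|P P' /= [P0 hP] [P'0 hP']]; first by rewrite sz.
  rewrite -/(fsub P 0 ts) -/(fsub P' 0 ts) P0 P'0 -/(frleaf 0 ts).
  have [-> -> bP] := H P P' hP hP'; split=> // _.
  case: ts {IH sz H hP hP'} c'ts bP => [|t ts] c'ts bP; last exact: bP.
  by move: c'ts; rewrite inE => /eqP[_ _ _ ->].
- by rewrite inE => /eqP ->.
move=> c; rewrite fcuts_cons => /allpairsP[[c1 c2] [/= /IHt[sz1 H1] c2ts ->]].
have [sz2 H2] := IHts i.+1 _ c2ts.
case: c1 c2 sz1 sz2 H1 H2 c2ts => [m1 [[l1 r1] b1]] [m2 [[l2 r2] b2]] /= sz1 sz2 H1 H2 c2ts.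
split=> [|P P']; first by rewrite fverts_cons !size_cat size_map sz1 sz2.
rewrite fverts_cons !map_cat -!map_comp => /eqP.
rewrite eqseq_cat ?size_map // => /andP[/eqP hP1 /eqP hP2] /eqP.
rewrite eqseq_cat ?size_map // => /andP[/eqP hP1' /eqP hP2'].
rewrite !fsub_cons; have [-> -> hb1] := H1 _ _ hP1 hP1'.
have [-> -> hb2] := H2 _ _ hP2 hP2'; split=> // _.
case: ts {IHts sz2 H2 hP2 hP2' c2ts} hb2 => [|u ts] hb2; first exact: hb1.
exact: hb2.
Qed.

(** With [mem_cuts_masks], the masks list every set closed under descendants exactly once. *)
Lemma cuts_masks_uniq :
  (forall t : tree, uniq (map fst (tcuts t))) /\
  (forall F : forest, uniq (map fst (fcuts F))).
Proof.
apply: ptree_forest_ind => [d ts IH|//|t ts IHt IHts].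
  rewrite tcuts_node /= -map_comp; apply/andP; split.
    by apply/mapP=> -[[m [[l r] b]] _].
  rewrite (eq_map (f := _ \o _) (g := cons false \o fst)); last by case=> m [[l r] b].
  by rewrite map_comp map_inj_uniq // => x y [].
rewrite fcuts_cons map_allpairs.
have E c1 c2 : fst (join_cuts (nilp ts) c1 c2) = c1.1 ++ c2.1.
  by case: c1 c2 => [? [[? ?] ?]] [? [[? ?] ?]].
have -> : [seq (join_cuts (nilp ts) c1 c2).1 | c1 <- tcuts t, c2 <- fcuts ts]
   = [seq c1.1 ++ c2.1 | c1 <- tcuts t, c2 <- fcuts ts].
  by congr flatten; apply: eq_map => c1; apply: eq_map => c2; apply: E.
have -> : [seq c1.1 ++ c2.1 | c1 <- tcuts t, c2 <- fcuts ts]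
   = [seq m1 ++ m2 | m1 <- map fst (tcuts t), m2 <- map fst (fcuts ts)].
  by rewrite allpairs_mapl allpairs_mapr.
apply: allpairs_uniq => // -[m1 m2] [m1' m2'] /=.
move=> /allpairsP[[x1 x2] [/mapP[c1 /cuts_sub.1[sz1 _] E1] _ [-> _]]].
move=> /allpairsP[[y1 y2] [/mapP[c1' /cuts_sub.1[sz1' _] E1'] _ [-> _]]].
move=> /eqP; rewrite /= in E1 E1' *; rewrite eqseq_cat ?E1 ?E1' ?sz1 ?sz1' //.
by case/andP=> /eqP -> /eqP ->.
Qed.

Definition closed_verts (V : seq (seq nat)) (P : pred (seq nat)) : Prop :=
  forall a k, a \in V -> rcons a k \in V -> P a -> P (rcons a k).

Lemma mem_cuts_masks :
  (forall (t : tree) P,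
    closed_verts (tree_verts t) P <-> map P (tree_verts t) \in map fst (tcuts t)) /\
  (forall (F : forest) i P,
    closed_verts (fverts i F) P <-> map P (fverts i F) \in map fst (fcuts F)).
Proof.
apply: ptree_forest_ind => [d ts IH P|i P|t ts IHt IHts i P].
- rewrite tcuts_node /= -/(fverts 0 ts) inE -map_comp.
  rewrite (eq_map (f := _ \o _) (g := cons false \o fst)); last by case=> m [[l r] b].
  rewrite map_comp; case P0: (P [::]).
    have -> : (true :: map P (fverts 0 ts) \in map (cons false) (map fst (fcuts ts))) = false.
      by apply/mapP => -[].
    rewrite orbF eqseq_cons /=.
    have -> : (map P (fverts 0 ts) == nseq (size (fverts 0 ts)) true) = all P (fverts 0 ts).
      rewrite -(size_map P) (sameP eqP (all_pred1P true (map P (fverts 0 ts)))).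
      by rewrite all_map; apply: eq_all => a /=; case: (P a).
    split=> [cl|/allP PV a k _]; last first.
      by rewrite inE => /orP[/eqP -> //|/PV].
    apply/allP=> a aV; have {aV} : a \in tree_verts (PNode d ts) by rewrite inE aV orbT.
    (* Closure carries membership from the root to each vertex, one step of its address at a
       time. *)
    elim/last_ind: a => // a k IHa akV; have aV := verts_prefix.1 _ _ _ akV.
    by apply: cl => //; apply: IHa.
  rewrite eqseq_cons /= mem_map => [|x y [] //]; rewrite -(IH 0%N).
  split=> cl a k.
    by move=> aV akV; apply: cl; rewrite inE ?aV ?akV orbT.
  rewrite !inE => /orP[/eqP ->|aV]; first by rewrite P0.
  by case/orP=> [/eqP|]; [case: a {aV} | apply: cl].
- by rewrite mem_seq1; split=> // _ a k.
rewrite fcuts_cons fverts_cons map_cat -map_comp.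
have -> : (map (P \o cons i) (tree_verts t) ++ map P (fverts i.+1 ts)
    \in map fst [seq join_cuts (nilp ts) c1 c2 | c1 <- tcuts t, c2 <- fcuts ts])
  = (map (P \o cons i) (tree_verts t) \in map fst (tcuts t))
    && (map P (fverts i.+1 ts) \in map fst (fcuts ts)).
  apply/mapP/andP => [[c /allpairsP[[c1 c2] [/= c1t c2ts ->]]]|].
    have [sz1 _] := cuts_sub.1 _ _ c1t.
    case: c1 c2 c1t c2ts sz1 => [m1 [[l1 r1] b1]] [m2 [[l2 r2] b2]] c1t c2ts /= sz1.
    move/eqP; rewrite eqseq_cat ?size_map // => /andP[/eqP -> /eqP ->].
    by split; apply/mapP; [exists (m1, (l1, r1, b1)) | exists (m2, (l2, r2, b2))].
  case=> /mapP[[m1 [[l1 r1] b1]] c1t ->] /mapP[[m2 [[l2 r2] b2]] c2ts ->].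
  exists (join_cuts (nilp ts) (m1, (l1, r1, b1)) (m2, (l2, r2, b2))) => //.
  exact: allpairs_f.
split=> [cl|/andP[/IHt clt /(IHts i.+1) clts] a k].
  apply/andP; split; [apply/IHt | apply/(IHts i.+1)] => a k.
    move=> aV akV /=; rewrite -rcons_cons; apply: cl; rewrite ?rcons_cons.
      by rewrite -fverts_cons fverts_cons0.
    by rewrite -fverts_cons fverts_cons0.
  by move=> aV akV; apply: cl; rewrite mem_cat ?aV ?akV orbT.
rewrite -fverts_cons => aV akV.
have [j [b [Ea le_ij]]] := fverts_ge aV; subst a.
move: le_ij; rewrite leq_eqVlt => /orP[/eqP Ei|lt_ij].
  by subst j; move: aV akV; rewrite rcons_cons !fverts_cons0 => aV akV; apply: clt.
by move: aV akV; rewrite rcons_cons !fverts_consS //; apply: (clts (j :: b)).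
Qed.

End PlanarCuts.

Arguments fverts : simpl never.
Arguments fsub : simpl never.
Arguments frleaf : simpl never.
Arguments fcuts : simpl never.
Arguments tcuts : simpl never.

(** * Half-coproducts of planar forests through the enumeration *)

Section PlanarCoproduct.

Variables (K : fieldType) (D : gradedSet).
Implicit Types F : pforest D.

Lemma pedge_acyclic F : acyclic (@pedge D F).
Proof.
apply: (@rank_acyclic _ _ (fun v : pvert F => size (ssval v))) => v w.
by case/andP=> /eqP ->.
Qed.

Definition mem_addr F (L : {set pvert F}) (a : seq nat) : bool := a \in addresses L.

Lemma mem_addresses F (L : {set pvert F}) (v : pvert F) :
  (ssval v \in addresses L) = (v \in L).
Proof. by rewrite /addresses mem_image //; apply: val_inj. Qed.

Definition mask_set F (m : bitseq) : {set pvert F} :=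
  [set v | nth false m (index (ssval v) (forest_verts (val F)))].

Definition set_mask F (L : {set pvert F}) : bitseq :=
  map (mem_addr L) (forest_verts (val F)).

Lemma set_maskK F : cancel (@set_mask F) (@mask_set F).
Proof.
move=> L; apply/setP=> v; rewrite inE /set_mask.
rewrite (nth_map [::]) ?index_mem ?ssvalP // nth_index ?ssvalP //.
exact: mem_addresses.
Qed.

Lemma mask_setK F m : size m = size (forest_verts (val F)) ->
  set_mask (mask_set F m) = m.
Proof.
move=> sz; apply: (@eq_from_nth _ false); first by rewrite size_map.
move=> i; rewrite size_map => lt_i; rewrite (nth_map [::]) //.
set a := nth [::] _ i; have aV : a \in forest_verts (val F) by apply: mem_nth.
rewrite /mem_addr (mem_addresses (mask_set F m) (SeqSub aV)) inE /= index_uniq //.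
exact: (verts_uniq D).2.
Qed.

Lemma ideal_closed F (L : {set pvert F}) :
  ideal (@pedge D F) L <-> closed_verts (forest_verts (val F)) (mem_addr L).
Proof.
split=> [/idealP iL a k aV akV|cl].
  rewrite /mem_addr (mem_addresses L (SeqSub aV)) (mem_addresses L (SeqSub akV)).
  move=> aL; apply: (iL _ _ aL); rewrite /pedge /= size_rcons eqxx /=.
  by rewrite -cats1 prefix_prefix.
apply/idealP=> v w vL /andP[/eqP sz /prefixP[s Es]].
have : size s = 1%N by move: sz; rewrite Es size_cat => /eqP; rewrite -addn1 eqn_add2l => /eqP.
case: s Es => [|k []] // Es _.
rewrite -(mem_addresses L w) Es cats1; apply: cl; rewrite -?cats1 -?Es ?ssvalP //.
by rewrite /mem_addr mem_addresses.
Qed.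

Lemma sum_cuts (M : nmodType) F (f : {set pvert F} -> M) :
  \sum_(L | ideal (@pedge D F) L) f L
  = \sum_(c <- fcuts (val F)) f (mask_set F c.1).
Proof.
rewrite -(big_map fst xpredT (fun m => f (mask_set F m))).
rewrite -(big_map (@mask_set F) xpredT f) -[LHS]big_filter; apply: perm_big.
apply: uniq_perm.
- by apply: filter_uniq; apply: index_enum_uniq.
- rewrite map_inj_in_uniq; first exact: (cuts_masks_uniq D).2.
  move=> m1 m2 /mapP[c1 c1F ->] /mapP[c2 c2F ->] E.
  have [sz1 _] := (cuts_sub D).2 _ 0%N _ c1F; have [sz2 _] := (cuts_sub D).2 _ 0%N _ c2F.
  by rewrite -(mask_setK sz1) -(mask_setK sz2) E.
move=> L; rewrite mem_filter mem_index_enum andbT.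
apply/idP/mapP => [iL|[m mF ->]].
  exists (set_mask L); last by rewrite set_maskK.
  by apply/(mem_cuts_masks D).2 => //; apply/ideal_closed.
apply/ideal_closed/(mem_cuts_masks D).2.
rewrite -/(set_mask _) mask_setK //.
by case/mapP: mF => c cF ->; have [sz1 _] := (cuts_sub D).2 _ 0%N _ cF.
Qed.

(** Improper cuts contribute 0, so sums over [fcuts] need no properness condition. *)
Definition fvect2 (l r : seq (ptree D)) : {malg K[(pforest D * pforest D)%type]} :=
  if (insub l, insub r) is (Some a, Some b) then vect K (a, b) else 0.

Definition pcutsum (P : pred bool) (F : seq (ptree D)) :
    {malg K[(pforest D * pforest D)%type]} :=
  \sum_(c <- fcuts F | P c.2.2) fvect2 c.2.1.1 c.2.1.2.

Lemma mem_addrC F (L : {set pvert F}) a : a \in forest_verts (val F) ->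
  mem_addr (~: L) a = ~~ mem_addr L a.
Proof.
move=> aV; rewrite /mem_addr (mem_addresses (~: L) (SeqSub aV)) in_setC.
by rewrite (mem_addresses L (SeqSub aV)).
Qed.

Lemma rleafP F : forest_rleaf (val F) \in forest_verts (val F).
Proof. exact: (rleaf_verts D).2 _ 0%N (valP F). Qed.

Lemma fvect2_psub F (L : {set pvert F}) : ideal (@pedge D F) L ->
  fvect2 (fsub (mem_addr L) 0 (val F)) (fsub (mem_addr (~: L)) 0 (val F))
  = if (L != set0) && (L != setT) then vect K (psub L, psub (~: L)) else 0.
Proof.
have none (X : {set pvert F}) : X = set0 -> fsub (mem_addr X) 0 (val F) = [::].
  move=> ->; apply: (sub_none D).2; apply/hasPn => a _.
  rewrite /mem_addr /addresses; apply/negP=> /imageP[v].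
  by rewrite in_set0.
rewrite /fvect2; have [->|L0] := eqVneq L set0; first by rewrite none // insubN.
have [->|LT] := eqVneq L setT.
  by rewrite setCT (none set0) // [insub [::]]insubN //; case: insub.
have Lc : ~: L != set0 by rewrite -setCT (inj_eq (@setC_inj _)).
by rewrite -[fsub _ 0 _](psubE L0) -[fsub _ 0 _](psubE Lc) !valK.
Qed.

Lemma sum_pcuts (P : pred bool) F :
  \sum_(L | pideal (@pedge D F) L && P (mem_addr L (forest_rleaf (val F))))
     vect K (psub L, psub (~: L))
  = pcutsum P (val F).
Proof.
transitivity (\sum_(L | ideal (@pedge D F) L)
    if P (mem_addr L (forest_rleaf (val F))) then
      fvect2 (fsub (mem_addr L) 0 (val F)) (fsub (mem_addr (~: L)) 0 (val F)) else 0).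
  rewrite [LHS]big_mkcond [RHS]big_mkcond; apply: eq_bigr => L _; rewrite /pideal.
  case: (boolP (ideal _ L)) => //= iL; rewrite fvect2_psub //.
  by case: (L != set0); case: (L != setT); case: (P _).
rewrite sum_cuts /pcutsum [RHS]big_mkcond; apply: eq_big_seq => c cF.
have [sz H] := (cuts_sub D).2 _ 0%N _ cF.
have mE : map (mem_addr (mask_set F c.1)) (fverts 0 (val F)) = c.1.
  exact: (mask_setK sz).
have mE' : map (mem_addr (~: mask_set F c.1)) (fverts 0 (val F)) = map negb c.1.
  by rewrite -[in RHS]mE -map_comp; apply/eq_in_map => a aV; apply: mem_addrC.
have [-> -> ->] := H _ _ mE mE' => //.
by case: (val F) (valP F).
Qed.

Lemma Hp_prec_vect F : @dd_prec K (Hp K D) (vect K F) = pcutsum id (val F).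
Proof.
apply: (etrans (linext_vect (@dd_prec0 K (Hp K D)) F)).
apply: etrans (sum_pcuts id F).
exact: (sum_proper_cuts (pedge_acyclic F)
  (fun L => mem_addr L (forest_rleaf (val F))) (fun L => vect K (psub L, psub (~: L)))).
Qed.

Lemma Hp_succ_vect F : @dd_succ K (Hp K D) (vect K F) = pcutsum negb (val F).
Proof.
apply: (etrans (linext_vect (@dd_succ0 K (Hp K D)) F)).
apply: etrans (sum_pcuts negb F).
apply: (etrans (sum_proper_cuts (pedge_acyclic F)
  (fun L => mem_addr (~: L) (forest_rleaf (val F))) (fun L => vect K (psub L, psub (~: L))))).
by apply: eq_bigl => L; rewrite mem_addrC // rleafP.
Qed.

End PlanarCoproduct.

(** * Decompositions of sums over planar cuts *)

Section CutSums.

Variable D : choiceType.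
Local Notation tree := (ptree D).
Local Notation forest := (seq tree).
Implicit Types (F G : forest) (t : tree).

(** The summand h ignores the masks, which only serve to match cuts with sets of vertices. *)
Lemma big_fcuts_cons (M : nmodType) (h : forest -> forest -> bool -> M) t F :
  \sum_(c <- fcuts (t :: F)) h c.2.1.1 c.2.1.2 c.2.2
  = \sum_(c1 <- tcuts t) \sum_(c2 <- fcuts F)
      h (c1.2.1.1 ++ c2.2.1.1) (c1.2.1.2 ++ c2.2.1.2)
        (if nilp F then c1.2.2 else c2.2.2).
Proof.
rewrite fcuts_cons big_allpairs_dep; apply: eq_bigr => -[m1 [[l1 r1] b1]] _.
by apply: eq_bigr => -[m2 [[l2 r2] b2]] _.
Qed.

Lemma big_tcuts (M : nmodType) (h : forest -> forest -> bool -> M) d F :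
  \sum_(c <- tcuts (PNode d F)) h c.2.1.1 c.2.1.2 c.2.2
  = h [:: PNode d F] [::] true
    + \sum_(c <- fcuts F) h c.2.1.1 [:: PNode d c.2.1.2] c.2.2.
Proof.
rewrite tcuts_node big_cons big_map; congr (_ + _).
by apply: eq_bigr => -[m [[l r] b]] _.
Qed.

(** Peeling from the right suits the flag: the rightmost leaf always lies in the last tree t. *)
Lemma big_fcuts_rcons (M : nmodType) (h : forest -> forest -> bool -> M) F t :
  \sum_(c <- fcuts (rcons F t)) h c.2.1.1 c.2.1.2 c.2.2
  = \sum_(c1 <- fcuts F) \sum_(c2 <- tcuts t)
      h (c1.2.1.1 ++ c2.2.1.1) (c1.2.1.2 ++ c2.2.1.2) c2.2.2.
Proof.
elim: F h => [|u F IHF] h.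
  rewrite (big_fcuts_cons h t [::]) [RHS]big_seq1; apply: eq_bigr => c _.
  by rewrite big_seq1 /= !cats0.
rewrite rcons_cons big_fcuts_cons.
rewrite (big_fcuts_cons (fun l r _ => \sum_(c2 <- tcuts t)
   h (l ++ c2.2.1.1) (r ++ c2.2.1.2) c2.2.2)).
apply: eq_bigr => c1 _.
rewrite (IHF (fun l r b => h (c1.2.1.1 ++ l) (c1.2.1.2 ++ r)
  (if nilp (rcons F t) then c1.2.2 else b))).
apply: eq_bigr => c2 _; apply: eq_bigr => c3 _; rewrite !catA.
by case: (F).
Qed.

(** There is a single cut with empty Lea and a single one with empty Roo. For the empty forest these
    coincide, whence the flag [~~ nilp F]. *)
Lemma big_cuts_nil (M : nmodType) :
  (forall t (h : forest -> forest -> bool -> M),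
    \sum_(c <- tcuts t | nilp c.2.1.1) h c.2.1.1 c.2.1.2 c.2.2 = h [::] [:: t] false
    /\ \sum_(c <- tcuts t | nilp c.2.1.2) h c.2.1.1 c.2.1.2 c.2.2 = h [:: t] [::] true) /\
  (forall F (h : forest -> forest -> bool -> M),
    \sum_(c <- fcuts F | nilp c.2.1.1) h c.2.1.1 c.2.1.2 c.2.2 = h [::] F false
    /\ \sum_(c <- fcuts F | nilp c.2.1.2) h c.2.1.1 c.2.1.2 c.2.2
       = h F [::] (~~ nilp F)).
Proof.
have nilcat (s1 s2 : forest) : nilp (s1 ++ s2) = nilp s1 && nilp s2.
  by case: s1.
apply: ptree_forest_ind => [d ts IH h|h|t ts IHt IHts h].
- split; rewrite big_mkcond.
    apply: (etrans (big_tcuts (fun l r b => if nilp l then h l r b else 0) d ts)).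
    rewrite add0r -big_mkcond.
    by have [-> _] := IH (fun l r b => h l [:: PNode d r] b).
  apply: (etrans (big_tcuts (fun l r b => if nilp r then h l r b else 0) d ts)).
  by rewrite big1 // addr0.
- by split; rewrite big_mkcond big_seq1.
split; rewrite big_mkcond.
  apply: (etrans (big_fcuts_cons (fun l r b => if nilp l then h l r b else 0) t ts)).
  transitivity (\sum_(c1 <- tcuts t | nilp c1.2.1.1) \sum_(c2 <- fcuts ts | nilp c2.2.1.1)
      h (c1.2.1.1 ++ c2.2.1.1) (c1.2.1.2 ++ c2.2.1.2)
        (if nilp ts then c1.2.2 else c2.2.2)).
    rewrite [RHS]big_mkcond; apply: eq_bigr => c1 _; case: ifP => n1.
      by rewrite [RHS]big_mkcond; apply: eq_bigr => c2 _; rewrite nilcat n1.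
    by rewrite big1 // => c2 _; rewrite nilcat n1.
  have [-> _] := IHt (fun l r b => \sum_(c2 <- fcuts ts | nilp c2.2.1.1)
      h (l ++ c2.2.1.1) (r ++ c2.2.1.2) (if nilp ts then b else c2.2.2)).
  have [-> _] := IHts (fun l r b => h ([::] ++ l) ([:: t] ++ r) (if nilp ts then false else b)).
  by rewrite if_same.
apply: (etrans (big_fcuts_cons (fun l r b => if nilp r then h l r b else 0) t ts)).
transitivity (\sum_(c1 <- tcuts t | nilp c1.2.1.2) \sum_(c2 <- fcuts ts | nilp c2.2.1.2)
    h (c1.2.1.1 ++ c2.2.1.1) (c1.2.1.2 ++ c2.2.1.2)
      (if nilp ts then c1.2.2 else c2.2.2)).
  rewrite [RHS]big_mkcond; apply: eq_bigr => c1 _; case: ifP => n1.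
    by rewrite [RHS]big_mkcond; apply: eq_bigr => c2 _; rewrite nilcat n1.
  by rewrite big1 // => c2 _; rewrite nilcat n1.
have [_ ->] := IHt (fun l r b => \sum_(c2 <- fcuts ts | nilp c2.2.1.2)
    h (l ++ c2.2.1.1) (r ++ c2.2.1.2) (if nilp ts then b else c2.2.2)).
have [_ ->] := IHts (fun l r b => h ([:: t] ++ l) ([::] ++ r) (if nilp ts then true else b)).
by case: (nilp ts).
Qed.

Definition proper_pair (l r : forest) : bool := ~~ nilp l && ~~ nilp r.

Lemma big_cuts_split (M : nmodType) (s : seq (bitseq * cut D)) F
    (h : forest -> forest -> bool -> M) : ~~ nilp F ->
  (forall h : forest -> forest -> bool -> M,
    \sum_(c <- s | nilp c.2.1.1) h c.2.1.1 c.2.1.2 c.2.2 = h [::] F false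
    /\ \sum_(c <- s | nilp c.2.1.2) h c.2.1.1 c.2.1.2 c.2.2 = h F [::] true) ->
  \sum_(c <- s) h c.2.1.1 c.2.1.2 c.2.2
  = h [::] F false + h F [::] true
    + \sum_(c <- s | proper_pair c.2.1.1 c.2.1.2) h c.2.1.1 c.2.1.2 c.2.2.
Proof.
move=> F0 H; rewrite (bigID (fun c => nilp c.2.1.1)) /= (H h).1 -addrA; congr (_ + _).
rewrite (bigID (fun c => nilp c.2.1.2)) /=; congr (_ + _).
have [_] := H (fun l r b => if nilp l then 0 else h l r b).
rewrite (negbTE F0) => <-; rewrite [LHS]big_mkcond [RHS]big_mkcond.
by apply: eq_bigr => c _; case: (nilp c.2.1.1); case: (nilp c.2.1.2).
Qed.

Lemma big_tcuts_split (M : nmodType) t (h : forest -> forest -> bool -> M) :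
  \sum_(c <- tcuts t) h c.2.1.1 c.2.1.2 c.2.2
  = h [::] [:: t] false + h [:: t] [::] true
    + \sum_(c <- tcuts t | proper_pair c.2.1.1 c.2.1.2) h c.2.1.1 c.2.1.2 c.2.2.
Proof. by apply: big_cuts_split => // g; apply: (big_cuts_nil M).1. Qed.

Lemma big_fcuts_split (M : nmodType) F (h : forest -> forest -> bool -> M) :
  ~~ nilp F ->
  \sum_(c <- fcuts F) h c.2.1.1 c.2.1.2 c.2.2
  = h [::] F false + h F [::] true
    + \sum_(c <- fcuts F | proper_pair c.2.1.1 c.2.1.2) h c.2.1.1 c.2.1.2 c.2.2.
Proof.
move=> F0; apply: big_cuts_split => // g.
by have := (big_cuts_nil M).2 F g; rewrite F0.
Qed.

Definition nverts (F : forest) : nat := size (fverts 0 F).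

Lemma size_fverts i F : size (fverts i F) = nverts F.
Proof.
rewrite /nverts; elim: F i 0%N => // t F IHF i j.
by rewrite !fverts_cons !size_cat !size_map (IHF i.+1 j.+1).
Qed.

Lemma nverts_cat F G : nverts (F ++ G) = (nverts F + nverts G)%N.
Proof.
elim: F => // t F IHF; rewrite /nverts /= !fverts_cons !size_cat.
by rewrite !size_fverts IHF addnA.
Qed.

Lemma nverts_node d F : nverts [:: PNode d F] = (nverts F).+1.
Proof. by rewrite /nverts fverts_cons size_cat size_map addn0 /= -/(fverts 0 F). Qed.

Lemma nverts_eq0 F : (nverts F == 0)%N = nilp F.
Proof. by case: F => // -[d ts] F; rewrite -cat1s nverts_cat nverts_node. Qed.

Lemma nverts_cuts :
  (forall t, {in tcuts t, forall c,
     nverts c.2.1.1 + nverts c.2.1.2 = nverts [:: t]}%N) /\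
  (forall F, {in fcuts F, forall c,
     nverts c.2.1.1 + nverts c.2.1.2 = nverts F}%N).
Proof.
apply: ptree_forest_ind => [d ts IH c|c|t ts IHt IHts c].
- rewrite tcuts_node inE => /orP[/eqP ->|/mapP[c' /IH E ->]]; first by rewrite addn0.
  by case: c' E => m [[l r] b] /= E; rewrite !nverts_node addnS E.
- by rewrite inE => /eqP ->.
rewrite fcuts_cons => /allpairsP[[c1 c2] [/= /IHt E1 /IHts E2 ->]].
case: c1 c2 E1 E2 => [m1 [[l1 r1] b1]] [m2 [[l2 r2] b2]] /= E1 E2.
by rewrite !nverts_cat addnACA E1 E2 -nverts_cat cat1s.
Qed.

End CutSums.

Lemma lin_onto (K : fieldType) (B : choiceType) (U : lmodType K)
    (f : U -> {malg K[B]}) x : lin f ->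
  (forall b, b \in msupp x -> exists y, f y = vect K b) -> exists y, f y = x.
Proof.
move=> fl h; suff hs (s : seq B) : {subset s <= msupp x} ->
    exists y, f y = \sum_(b <- s) x@_b *: vect K b.
  by have [|y Ey] := hs (msupp x); [move=> b | exists y; rewrite Ey -vectE].
elim: s => [|b s IHs] sub; first by exists 0; rewrite (lin0 fl) big_nil.
have [y Ey] := h b (sub b (mem_head _ _)).
have [z Ez] : exists z, f z = \sum_(b <- s) x@_b *: vect K b.
  by apply: IHs => c cs; apply: sub; rewrite inE cs orbT.
by exists (x@_b *: y + z); rewrite fl Ey Ez big_cons.
Qed.

(** * A unitriangular operator on planar forests *)

Section PlanarTriangular.

Variables (K : fieldType) (D : gradedSet).
Local Notation tree := (ptree D).
Local Notation forest := (seq tree).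
Local Notation H := (dd_space (Hp K D)).
Local Notation Dp := (@dd_prec K (Hp K D)).
Local Notation Ds := (@dd_succ K (Hp K D)).
Implicit Types (F G L R : forest) (d : D).

Definition fvect F : H := if insub F is Some a then vect K (a : pforest D) else 0.

Lemma fvect_val (a : pforest D) : fvect (val a) = vect K a.
Proof. by rewrite /fvect valK. Qed.

Lemma fvect_nil : fvect [::] = 0.
Proof. by rewrite /fvect insubN. Qed.

Lemma coef_fvect F (a : pforest D) : (fvect F)@_a = (F == val a)%:R.
Proof.
rewrite /fvect; case: insubP => [b _ <-|nF].
  by rewrite coef_vect (inj_eq val_inj).
have /negbTE -> : F != val a by apply: contraNneq nF => ->; exact: (valP a).
by rewrite mcoeff0.
Qed.

Lemma fvect2E L R : fvect2 K L R = fvect L ⊗ fvect R.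
Proof.
rewrite /fvect2 /fvect.
move: (insub L : option (pforest D)) (insub R : option (pforest D)) => a b.
case: a => [a|]; last by rewrite (lin0 ((@bilin_tens _ _ _).1 _)).
case: b => [b|]; first by rewrite tens_vect.
by rewrite (lin0 ((@bilin_tens _ _ _).2 _)).
Qed.

Lemma Dp_fvect F : Dp (fvect F) = pcutsum K id F.
Proof.
case: F => [|t F]; last first.
  have -> : fvect (t :: F) = vect K (exist (fun F : forest => F != [::]) (t :: F) isT : pforest D).
    exact: (fvect_val (exist (fun F : forest => F != [::]) (t :: F) isT)).
  exact: Hp_prec_vect.
rewrite fvect_nil (lin0 (@lin_prec K (Hp K D))) /pcutsum.
by rewrite big_mkcond big_seq1.
Qed.

(* For a forest F whose last tree is not reduced to its root, the pair (l, r)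
   of the subtrees above that root and of the rest of F occurs in Dp F, and
   [regrow0 l r] = F.  All the other forests obtained by applying [regrow] to
   Dp F have more vertices above the root of the last tree (this number is
   [lastsize]), so [Tlast] is unitriangular. *)
Definition bare F : bool := if rev F is PNode _ [::] :: _ then true else false.
Definition lastsize F : nat := if rev F is PNode _ G :: _ then nverts G else 0.
Definition regrow0 L R : H :=
  if rev R is PNode d [::] :: G then fvect (rcons (rev G) (PNode d L)) else 0.

Lemma bare_rcons F d G : bare (rcons F (PNode d G)) = nilp G.
Proof. by rewrite /bare rev_rcons; case: G. Qed.

Lemma lastsize_rcons F d G : lastsize (rcons F (PNode d G)) = nverts G.
Proof. by rewrite /lastsize rev_rcons. Qed.

Lemma regrow0_rcons L F d G : regrow0 L (rcons F (PNode d G))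
  = if nilp G then fvect (rcons F (PNode d L)) else 0.
Proof. by rewrite /regrow0 rev_rcons; case: G; rewrite ?revK. Qed.

Lemma nverts_rcons F d G : nverts (rcons F (PNode d G)) = (nverts F + (nverts G).+1)%N.
Proof. by rewrite -cats1 nverts_cat nverts_node. Qed.

(** Supplies the diagonal coefficient on forests ending with a bare root, where there is no subtree
    to detach and regrow. *)
Definition barepart : H -> H :=
  linext (fun a : pforest D => if bare (val a) then vect K a else 0).
Definition regrow : {malg K[(pforest D * pforest D)%type]} -> H :=
  linext (fun p => regrow0 (val p.1) (val p.2)).
Definition Tlast (x : H) : H := barepart x + regrow (Dp x).

Lemma lin_barepart : lin barepart. Proof. exact: lin_linext. Qed.
Lemma lin_regrow : lin regrow. Proof. exact: lin_linext. Qed.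
Lemma lin_Tlast : lin Tlast.
Proof. exact: lin_add lin_barepart (lin_comp lin_regrow (@lin_prec K (Hp K D))). Qed.

Lemma barepart_fvect F : barepart (fvect F) = if bare F then fvect F else 0.
Proof.
rewrite /fvect; case: insubP => [a _ <-|]; first exact: linext_vect.
by rewrite (lin0 lin_barepart) if_same.
Qed.

Lemma coef_barepart x (a : pforest D) : (barepart x)@_a = if bare (val a) then x@_a else 0.
Proof.
move: x; apply: (@lin_eq _ _ K^o) => [||b].
- exact: lin_comp (@lin_coef _ _ a) lin_barepart.
- by case: (bare _); [exact: lin_coef | exact: lin_cst0].
rewrite /barepart linext_vect coef_vect; case: (b =P a) => [->|/eqP nba].
  by case: (bare _); rewrite ?coef_vect ?eqxx ?mcoeff0.
by rewrite (fun_if (fun z => z@_a)) coef_vect (negbTE nba) mcoeff0 !if_same.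
Qed.

Lemma regrow_fvect2 L R : regrow (fvect2 K L R) = if nilp L then 0 else regrow0 L R.
Proof.
rewrite /fvect2; case: insubP => [a _ <-|]; last first.
  by rewrite negbK => /eqP ->; rewrite (lin0 lin_regrow).
have -> : nilp (val a) = false by case: a => -[].
case: insubP => [b _ <-|]; first exact: linext_vect.
by rewrite negbK => /eqP ->; rewrite (lin0 lin_regrow) /regrow0.
Qed.

Definition above F (x : H) : Prop :=
  forall a : pforest D, x@_a != 0 -> (lastsize F < lastsize (val a))%N /\ nverts (val a) = nverts F.

Lemma above0 F : above F 0.
Proof. by move=> a; rewrite mcoeff0 eqxx. Qed.

Lemma aboveD F x y : above F x -> above F y -> above F (x + y).
Proof.
move=> hx hy a; rewrite mcoeffD; have [x0|/hx //] := eqVneq x@_a 0.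
by rewrite x0 add0r; apply: hy.
Qed.

Lemma above_sum F (I : eqType) (r : seq I) (P : pred I) (f : I -> H) :
  (forall i, i \in r -> P i -> above F (f i)) -> above F (\sum_(i <- r | P i) f i).
Proof.
move=> h; rewrite big_seq_cond.
by apply: (big_ind (above F)) => [|x y|i /andP[]]; [exact: above0 | exact: aboveD | exact: h].
Qed.

Lemma above_fvect F G : (lastsize F < lastsize G)%N -> nverts G = nverts F -> above F (fvect G).
Proof.
by move=> h1 h2 a; rewrite coef_fvect; case: (G =P _) => [<-|]; rewrite ?eqxx.
Qed.

Lemma Tlast_above F : ~~ nilp F -> above F (Tlast (fvect F) - fvect F).
Proof.
case/lastP: F => // G [d E] _; set t := PNode d E; set F := rcons G t.
pose h l r (b : bool) : H := if b then if nilp l then 0 else regrow0 l r else 0.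
have -> : Tlast (fvect F) = barepart (fvect F) + \sum_(c <- fcuts F) h c.2.1.1 c.2.1.2 c.2.2.
  rewrite /Tlast Dp_fvect /pcutsum (lin_sum _ _ _ lin_regrow) big_mkcond; congr (_ + _).
  by apply: eq_bigr => c _; rewrite regrow_fvect2.
rewrite big_fcuts_rcons.
under eq_bigr => c1 _ do rewrite (big_tcuts (fun l r b => h (c1.2.1.1 ++ l) (c1.2.1.2 ++ r) b)).
(* Only the cuts that take all of E leave a bare root at the end of Roo; the others are killed by
   [regrow0]. *)
have inner c1 : \sum_(c <- fcuts E) h (c1.2.1.1 ++ c.2.1.1) (c1.2.1.2 ++ [:: PNode d c.2.1.2]) c.2.2
    = if nilp E then 0 else fvect (rcons c1.2.1.2 (PNode d (c1.2.1.1 ++ E))).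
  transitivity (\sum_(c <- fcuts E | nilp c.2.1.2)
      h (c1.2.1.1 ++ c.2.1.1) (c1.2.1.2 ++ [:: PNode d c.2.1.2]) c.2.2).
    rewrite [RHS]big_mkcond; apply: eq_bigr => c _; rewrite /h cats1 regrow0_rcons.
    by case: (nilp c.2.1.2); rewrite // !if_same.
  have [_ ->] := (big_cuts_nil D H).2 E (fun l r b => h (c1.2.1.1 ++ l) (c1.2.1.2 ++ [:: PNode d r]) b).
  by rewrite /h cats1 regrow0_rcons; case: (E) => [|x E'] //=; case: (c1.2.1.1).
under eq_bigr => c1 _ do rewrite inner.
rewrite big_split /= addrA.
set A := (X in _ + X + _); rewrite (bigID (fun c => nilp c.2.1.1)) /=.
have [-> _] := (big_cuts_nil D H).2 G (fun l r b =>
  if nilp E then 0 else fvect (rcons r (PNode d (l ++ E)))).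
rewrite barepart_fvect bare_rcons cat0s -/t -/F.
(* In A, the whole last tree is cut off and regrown on a bare root of what remains; in B, E is cut
   off together with a nonempty part of G. Both put more vertices than E above the last root. The
   diagonal term F comes from [barepart] if E is empty, and otherwise from cutting E alone. *)
set B := (X in _ + (_ + X)).
have -> : (if nilp E then fvect F else 0) + A + ((if nilp E then 0 else fvect F) + B) - fvect F = A + B.
  rewrite addrACA; case: (nilp E); rewrite ?addr0 ?add0r;
  by rewrite [fvect F + _]addrC addrK.
have nF : nverts F = (nverts G + (nverts E).+1)%N by rewrite nverts_rcons.
have mF : lastsize F = nverts E by rewrite lastsize_rcons.
apply: aboveD; apply: above_sum => c cG.
  move=> _; rewrite cats0 /h.
  case: (nilp _); first exact: above0.
  have := (nverts_cuts D).2 _ _ cG; case/lastP: (c.2.1.2) => [|R [d' E']] Ec.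
    by rewrite /regrow0; apply: above0.
  rewrite regrow0_rcons; case: ifP => nE'; last exact: above0.
  move: Ec; rewrite nverts_rcons (eqP (etrans (nverts_eq0 E') nE')) => Ec.
  apply: above_fvect; rewrite ?lastsize_rcons ?nverts_rcons nverts_cat nverts_node ?mF ?nF.
    by rewrite addnS ltnS leq_addl.
  by rewrite -Ec addn1 !(addnS, addSn) addnA [(nverts R + _)%N]addnC.
move=> c0; case: ifP => nE; first exact: above0.
have Ec := (nverts_cuts D).2 _ _ cG.
have l0 : (0 < nverts c.2.1.1)%N by rewrite lt0n nverts_eq0.
apply: above_fvect; rewrite ?lastsize_rcons ?nverts_rcons nverts_cat ?mF ?nF.
  by rewrite -[X in (X < _)%N]add0n ltn_add2r.
by rewrite -Ec !addnS addnA [(nverts c.2.1.2 + _)%N]addnC.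
Qed.

Lemma pforest_rcons (a : pforest D) : exists G d E, val a = rcons G (PNode d E).
Proof.
by case: a => F /=; case/lastP: F => // G [d E] _; exists G, d, E.
Qed.

Lemma Tlast_sub x : Tlast x - x
  = \sum_(b <- msupp x) x@_b *: (Tlast (vect K b) - vect K b).
Proof. exact: (linE (lin_sub lin_Tlast (@lin_id _ _))). Qed.

Lemma Tlast_vect_above (b : pforest D) : above (val b) (Tlast (vect K b) - vect K b).
Proof.
by rewrite -fvect_val; apply: Tlast_above; case: b => -[].
Qed.

(** The coefficient of a in [Tlast x - x] only involves forests of smaller [lastsize], whose
    coefficients in x vanish by induction. *)
Lemma Tlast_eq0 x : Tlast x = 0 -> x = 0.
Proof.
move=> Tx0; suff h n (a : pforest D) : (lastsize (val a) < n)%N -> x@_a = 0.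
  by apply/malgP=> a; rewrite mcoeff0 (h (lastsize (val a)).+1).
elim: n a => // n IHn a lt_a.
have /(congr1 (mcoeff a)) := Tlast_sub x.
rewrite Tx0 sub0r mcoeffN raddf_sum big_seq big1 => [/eqP|b xb].
  by rewrite oppr_eq0 => /eqP.
apply: (etrans (mcoeffZ _ _ _)); have [->|/Tlast_vect_above[lt_ba _]] := eqVneq (Tlast (vect K b) - vect K b)@_a 0.
  by rewrite mulr0.
by rewrite IHn ?mul0r // (leq_trans lt_ba).
Qed.

Lemma lastsize_le F : (lastsize F <= nverts F)%N.
Proof.
case/lastP: F => // G [d E]; rewrite lastsize_rcons nverts_rcons addnS.
by rewrite leqW // leq_addl.
Qed.

(** The error terms have a larger [lastsize] and as many vertices; as this number bounds [lastsize],
    correcting them terminates. *)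
Lemma Tlast_onto x : exists y, Tlast y = x.
Proof.
apply: (lin_onto lin_Tlast) => a _.
have [n] := ubnP (nverts (val a) - lastsize (val a)); elim: n a => // n IHn a lt_a.
have [y Ey] : exists y, Tlast y = Tlast (vect K a) - vect K a.
  apply: (lin_onto lin_Tlast) => b; rewrite -mcoeff_neq0 => /Tlast_vect_above[lt_lastsize En].
  apply: IHn; rewrite En -ltnS; apply: leq_trans lt_a.
  by rewrite ltnS ltn_sub2l // -En (leq_trans lt_lastsize) // lastsize_le.
by exists (vect K a - y); rewrite (linB lin_Tlast) Ey opprB addrC subrK.
Qed.

Lemma node_eq d d' F F' : (PNode d F == PNode d' F') = (d == d') && (F == F').
Proof. by apply/eqP/andP => [[-> ->]|[/eqP -> /eqP ->]]. Qed.

(** Regrowing is injective on the pairs whose right factor ends with a bare root, so a determines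
    (k, r). *)
Lemma coef_regrow t (a k r : pforest D) G d :
  val a = rcons G (PNode d (val k)) -> val r = rcons G (PNode d [::]) ->
  (regrow t)@_a = t@_(k, r).
Proof.
move=> Ea Er; move: t; apply: (@lin_eq _ _ K^o) => [||[k' r']].
- exact: lin_comp (@lin_coef _ _ a) lin_regrow.
- exact: lin_coef.
rewrite /regrow linext_vect coef_vect xpair_eqE.
rewrite -[k' == k](inj_eq val_inj) -[r' == r](inj_eq val_inj) Er.
have [G' [d' [E' Er']]] := pforest_rcons r'.
rewrite [(k', r').1]/= [(k', r').2]/= Er' regrow0_rcons eqseq_rcons node_eq.
case: E' {Er'} => [|u E'] /=; last by rewrite mcoeff0 !andbF.
rewrite coef_fvect Ea eqseq_rcons node_eq andbT.
by apply: (congr1 (fun b : bool => b%:R)); rewrite [RHS]andbC -andbA.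
Qed.

Lemma coef_regrow_bare t (a : pforest D) : bare (val a) -> (regrow t)@_a = 0.
Proof.
move=> ea; move: t; apply: (@lin_eq _ _ K^o) => [||[k r]].
- exact: lin_comp (@lin_coef _ _ a) lin_regrow.
- exact: lin_cst0.
rewrite /regrow linext_vect /=; have [G [d [E Er]]] := pforest_rcons r.
rewrite Er regrow0_rcons; case: E {Er} => [|u E] /=; last by rewrite mcoeff0.
rewrite coef_fvect; case: eqP => // Ea; move: ea; rewrite -Ea bare_rcons.
by case: k {Ea} => -[].
Qed.

Lemma coef_pcutsum (P : pred bool) F (k r : pforest D) :
  (pcutsum K P F)@_(k, r) = \sum_(c <- fcuts F)
    if P c.2.2 then ((c.2.1.1 == val k) && (c.2.1.2 == val r))%:R else 0.
Proof.
rewrite /pcutsum raddf_sum /= big_mkcond; apply: eq_bigr => c _; case: ifP => // _.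
by rewrite fvect2E coef_tens !coef_fvect -natrM mulnb.
Qed.

(** If Roo is one vertex and contains the rightmost leaf, this leaf is also a root: it is the whole
    last tree, and Lea is the rest of the forest. *)
Lemma Ds_single x (b r a : pforest D) d :
  val r = [:: PNode d [::]] -> val a = rcons (val b) (PNode d [::]) ->
  (Ds x)@_(b, r) = x@_a.
Proof.
move=> Er Ea; move: x; apply: (@lin_eq _ _ K^o) => [||f].
- exact: lin_comp (@lin_coef _ _ (b, r)) (@lin_succ K (Hp K D)).
- exact: lin_coef.
rewrite Hp_succ_vect coef_pcutsum coef_vect -(inj_eq val_inj) Ea Er.
have [G [d' [E ->]]] := pforest_rcons f.
pose h (l s : forest) (b' : bool) : K := if ~~ b' then ((l == val b) && (s == [:: PNode d [::]]))%:R else 0.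
rewrite (big_fcuts_rcons h).
under eq_bigr => c1 _ do rewrite (big_tcuts (fun l s b => h (c1.2.1.1 ++ l) (c1.2.1.2 ++ s) b)).
have inner c1 : \sum_(c <- fcuts E) h (c1.2.1.1 ++ c.2.1.1) (c1.2.1.2 ++ [:: PNode d' c.2.1.2]) c.2.2
    = if nilp c1.2.1.2 then (nilp E && (c1.2.1.1 == val b) && (d' == d))%:R else 0.
  transitivity (\sum_(c <- fcuts E | nilp c.2.1.2)
      h (c1.2.1.1 ++ c.2.1.1) (c1.2.1.2 ++ [:: PNode d' c.2.1.2]) c.2.2).
    rewrite [RHS]big_mkcond; apply: eq_bigr => c _; rewrite /h.
    have [//|n0] := boolP (nilp c.2.1.2); rewrite cats1 -[[:: PNode d _]]cat0s cats1 eqseq_rcons node_eq.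
    by case: (c.2.1.2) n0 => // u s _; rewrite !andbF if_same.
  have [_ ->] := (big_cuts_nil D K).2 E (fun l s b => h (c1.2.1.1 ++ l) (c1.2.1.2 ++ [:: PNode d' s]) b).
  rewrite /h negbK cats1 -[[:: PNode d _]]cat0s cats1 eqseq_rcons node_eq eqxx andbT.
  case: (c1.2.1.2) => [|u s] /=; last by rewrite andbF if_same.
  by case: (E) => [|u s] //=; rewrite cats0.
under eq_bigr => c1 _ do rewrite inner /h /= add0r.
rewrite -big_mkcond; have [_ ->] := (big_cuts_nil D K).2 G (fun l s b' => (nilp E && (l == val b) && (d' == d))%:R).
rewrite eqseq_rcons node_eq; apply: (congr1 (fun b : bool => b%:R)).
by rewrite -andbA andbC -andbA; case: E {h inner} => [|u s]; rewrite ?andbT ?andbF.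
Qed.

Definition bare_free (x : H) : Prop := forall a : pforest D, bare (val a) -> x@_a = 0.

(** In the right half-coproduct the rightmost leaf stays in Roo. If the last tree is not bare, this
    leaf remains above the last root, so Roo does not end with a bare root. *)
Lemma Ds_bare_free x (k r : pforest D) : bare_free x -> bare (val r) -> (Ds x)@_(k, r) = 0.
Proof.
move=> x0 er; rewrite (linE (@lin_succ K (Hp K D))) raddf_sum /= big1 // => f _.
apply: (etrans (mcoeffZ _ _ _)); have [/x0 ->|ef] := boolP (bare (val f)); first by rewrite mul0r.
rewrite Hp_succ_vect coef_pcutsum; have [G [d [E Ef]]] := pforest_rcons f.
move: ef; rewrite Ef bare_rcons => nE.
pose h (l s : forest) (b' : bool) : K := if ~~ b' then ((l == val k) && (s == val r))%:R else 0.
rewrite (big_fcuts_rcons h).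
under eq_bigr => c1 _ do rewrite (big_tcuts (fun l s b => h (c1.2.1.1 ++ l) (c1.2.1.2 ++ s) b)).
rewrite big1 ?mulr0 // => c1 _; rewrite {1}/h /= add0r.
transitivity (\sum_(c <- fcuts E | nilp c.2.1.2)
      h (c1.2.1.1 ++ c.2.1.1) (c1.2.1.2 ++ [:: PNode d c.2.1.2]) c.2.2).
  rewrite [RHS]big_mkcond; apply: eq_bigr => c _; rewrite /h.
  have [//|n0] := boolP (nilp c.2.1.2); rewrite cats1.
  case: (_ =P val r) => [Er|_]; last by rewrite andbF if_same.
  by move: er; rewrite -Er bare_rcons (negbTE n0).
have [_ ->] := (big_cuts_nil D K).2 E (fun l s b => h (c1.2.1.1 ++ l) (c1.2.1.2 ++ [:: PNode d s]) b).
by rewrite nE.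
Qed.

(** The two hypotheses kill the two summands of [Tlast x]. *)
Lemma bare_free_eq0 x : bare_free x ->
  (forall k r : pforest D, bare (val r) -> (Dp x)@_(k, r) = 0) -> x = 0.
Proof.
move=> x0 Dx0; apply: Tlast_eq0; apply/malgP=> a; rewrite mcoeffD coef_barepart mcoeff0.
have [ea|na] := boolP (bare (val a)); first by rewrite x0 // coef_regrow_bare // addr0.
have [G [d [E Ea]]] := pforest_rcons a; rewrite add0r.
move: na; rewrite Ea bare_rcons => nE.
have E0 : E != [::] by case: (E) nE.
have R0 : rcons G (PNode d [::]) != [::] by case: (G).
rewrite (@coef_regrow _ a (exist (fun F : forest => F != [::]) E E0)
  (exist (fun F : forest => F != [::]) _ R0) G d) //.
by apply: Dx0; rewrite /= bare_rcons.
Qed.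

End PlanarTriangular.

(** * Rigidity *)

Section Primitives.

Variables (K : fieldType) (A : ddData K) (rk : dd_basis A -> nat).
Hypothesis rk_inj : injective rk.
Local Notation V := (dd_space A).

Definition primitive (x : V) : Prop := dd_prec x = 0 /\ dd_succ x = 0.

Lemma primitive_lin c x y : primitive x -> primitive y -> primitive (c *: x + y).
Proof.
move=> [px sx] [py sy]; split.
  by rewrite (@lin_prec K A) px py scaler0 addr0.
by rewrite (@lin_succ K A) sx sy scaler0 addr0.
Qed.

(** A normalized row of an echelon form, whose columns are ordered by the injective numbering
    [rk]. *)
Definition leading (b : dd_basis A) (x : V) : Prop :=
  [/\ primitive x, homog (@dd_deg K A) (dd_deg b) x, x@_b = 1
    & forall c, c \in msupp x -> (rk c <= rk b)%N].

(* The leading basis vectors of the homogeneous primitive elements index a basis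
   of the space of primitive elements. *)
Definition prim_set : gradedSet := GradedSet
  (fun d : {b : dd_basis A | `[< exists x, leading b x >]} => dd_deg (val d)).

Definition pvec (d : prim_set) : V := projT1 (cid (asboolW (valP d))).

Lemma pvecP d : leading (val d) (pvec d).
Proof. exact: projT2 (cid (asboolW (valP d))). Qed.

(** The coefficient of a combination at its greatest leading vector comes from a single element;
    induction on the rank removes it. *)
Lemma pvec_inj w : linext pvec w = 0 -> w = 0.
Proof.
move=> w0; suff h n : forall w, linext pvec w = 0 ->
    (forall d, d \in msupp w -> (rk (val d) < n)%N) -> w = 0.
  apply: (h (\max_(d <- msupp w) (rk (val d)).+1)) => // d dw.
  exact: (@leq_bigmax_seq _ _ xpredT (fun d : prim_set => (rk (val d)).+1) d dw).
elim: n => [|n IHn] {w0}w w0 lt_w.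
  by apply/malgP=> d; rewrite mcoeff0 mcoeff_outdom //; apply/negP=> /lt_w.
apply: IHn => // d dw; have := lt_w d dw; rewrite ltnS leq_eqVlt => /orP[/eqP rd|//].
suff E : (linext pvec w)@_(val d) = w@_d.
  by move: dw; rewrite -mcoeff_neq0 -E w0 mcoeff0 eqxx.
rewrite (linE (lin_linext pvec)) [in RHS](vectE w) !raddf_sum /=.
apply: eq_big_seq => d' d'w; rewrite linext_vect.
apply: (etrans (mcoeffZ _ _ _)); apply: esym; apply: (etrans (mcoeffZ _ _ _)).
congr (_ * _); rewrite coef_vect; have [_ _ d1 le_d'] := pvecP d'.
have [<-|nd] := eqVneq d' d; first by rewrite d1.
apply/esym/mcoeff_outdom; apply: contraNN nd => /le_d'; rewrite rd => le_n.
by apply/eqP/val_inj/rk_inj/eqP; rewrite rd eqn_leq le_n andbT -ltnS lt_w.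
Qed.

(** Gaussian elimination: subtracting a multiple of the chosen element with the same leading vector
    lowers the rank bound and keeps x primitive and homogeneous. *)
Lemma pvec_span m n x : primitive x -> homog (@dd_deg K A) m x ->
  (forall c, c \in msupp x -> (rk c < n)%N) -> exists w, linext pvec w = x.
Proof.
elim: n x => [|n IHn] x px hx lt_x.
  exists 0; rewrite (lin0 (lin_linext pvec)); apply/malgP=> c.
  by rewrite mcoeff0 mcoeff_outdom //; apply/negP=> /lt_x.
have [[b [bx rb]]|nb] := pselect (exists b, b \in msupp x /\ rk b = n); last first.
  apply: IHn => // c cx; have := lt_x c cx; rewrite ltnS leq_eqVlt => /orP[/eqP rc|//].
  by case: nb; exists c.
have xb0 : x@_b != 0 by rewrite mcoeff_neq0.
have lb : leading b ((x@_b)^-1 *: x).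
  split.
  - rewrite -[_ *: x]addr0; apply: primitive_lin => //.
    by split; [rewrite (lin0 (@lin_prec K A)) | rewrite (lin0 (@lin_succ K A))].
  - by rewrite (hx b bx); apply: homogZ.
  - by apply: (etrans (mcoeffZ _ _ _)); rewrite mulVf.
  - move=> c; rewrite -mcoeff_neq0 => cx; rewrite rb -ltnS lt_x // -mcoeff_neq0.
    apply: contraNneq cx => c0; apply/eqP; apply: (etrans (mcoeffZ _ _ _)).
    by rewrite c0 mulr0.
have Db : `[< exists x, leading b x >] by apply/asboolP; exists ((x@_b)^-1 *: x).
pose d : prim_set := exist (fun b => `[< exists x, leading b x >]) b Db.
have [pd hd d1 le_d] := pvecP d.
have [|||w Ew] := IHn (- x@_b *: pvec d + x).
- exact: primitive_lin.
- have hd' : homog (@dd_deg K A) m (pvec d) by rewrite -(hx b bx).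
  move/homogP: hx => hx; move/homogP: hd' => hd'; apply/homogP.
  by rewrite (lin_hcomp _ _) hx hd'.
- move=> c; rewrite -mcoeff_neq0 => cx.
  have E : (- x@_b *: pvec d + x)@_c = - x@_b * (pvec d)@_c + x@_c.
    by apply: (etrans (mcoeffD _ _ _)); congr (_ + _); apply: mcoeffZ.
  move: cx; rewrite E => cx; have le_c : (rk c <= n)%N.
    case: (boolP (c \in msupp x)) => [/lt_x //|xc].
    rewrite -rb; apply: le_d; rewrite -mcoeff_neq0; apply: contraNneq cx => ->.
    by rewrite mulr0 add0r mcoeff_outdom.
  rewrite ltn_neqAle le_c andbT; apply: contraNneq cx => rc.
  have -> : c = b by apply: rk_inj; rewrite rc rb.
  by rewrite d1 mulr1 addNr.
exists (x@_b *: vect K d + w); rewrite (lin_linext pvec) linext_vect Ew.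
by rewrite scaleNr addrA subrr add0r.
Qed.

End Primitives.

(** * The morphism from planar forests defined by a family of primitive elements *)

Section PlanarMorphism.

Variables (K : fieldType) (A : ddData K) (D : gradedSet) (p : D -> dd_space A).
Hypotheses (dupA : duplicial_algebra A) (compA : dupdend_compat A).
Hypothesis p_prim : forall d, primitive (p d).
Local Notation V := (dd_space A).
Local Notation tree := (ptree D).
Local Notation forest := (seq tree).
Local Notation "x ∙ y" := (@dd_mul K A x y) (at level 40, left associativity).
Local Notation "x ↖ y" := (@dd_graft K A x y)
  (at level 40, left associativity).

(** One-tree forests are treated apart because A has no unit from which to start the product. *)
Definition phi_of (pt : tree -> V) :=
  fix loop (F : forest) : V :=
    match F with
    | [::] => 0
    | [:: t] => pt t
    | t :: F' => pt t ∙ loop F'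
    end.

Fixpoint phi_tree (t : tree) : V :=
  let: PNode d ts := t in
  if ts is [::] then p d else p d ↖ phi_of phi_tree ts.

Definition phi : forest -> V := phi_of phi_tree.

Lemma phi_cons t F : phi (t :: F) = if nilp F then phi_tree t else phi_tree t ∙ phi F.
Proof. by case: F. Qed.

Lemma phi_node d F :
  phi_tree (PNode d F) = if nilp F then p d else p d ↖ phi F.
Proof. by case: F. Qed.

Lemma graftd0 x : x ↖ 0 = 0. Proof. exact: (lin0 ((@bilin_graft K A).2 x)). Qed.
Lemma tens0d (x : V) : (0 : V) ⊗ x = 0. Proof. exact: (lin0 ((@bilin_tens K _ _).1 x)). Qed.
Lemma tensd0 (x : V) : x ⊗ (0 : V) = 0. Proof. exact: (lin0 ((@bilin_tens K _ _).2 x)). Qed.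

Lemma phi_cat F G : ~~ nilp F -> ~~ nilp G -> phi (F ++ G) = phi F ∙ phi G.
Proof.
have [mA _ _] := dupA.
elim: F => // t F IHF _ G0; rewrite cat_cons !phi_cons.
have [->|F0] := eqVneq F [::]; first by rewrite /= (negbTE G0).
have nF : ~~ nilp F by case: (F) F0.
have nFG : ~~ nilp (F ++ G) by case: (F) F0.
by rewrite (negbTE nF) (negbTE nFG) (IHF nF G0) mA.
Qed.

(** On the way to the rightmost leaf, the mixed axiom (xy) ↖ z = x (y ↖ z) crosses a juxtaposition
    and associativity of ↖ crosses a node. *)
Lemma phi_forest_graft F G : ~~ nilp F -> ~~ nilp G ->
  phi (forest_graft F G) = phi F ↖ phi G.
Proof.
have [_ gA mgA] := dupA; move=> F0 G0; move: F0.
have nng (X : forest) : nilp (on_last G (tree_graft G) X) = false.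
  by case: X => [|t [|u X]] //; apply: negbTE.
suff [_ h] : (forall t, phi_tree (tree_graft G t) = phi_tree t ↖ phi G) /\
    (forall F, ~~ nilp F -> phi (forest_graft F G) = phi F ↖ phi G) by apply: h.
apply: ptree_forest_ind => [d ts IH|//|t ts IHt IHts _].
  have -> : tree_graft G (PNode d ts) = PNode d (on_last G (tree_graft G) ts) by [].
  rewrite !phi_node nng.
  have [->|ts0] := eqVneq ts [::]; first by [].
  have nts : ~~ nilp ts by case: (ts) ts0.
  by rewrite (negbTE nts) gA -(IH nts).
case: ts IHts => [|u ts] IHts; first exact: IHt.
have -> : forest_graft (t :: u :: ts) G = t :: forest_graft (u :: ts) G by [].
rewrite phi_cons nng phi_cons.
exact: (etrans (congr1 (dd_mul (phi_tree t)) (IHts isT)) (esym (mgA _ _ _))).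
Qed.

Definition dd_half (b : bool) : V -> dd_space2 A :=
  if b then @dd_prec K A else @dd_succ K A.

Lemma half_mul b x y :
  dd_half b (x ∙ y)
  = (if b then y ⊗ x else x ⊗ y)
    + \swd_(x1, x2 <- dd_cop x) (if b then (x1 ∙ y) ⊗ x2 else x1 ⊗ (x2 ∙ y))
    + \swd_(y1, y2 <- dd_half b y) ((x ∙ y1) ⊗ y2)
    + \swd_(y1, y2 <- dd_half b y) (y1 ⊗ (x ∙ y2))
    + \swd_(x1, x2 <- dd_cop x) \swd_(y1, y2 <- dd_half b y)
        ((x1 ∙ y1) ⊗ (x2 ∙ y2)).
Proof. by have [c1 c2 _ _] := compA; case: b; [exact: c1|exact: c2]. Qed.

Lemma half_graft b x y : primitive x ->
  dd_half b (x ↖ y)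
  = (if b then y ⊗ x else 0) + \swd_(y1, y2 <- dd_half b y) (y1 ⊗ (x ↖ y2)).
Proof.
have swd0 (f : V -> V -> dd_space2 A) : sweedler f (0 : dd_space2 A) = 0 by apply: (lin0 (lin_swd f)).
case=> px sx; have [_ _ c3 c4] := compA; case: b.
  apply: (etrans (c3 x y)); rewrite px sx /dd_half; move: (dd_prec y) => u.
  apply: (etrans (congr2 +%R (congr2 +%R (congr2 +%R erefl (swd0 _)) (swd0 _)) (swd0 _))).
  exact: (etrans (addr0 _) (etrans (addr0 _) (addr0 _))).
apply: (etrans (c4 x y)); rewrite sx /dd_half; move: (dd_succ y) => u.
apply: (etrans (congr2 +%R (congr2 +%R erefl (swd0 _)) (swd0 _))).
exact: (etrans (addr0 _) (etrans (addr0 _) (esym (add0r _)))).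
Qed.

Definition cut_tens (b : bool) (s : seq (bitseq * cut D)) : dd_space2 A :=
  \sum_(c <- s | c.2.2 == b) (phi c.2.1.1 ⊗ phi c.2.1.2).

Lemma cut_tens_cop s :
  cut_tens true s + cut_tens false s = \sum_(c <- s) (phi c.2.1.1 ⊗ phi c.2.1.2).
Proof.
rewrite /cut_tens [RHS](bigID (fun c => c.2.2)) /=; congr (_ + _).
  by apply: eq_bigl => c; case: c.2.2.
by apply: eq_bigl => c; case: c.2.2.
Qed.

Lemma swd_pairs (M : lmodType K) (f : V -> V -> M) (s : seq (bitseq * cut D))
    (P : pred (bitseq * cut D)) : bilin f ->
  sweedler f (\sum_(c <- s | P c) (phi c.2.1.1 ⊗ phi c.2.1.2))
  = \sum_(c <- s | P c) f (phi c.2.1.1) (phi c.2.1.2).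
Proof.
move=> fb; rewrite (lin_sum _ _ _ (lin_swd f)); apply: eq_bigr => c _.
exact: swd_tens.
Qed.

Definition properc (c : bitseq * cut D) : bool := proper_pair c.2.1.1 c.2.1.2.

Lemma phi_pair0 l r : ~~ proper_pair l r -> phi l ⊗ phi r = 0.
Proof.
rewrite negb_and !negbK; case: l => [|t l]; first by rewrite tens0d.
by case: r => // _; rewrite tensd0.
Qed.

Lemma cut_tens_proper b s : cut_tens b s
  = \sum_(c <- s | properc c && (c.2.2 == b)) (phi c.2.1.1 ⊗ phi c.2.1.2).
Proof.
rewrite /cut_tens big_mkcond [RHS]big_mkcond; apply: eq_bigr => c _.
by case: (boolP (properc c)) => [//|/phi_pair0 ->]; rewrite if_same.
Qed.

Lemma cut_tens_cop_proper s : cut_tens true s + cut_tens false s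
  = \sum_(c <- s | properc c) (phi c.2.1.1 ⊗ phi c.2.1.2).
Proof.
rewrite cut_tens_cop [RHS]big_mkcond; apply: eq_bigr => c _.
by case: (boolP (properc c)) => [//|/phi_pair0 ->].
Qed.

(** Matches the order of terms in the product axiom with that of [big_fcuts_cons_split]. *)
Lemma add_mul_terms (M : nmodType) (b : bool) (u v a1 a2 a3 a4 : M) :
  (if b then u else v) + a1 + a2 + a3 + a4
  = (0 + (if true == b then u else 0) + a3) + ((if false == b then v else 0) + 0 + a2)
    + (a1 + a4).
Proof.
have E (w : M) : w + a1 + a2 + a3 + a4 = w + a3 + a2 + (a1 + a4).
  rewrite addrA; congr (_ + _); rewrite -!addrA; congr (_ + _).
  by rewrite addrC [a2 + a3]addrC -addrA.
rewrite E addr0; case: b; rewrite /= ?add0r ?addr0 //.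
by rewrite -[_ + a3 + a2]addrA [_ + (a3 + a2)]addrCA addrA.
Qed.

(** Nine cases: each of t and F is cut with empty Lea, with empty Roo, or properly. *)
Lemma big_fcuts_cons_split (M : nmodType) (h : forest -> forest -> bool -> M) t F :
  ~~ nilp F ->
  \sum_(c <- fcuts (t :: F)) h c.2.1.1 c.2.1.2 c.2.2
  = (h [::] (t :: F) false + h F [:: t] true
     + \sum_(c <- fcuts F | properc c) h c.2.1.1 (t :: c.2.1.2) c.2.2)
    + (h [:: t] F false + h (t :: F) [::] true
     + \sum_(c <- fcuts F | properc c) h (t :: c.2.1.1) c.2.1.2 c.2.2)
    + (\sum_(c1 <- tcuts t | properc c1) h c1.2.1.1 (c1.2.1.2 ++ F) false
       + \sum_(c1 <- tcuts t | properc c1) h (c1.2.1.1 ++ F) c1.2.1.2 true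
       + \sum_(c1 <- tcuts t | properc c1) \sum_(c2 <- fcuts F | properc c2)
           h (c1.2.1.1 ++ c2.2.1.1) (c1.2.1.2 ++ c2.2.1.2) c2.2.2).
Proof.
move=> F0; rewrite (big_fcuts_cons h) (negbTE F0).
rewrite (big_tcuts_split t (fun l r _ => \sum_(c2 <- fcuts F) h (l ++ c2.2.1.1) (r ++ c2.2.1.2) c2.2.2)).
rewrite (big_fcuts_split (fun l r => h ([::] ++ l) ([:: t] ++ r)) F0).
rewrite (big_fcuts_split (fun l r => h ([:: t] ++ l) ([::] ++ r)) F0).
rewrite -!big_split; congr (_ + _); apply: eq_bigr => c1 _.
rewrite (big_fcuts_split (fun l r => h (c1.2.1.1 ++ l) (c1.2.1.2 ++ r)) F0).
by rewrite !cats0.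
Qed.

Lemma half_forest_cons t F b : ~~ nilp F ->
  (forall b, dd_half b (phi_tree t) = cut_tens b (tcuts t)) ->
  dd_half b (phi F) = cut_tens b (fcuts F) ->
  dd_half b (phi (t :: F)) = cut_tens b (fcuts (t :: F)).
Proof.
move=> F0 Ht HF; have F1 : F != [::] by case: (F) F0.
have pc s r : ~~ nilp r -> phi (s ++ r) = if nilp s then phi r else phi s ∙ phi r.
  by move=> r0; case: s => // u s; apply: phi_cat.
apply: esym; rewrite /cut_tens big_mkcond.
apply: (etrans (big_fcuts_cons_split (fun l r b' => if b' == b then phi l ⊗ phi r else 0) t F0)).
rewrite !tens0d !tensd0 !if_same.
have HFp := etrans HF (cut_tens_proper b (fcuts F)).
have HX : dd_cop (phi_tree t)
    = \sum_(c <- tcuts t | properc c) (phi c.2.1.1 ⊗ phi c.2.1.2).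
  apply: etrans (cut_tens_cop_proper _).
  exact: (congr2 +%R (Ht true) (Ht false)).
rewrite [phi (t :: F)]phi_cons (negbTE F0) [phi [:: t]]/(phi_tree t).
set X := phi_tree t in HX *; set Y := phi F in HF HFp pc *.
have E4 : \sum_(c <- fcuts F | properc c)
      (if c.2.2 == b then phi c.2.1.1 ⊗ phi (t :: c.2.1.2) else 0)
    = \swd_(y1, y2 <- dd_half b Y) (y1 ⊗ (X ∙ y2)).
  rewrite HFp; apply: esym; apply: (etrans (swd_pairs _ _ _)); first by lin_tac.
  rewrite big_mkcondr; apply: eq_bigr => c /andP[_ r0].
  by rewrite phi_cons (negbTE r0).
have E3 : \sum_(c <- fcuts F | properc c)
      (if c.2.2 == b then phi (t :: c.2.1.1) ⊗ phi c.2.1.2 else 0)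
    = \swd_(y1, y2 <- dd_half b Y) ((X ∙ y1) ⊗ y2).
  rewrite HFp; apply: esym; apply: (etrans (swd_pairs _ _ _)); first by lin_tac.
  rewrite big_mkcondr; apply: eq_bigr => c /andP[l0 _].
  by rewrite phi_cons (negbTE l0).
have E5 : \sum_(c1 <- tcuts t | properc c1) \sum_(c2 <- fcuts F | properc c2)
      (if c2.2.2 == b then phi (c1.2.1.1 ++ c2.2.1.1) ⊗ phi (c1.2.1.2 ++ c2.2.1.2) else 0)
    = \swd_(x1, x2 <- dd_cop X) \swd_(y1, y2 <- dd_half b Y)
        ((x1 ∙ y1) ⊗ (x2 ∙ y2)).
  rewrite HX HFp; apply: esym; apply: (etrans (swd_pairs _ _ _)); first by lin_tac.
  apply: eq_bigr => c1 /andP[l1 r1].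
  apply: (etrans (swd_pairs _ _ _)); first by lin_tac.
  rewrite big_mkcondr; apply: eq_bigr => c2 /andP[l2 r2].
  case: (c2.2.2 == b); last by [].
  apply: (congr2 (@tens K _ _)).
    by rewrite pc // (negbTE l1).
  by rewrite pc // (negbTE r1).
have E2 : \sum_(c1 <- tcuts t | properc c1)
      (if false == b then phi c1.2.1.1 ⊗ phi (c1.2.1.2 ++ F) else 0)
    + \sum_(c1 <- tcuts t | properc c1)
      (if true == b then phi (c1.2.1.1 ++ F) ⊗ phi c1.2.1.2 else 0)
    = \swd_(x1, x2 <- dd_cop X) (if b then (x1 ∙ Y) ⊗ x2 else x1 ⊗ (x2 ∙ Y)).
  rewrite HX; apply: esym; apply: (etrans (swd_pairs _ _ _)).
    by case: (b); lin_tac.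
  rewrite -big_split; apply: eq_bigr => c /andP[l0 r0].
  case: (b); [apply: (etrans _ (esym (add0r _))) | apply: (etrans _ (esym (addr0 _)))].
    apply: (congr2 (@tens K _ _)); last by [].
    by rewrite pc // (negbTE l0).
  apply: (congr2 (@tens K _ _)); first by [].
  by rewrite pc // (negbTE r0).
apply: (etrans (congr2 +%R (congr2 +%R (congr2 +%R erefl E4) (congr2 +%R erefl E3))
  (congr2 +%R E2 E5))); apply: esym; apply: (etrans (half_mul _ _ _)).
exact: add_mul_terms.
Qed.

Lemma phi_half :
  (forall t b, dd_half b (phi_tree t) = cut_tens b (tcuts t)) /\
  (forall F b, dd_half b (phi F) = cut_tens b (fcuts F)).
Proof.
have lh b : lin (dd_half b) by case: b; [exact: lin_prec|exact: lin_succ].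
apply: ptree_forest_ind => [d ts IH b|b|t ts IHt IHts b].
- rewrite /cut_tens big_mkcond.
  rewrite (big_tcuts (fun l r b' => if b' == b then phi l ⊗ phi r else 0)) tensd0.
  rewrite if_same add0r phi_node; have [->|ts0] := eqVneq ts [::].
    rewrite big_seq1 tens0d if_same.
    by have [px sx] := p_prim d; case: (b).
  have nts : ~~ nilp ts by case: (ts) ts0.
  rewrite (negbTE nts); apply: (etrans (half_graft _ _ (p_prim d))).
  rewrite IH /cut_tens.
  (* The cut of ts with empty Roo leaves the bare root d, and accounts for the isolated term y ⊗ x
     of [half_graft]. *)
  have [_ E] := (big_cuts_nil D (dd_space2 A)).2 ts
    (fun l r b' => if b' == b then phi l ⊗ phi [:: PNode d r] else 0).
  rewrite [RHS](bigID (fun c => nilp c.2.1.2)) /=.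
  apply: (congr2 +%R).
    by apply: (etrans _ (esym E)); rewrite nts; case: (b).
  apply: (etrans (swd_pairs _ _ _)); first by lin_tac.
  rewrite big_mkcond [RHS]big_mkcond; apply: eq_bigr => c _.
  case: (c.2.2 == b); last by rewrite if_same.
  by case: (c.2.1.2) => [|u r]; [rewrite graftd0 tensd0 | ].
- rewrite [phi [::]]/(0 : V) (lin0 (lh b)) /cut_tens big_mkcond big_seq1 tens0d.
  by rewrite if_same.
have [->|ts0] := eqVneq ts [::]; last by apply: half_forest_cons => //; case: (ts) ts0.
rewrite [phi [:: t]]/(phi_tree t) IHt /cut_tens [RHS]big_mkcond.
rewrite (big_fcuts_cons (fun l r b' => if b' == b then phi l ⊗ phi r else 0) t [::]).
by rewrite big_mkcond; apply: eq_bigr => c _; rewrite big_seq1 /= !cats0.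
Qed.

End PlanarMorphism.

Section PlanarExtension.

Variables (K : fieldType) (A : ddData K) (D : gradedSet) (p : D -> dd_space A).
Hypothesis A_bialgebra : graded_dupdend_bialgebra A.
Hypothesis p_prim : forall d, primitive (p d).
Hypothesis p_homog : forall d, homog (@dd_deg K A) (gs_deg d) (p d).

Definition Phi : dd_space (Hp K D) -> dd_space A :=
  linext (fun F : pforest D => phi p (val F)).

Lemma lin_Phi : lin Phi. Proof. exact: lin_linext. Qed.

Lemma Phi_vect (F : pforest D) : Phi (vect K F) = phi p (val F).
Proof. exact: linext_vect. Qed.

Lemma Phi_fvect F : Phi (fvect K F) = phi p F.
Proof.
case: F => [|t F]; first by rewrite fvect_nil (lin0 lin_Phi).
exact: (etrans (congr1 Phi (fvect_val K (exist (fun F => F != [::]) (t :: F) isT)))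
  (Phi_vect _)).
Qed.

Lemma Phi_half b F :
  dd_half b (phi p F) = tmap Phi Phi (pcutsum K (fun b' => b' == b) F).
Proof.
have [dA _ cA _] := A_bialgebra.
apply: (etrans ((phi_half dA cA p_prim).2 F b)).
rewrite /cut_tens /pcutsum (lin_sum _ _ _ (@lin_tmap _ _ _ _ _ Phi Phi)).
apply: eq_bigr => c _; apply: esym.
apply: (etrans (congr1 (tmap Phi Phi) (fvect2E K c.2.1.1 c.2.1.2))).
apply: (etrans (tmap_tens _ _ lin_Phi lin_Phi)).
by rewrite !Phi_fvect.
Qed.

Lemma pcutsum_eq (P Q : pred bool) (F : seq (ptree D)) : P =1 Q ->
  pcutsum K P F = pcutsum K Q F.
Proof. by move=> PQ; apply: eq_bigl => c; apply: PQ. Qed.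

Lemma nnilp_val (F : pforest D) : ~~ nilp (val F).
Proof. by case: F => -[]. Qed.

Lemma Phi_morphism : dd_morphism Phi.
Proof.
have [dA _ cA _] := A_bialgebra; have jl := lin_Phi.
split=> //.
- apply: bilin_eq; [by lin_tac|by lin_tac|] => F G.
  apply: (etrans (congr1 Phi (bilinext_vect (@dd_mul0 K (Hp K D)) F G))).
  apply: (etrans (Phi_vect (pmul F G))).
  apply: esym; apply: (etrans (congr2 _ (Phi_vect F) (Phi_vect G))).
  exact: (esym (phi_cat p dA (nnilp_val F) (nnilp_val G))).
- apply: bilin_eq; [by lin_tac|by lin_tac|] => F G.
  apply: (etrans (congr1 Phi (bilinext_vect (@dd_graft0 K (Hp K D)) F G))).
  apply: (etrans (Phi_vect (pgraft F G))).
  apply: esym; apply: (etrans (congr2 _ (Phi_vect F) (Phi_vect G))).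
  exact: (esym (phi_forest_graft p dA (nnilp_val F) (nnilp_val G))).
- apply: lin_eq; [by lin_tac|by lin_tac|] => F.
  apply: (etrans (congr1 _ (Phi_vect F))); apply: (etrans (Phi_half true (val F))).
  apply: (congr1 (tmap Phi Phi)); apply: esym; apply: (etrans (Hp_prec_vect K F)).
  by apply: pcutsum_eq; case.
- apply: lin_eq; [by lin_tac|by lin_tac|] => F.
  apply: (etrans (congr1 _ (Phi_vect F))); apply: (etrans (Phi_half false (val F))).
  apply: (congr1 (tmap Phi Phi)); apply: esym; apply: (etrans (Hp_succ_vect K F)).
  by apply: pcutsum_eq; case.
Qed.

Lemma homog0 n : homog (@dd_deg K A) n (0 : dd_space A).
Proof. by move=> b; rewrite -mcoeff_neq0 mcoeff0 eqxx. Qed.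

Lemma phi_homog :
  (forall t, homog (@dd_deg K A) (tree_deg (@gs_deg D) t) (phi_tree p t)) /\
  (forall F, homog (@dd_deg K A) (sumn (map (tree_deg (@gs_deg D)) F)) (phi p F)).
Proof.
have [_ _ _ [hm hg _ _]] := A_bialgebra.
apply: ptree_forest_ind => [d ts IH||t ts IHt IHts].
- rewrite phi_node; have [->|ts0] := eqVneq ts [::].
    by have -> : tree_deg (@gs_deg D) (PNode d [::]) = gs_deg d by exact: addn0.
  by have -> : nilp ts = false; [case: (ts) ts0 | apply: hg].
- exact: homog0.
rewrite phi_cons; have [->|ts0] := eqVneq ts [::].
  by have -> : sumn (map (tree_deg (@gs_deg D)) [:: t]) = tree_deg (@gs_deg D) t by exact: addn0.
by have -> : nilp ts = false; [case: (ts) ts0 | apply: hm].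
Qed.

Lemma Phi_homogeneous : dd_homogeneous Phi.
Proof. by move=> F; rewrite Phi_vect; apply: phi_homog.2. Qed.

End PlanarExtension.

Lemma coef_lin_neq0 (K : fieldType) (B C : choiceType)
    (f : {malg K[B]} -> {malg K[C]}) x c : lin f -> (f x)@_c != 0 ->
  exists2 b, b \in msupp x & (f (vect K b))@_c != 0.
Proof.
move=> fl fx0; apply: contrapT => h; move/eqP: fx0; apply.
rewrite (linE fl) raddf_sum /= big1_seq // => b /andP[_ bx].
rewrite mcoeffZ; have [->|fb0] := eqVneq (f (vect K b))@_c 0; first by rewrite mulr0.
by case: h; exists b.
Qed.

(** * Primitive elements of planar forests *)

Section PlanarPrimitives.

Variables (K : fieldType) (D : gradedSet).
Local Notation H := (dd_space (Hp K D)).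
Local Notation Dp := (@dd_prec K (Hp K D)).
Local Notation Ds := (@dd_succ K (Hp K D)).

Lemma pcutsum_nverts P F (k r : pforest D) : (pcutsum K P F)@_(k, r) != 0 ->
  (nverts (val k) + nverts (val r) = nverts F)%N.
Proof.
rewrite coef_pcutsum; apply: contra_neq_eq => neq; rewrite big1_seq // => c /andP[_ cF].
case: ifP => // _; case: eqP => // El; case: eqP => // Er.
by case/eqP: neq; rewrite -El -Er; apply: (nverts_cuts D).2.
Qed.

Lemma nverts_val_gt0 (a : pforest D) : (0 < nverts (val a))%N.
Proof. by rewrite lt0n nverts_eq0; apply: nnilp_val. Qed.

Lemma half_nverts b (x : H) n : {in msupp x, forall a, (nverts (val a) <= n)%N} ->
  {in msupp (dd_half b x), forall q, (nverts (val q.1) < n)%N && (nverts (val q.2) < n)%N}.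
Proof.
move=> xn [k r]; rewrite -mcoeff_neq0.
have hl : lin (@dd_half K (Hp K D) b) by case: b; [exact: lin_prec | exact: lin_succ].
case/(coef_lin_neq0 hl) => a /xn an h.
have E : (nverts (val k) + nverts (val r) = nverts (val a))%N.
  case: b h {hl} => h; [move: h; rewrite /dd_half Hp_prec_vect | move: h; rewrite /dd_half Hp_succ_vect];
  exact: pcutsum_nverts.
move: an; rewrite -E => an; apply/andP; split; apply: leq_trans an.
  by rewrite -addn1 leq_add2l nverts_val_gt0.
by rewrite -add1n leq_add2r nverts_val_gt0.
Qed.

Definition single (d : D) : H := fvect K [:: PNode d [::]].

Definition single_part : H -> {malg K[D]} :=
  linext (fun F : pforest D => if val F is [:: PNode d [::]] then vect K d else 0).

Lemma coef_single_part x (a : pforest D) d : val a = [:: PNode d [::]] ->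
  (linext single (single_part x))@_a = x@_a.
Proof.
move=> Ea; move: x; apply: (@lin_eq _ _ K^o) => [||F].
- apply: lin_comp (@lin_coef _ _ a) _.
  exact: lin_comp (lin_linext single) (lin_linext _).
- exact: lin_coef.
rewrite /single_part linext_vect coef_vect -(inj_eq val_inj) Ea.
case: (val F) => [|[d' [|u ts]] [|t G]];
  rewrite ?(lin0 (lin_linext single)) ?mcoeff0 //.
- by rewrite linext_vect /single coef_fvect Ea.
- by rewrite eqseq_cons andbF.
- by rewrite eqseq_cons node_eq andbF.
by rewrite eqseq_cons andbF.
Qed.

(** By [half_nverts], both factors of a term of a half-coproduct would have no vertex. *)
Lemma single_primitive d : primitive (single d).
Proof.
suff h b : dd_half b (single d) = 0 by split; [exact: (h true) | exact: (h false)].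
apply/malgP=> q; rewrite mcoeff0 mcoeff_outdom //; apply/negP.
have xn : {in msupp (single d), forall a, (nverts (val a) <= 1)%N}.
  move=> a; rewrite -mcoeff_neq0 /single coef_fvect.
  by case: (_ =P val a) => [<- _|]; rewrite ?eqxx // nverts_node.
by move/(half_nverts xn); rewrite !ltnS !leqn0 !nverts_eq0 (negbTE (nnilp_val _)).
Qed.

(** After removing the single-vertex part, the vanishing of [Ds] kills, by [Ds_single], the
    coefficients on forests ending with a bare root; [bare_free_eq0] then applies. *)
Lemma primitive_single x : primitive x -> exists w, x = linext single w.
Proof.
move=> [px sx]; exists (single_part x); apply/eqP; rewrite -subr_eq0; apply/eqP.
have zero (f : H -> dd_space2 (Hp K D)) : lin f -> f x = 0 ->
    (forall d, f (single d) = 0) -> f (x - linext single (single_part x)) = 0.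
  move=> fl fx fs; rewrite (linB fl) fx sub0r.
  suff -> : f (linext single (single_part x)) = 0 by rewrite oppr0.
  rewrite /linext (lin_sum _ _ _ fl) big1 // => d _.
  by rewrite (linZ fl) fs scaler0.
have py := zero _ (@lin_prec K (Hp K D)) px (fun d => (single_primitive d).1).
have sy := zero _ (@lin_succ K (Hp K D)) sx (fun d => (single_primitive d).2).
have E a d : val a = [:: PNode d [::]] -> (x - linext single (single_part x))@_a = 0.
  by move=> Ea; rewrite mcoeffB (coef_single_part x Ea) subrr.
move: (x - _) py sy E => y py sy E; apply: bare_free_eq0 => [a|k r _]; last first.
  by rewrite py mcoeff0.
have [G [d [ts Ea]]] := pforest_rcons a; rewrite Ea bare_rcons; case: ts Ea => // Ea _.
have [EG|G0] := eqVneq G [::]; first by apply: (E a d); rewrite Ea EG.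
have := @Ds_single _ _ y (exist (fun F => F != [::]) G G0)
  (exist (fun F => F != [::]) [:: PNode d [::]] isT) a d erefl Ea.
by rewrite sy mcoeff0.
Qed.

End PlanarPrimitives.

(** * Injectivity of the morphism *)

Section PhiInjective.

Variables (K : fieldType) (A : ddData K) (D : gradedSet) (p : D -> dd_space A).
Hypothesis A_bialgebra : graded_dupdend_bialgebra A.
Hypothesis p_prim : forall d, primitive (p d).
Hypothesis p_free : forall w, linext p w = 0 -> w = 0.

Lemma Phi_linext_single w : Phi p (linext (@single K D) w) = linext p w.
Proof.
move: w; apply: lin_eq => [||d].
- exact: lin_comp (lin_Phi p) (lin_linext _).
- exact: lin_linext.
rewrite !linext_vect; exact: (Phi_fvect p [:: PNode d [::]]).
Qed.

(** Half-coproducts of x involve only smaller forests, on which Phi ⊗ Phi is injective by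
    [tmap_inj_on]. So x is primitive, hence a combination of single vertices, and [p_free]
    concludes. *)
Lemma Phi_eq0 x : Phi p x = 0 -> x = 0.
Proof.
have [_ _ _ jp js] := Phi_morphism A_bialgebra p_prim; have jl := lin_Phi p.
move=> x0; suff h n : forall x, Phi p x = 0 ->
    {in msupp x, forall a : pforest D, (nverts (val a) < n)%N} -> x = 0.
  apply: (h (\max_(a <- msupp x) (nverts (val a)).+1) x x0) => a ax.
  exact: (@leq_bigmax_seq _ _ xpredT (fun a : pforest D => (nverts (val a)).+1) a ax).
elim: n => [|n IHn] {x0}x x0 xn.
  by apply/malgP=> a; rewrite mcoeff0 mcoeff_outdom //; apply/negP=> /xn.
pose P (a : pforest D) := (nverts (val a) < n)%N.
have inj (t : dd_space2 (Hp K D)) :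
    {in msupp t, forall q, (nverts (val q.1) < n)%N && (nverts (val q.2) < n)%N} ->
    tmap (Phi p) (Phi p) t = 0 -> t = 0.
  move=> tn; apply: (@tmap_inj_on _ _ _ _ _ P P _ _ t jl jl) => // y yn y0;
  exact: IHn y0 yn.
have px : dd_prec x = 0.
  apply: inj; first exact: (half_nverts (b := true) xn).
  by rewrite -jp x0 (lin0 (@lin_prec K A)).
have sx : dd_succ x = 0.
  apply: inj; first exact: (half_nverts (b := false) xn).
  by rewrite -js x0 (lin0 (@lin_succ K A)).
have [w Ew] := primitive_single (conj px sx).
move: x0; rewrite Ew Phi_linext_single => /p_free ->.
exact: (lin0 (lin_linext _)).
Qed.

Lemma Phi_inj : injective (Phi p).
Proof.
move=> x y E; apply/eqP; rewrite -subr_eq0; apply/eqP; apply: Phi_eq0.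
by rewrite (linB (lin_Phi p)) E subrr.
Qed.

End PhiInjective.

(** * Pairs of tensors satisfying the dendriform axioms *)

Section Cocycle.

Variables (K : fieldType) (D : gradedSet).
Local Notation H := (dd_space (Hp K D)).
Local Notation HH := (dd_space2 (Hp K D)).
Local Notation Dp := (@dd_prec K (Hp K D)).
Local Notation Ds := (@dd_succ K (Hp K D)).
Local Notation Dc := (@dd_cop K (Hp K D)).

(** The dendriform axioms with u and v in place of the two half-coproducts of an element. *)
Definition dd_cocycle (u v : HH) : Prop :=
  [/\ tmap Dp id u = tassoc (tmap id Dc u),
      tmap Ds id u = tassoc (tmap id Dp v)
    & tmap Dc id v = tassoc (tmap id Ds v)].

Lemma dd_cocycleB u v u' v' : dd_cocycle u v -> dd_cocycle u' v' ->
  dd_cocycle (u - u') (v - v').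
Proof.
have tB (f g : H -> HH) s t s' t' :
    tmap f id s = tassoc (tmap id g t) -> tmap f id s' = tassoc (tmap id g t') ->
    tmap f id (s - s') = tassoc (tmap id g (t - t')).
  move=> E E'; rewrite (linB (@lin_tmap _ _ _ _ _ f id)) E E'.
  rewrite (linB (@lin_tmap _ _ _ _ _ id g)).
  exact: (esym (linB (@lin_linext K _ _ _) _ _)).
by move=> [e1 e2 e3] [e1' e2' e3']; split; apply: tB.
Qed.

(** Puts the vertex d back after b in each term b ⊗ d, thereby inverting the reading of
    [Ds_single]. *)
Definition appendroot : HH -> H :=
  linext (fun q : pforest D * pforest D =>
    if val q.2 is [:: PNode d [::]] then fvect K (rcons (val q.1) (PNode d [::])) else 0).

Lemma coef_appendroot t (a b r : pforest D) d :
  val r = [:: PNode d [::]] -> val a = rcons (val b) (PNode d [::]) ->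
  (appendroot t)@_a = t@_(b, r).
Proof.
move=> Er Ea; move: t; apply: (@lin_eq _ _ K^o) => [||[b' r']].
- exact: lin_comp (@lin_coef _ _ a) (lin_linext _).
- exact: lin_coef.
rewrite /appendroot linext_vect coef_vect xpair_eqE -[r' == r](inj_eq val_inj) Er.
rewrite -[b' == b](inj_eq val_inj) [(b', r').1]/= [(b', r').2]/=.
case: (val r') => [|[d' [|u ts]] [|t G]]; rewrite ?mcoeff0 ?andbF //.
- by rewrite coef_fvect Ea eqseq_rcons eqseq_cons andbT.
- by rewrite eqseq_cons !andbF.
- by rewrite eqseq_cons node_eq !andbF.
by rewrite eqseq_cons !andbF.
Qed.

Lemma coef_appendroot_bare t (a : pforest D) : ~~ bare (val a) -> (appendroot t)@_a = 0.
Proof.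
move=> na; move: t; apply: (@lin_eq _ _ K^o) => [||[b' r']].
- exact: lin_comp (@lin_coef _ _ a) (lin_linext _).
- exact: lin_cst0.
rewrite /appendroot linext_vect [(b', r').1]/= [(b', r').2]/=.
case: (val r') => [|[d' [|u ts]] [|t G]]; rewrite ?mcoeff0 //.
rewrite coef_fvect; case: eqP => // Ea; move: na.
by rewrite -Ea bare_rcons.
Qed.

(** Coefficientwise, an axiom says that where the right slice at r vanishes, the relevant coproduct
    of every left slice vanishes at (k, r). Applied to bare r, this puts the left slices of u, then
    those of v, under [bare_free_eq0]. *)
Lemma cocycle_eq0 u v : dd_cocycle u v ->
  (forall k r : pforest D, bare (val r) -> u@_(k, r) = 0) ->
  (forall (k r : pforest D) d, val r = [:: PNode d [::]] -> v@_(k, r) = 0) ->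
  u = 0 /\ v = 0.
Proof.
have pl := @lin_prec K (Hp K D); have sl := @lin_succ K (Hp K D).
have cl := @lin_cop K (Hp K D).
move=> [e1 e2 e3] u0 v0.
have su0 (r : pforest D) : bare (val r) -> slice2 r u = 0.
  by move=> er; apply/malgP=> k; rewrite coef_slice2 u0 // mcoeff0.
have sv0 (r : pforest D) d : val r = [:: PNode d [::]] -> slice2 r v = 0.
  by move=> er; apply/malgP=> k; rewrite coef_slice2 (v0 k r d) // mcoeff0.
have trans (f g : H -> HH) s t b k r : lin f -> lin g ->
    tmap f id s = tassoc (tmap id g t) -> slice2 r s = 0 -> (g (slice1 b t))@_(k, r) = 0.
  move=> fl gl E s0; apply: (etrans (esym (coef_tmapr t b (k, r) gl))).
  apply: (etrans (esym (coef_tassoc _ b k r))); rewrite -E.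
  by apply: (etrans (coef_tmapl _ _ _ fl)); rewrite s0 (lin0 fl) mcoeff0.
split; apply/malgP=> -[b a]; rewrite mcoeff0 -coef_slice1.
  suff -> : slice1 b u = 0 by rewrite mcoeff0.
  have ub : bare_free (slice1 b u) by move=> r er; rewrite coef_slice1 u0.
  apply: bare_free_eq0 => // k r er.
  have := trans _ _ _ _ b k r pl cl e1 (su0 r er).
  (* The first axiom controls the sum of the half-coproducts; its [Ds] part is zero by
     [Ds_bare_free], which leaves [Dp]. *)
  by rewrite /dd_cop mcoeffD [X in _ + X](Ds_bare_free _ ub) // addr0.
suff -> : slice1 b v = 0 by rewrite mcoeff0.
apply: bare_free_eq0 => [r|k r er]; last first.
  have := trans _ _ _ _ b k r sl pl e2 (su0 r er); exact: id.
have [G [d [ts Er]]] := pforest_rcons r; rewrite Er bare_rcons; case: ts Er => // Er _.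
have [EG|G0] := eqVneq G [::].
  by rewrite coef_slice1 (v0 b r d) // Er EG.
pose g : pforest D := exist (fun F => F != [::]) G G0.
pose s : pforest D := exist (fun F => F != [::]) [:: PNode d [::]] isT.
have Es : val s = [:: PNode d [::]] by [].
(* Splitting off the last vertex d turns the coefficient into one of [Ds] with right factor d; the
   third axiom relates it to the right slice of v at d, which is zero. *)
rewrite -(@Ds_single _ _ (slice1 b v) g s r d Es Er).
have := trans _ _ _ _ b g s cl sl e3 (sv0 s d Es); exact: id.
Qed.

Hypothesis Hp_dendriform : dendriform_coalgebra (Hp K D).

Lemma cocycle_coboundary u v : dd_cocycle u v -> exists y, Dp y = u /\ Ds y = v.
Proof.
(* Up to single vertices, which do not affect half-coproducts, the right-hand side is the value that
   [Tlast y] has if u and v are the half-coproducts of y. *)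
move=> uv; have [y Ty] := Tlast_onto (appendroot v + regrow u); exists y.
have [d1 d2 d3] := (dendriformP _).1 Hp_dendriform.
have dy : dd_cocycle (u - Dp y) (v - Ds y).
  exact: (dd_cocycleB uv (And3 (d1 y) (d2 y) (d3 y))).
(* On each a, only one summand of each side survives: the [regrow] terms if the last tree of a has
   other vertices than its root, the other two if it is bare. *)
have Ta (a : pforest D) : (barepart y)@_a + (regrow (Dp y))@_a = (appendroot v)@_a + (regrow u)@_a.
  exact: (etrans (esym (mcoeffD _ _ _)) (etrans (congr1 (mcoeff a) Ty) (mcoeffD _ _ _))).
have sumE (q n1 n2 n3 z x : K) : q = 0 -> n1 = z -> n2 = 0 -> n3 = x ->
    q + n1 = n2 + n3 -> x = z.
  by move=> -> -> -> ->; rewrite !add0r.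
have sumE' (q n1 n2 n3 z x : K) : q = z -> n1 = 0 -> n2 = x -> n3 = 0 ->
    q + n1 = n2 + n3 -> z = x.
  by move=> -> -> -> ->; rewrite !addr0.
suff [u0 v0] : u - Dp y = 0 /\ v - Ds y = 0.
  exact: (conj (esym (subr0_eq u0)) (esym (subr0_eq v0))).
apply: (cocycle_eq0 dy) => [k r er|b r d Er]; apply: (etrans (mcoeffB _ _ _));
  apply/eqP; rewrite subr_eq0; apply/eqP.
  have [G [d [ts Er]]] := pforest_rcons r.
  have ts0 : ts = [::] by move: er; rewrite Er bare_rcons; case: (ts).
  subst ts.
  have R0 : rcons G (PNode d (val k)) != [::] by case: (G).
  pose a : pforest D := exist (fun F => F != [::]) _ R0.
  have na : bare (val a) = false.
    by rewrite bare_rcons; apply: negbTE; apply: nnilp_val.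
  have Ea : val a = rcons G (PNode d (val k)) by [].
  have q0 : (barepart y)@_a = 0 by rewrite coef_barepart na.
  exact: (sumE _ _ _ _ _ _ q0 (coef_regrow _ Ea Er) (coef_appendroot_bare v (negbT na))
    (coef_regrow _ Ea Er) (Ta a)).
have R0 : rcons (val b) (PNode d [::]) != [::] by case: (val b).
pose a : pforest D := exist (fun F => F != [::]) _ R0.
have ea : bare (val a) by rewrite bare_rcons.
have Ea : val a = rcons (val b) (PNode d [::]) by [].
have qa : (barepart y)@_a = (Ds y)@_(b, r) by rewrite coef_barepart ea (Ds_single y Er Ea).
apply: esym.
exact: (sumE' _ _ _ _ _ _ qa (coef_regrow_bare _ ea) (coef_appendroot v Er Ea)
  (coef_regrow_bare _ ea) (Ta a)).
Qed.

End Cocycle.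

(** * Surjectivity of the morphism and the isomorphism *)

Section Rigidity.

Variables (K : fieldType) (A : ddData K) (rk : dd_basis A -> nat).
Hypotheses (A_bialgebra : graded_dupdend_bialgebra A) (rk_inj : injective rk).
Hypothesis deg_gt0 : forall b : dd_basis A, (0 < dd_deg b)%N.
Local Notation D := (prim_set rk).
Local Notation Phi := (Phi (@pvec K A rk)).
Local Notation H := (dd_space (Hp K D)).

Lemma pvec_prim (d : D) : primitive (pvec d).
Proof. by have [] := pvecP d. Qed.

Lemma pvec_homog (d : D) : homog (@dd_deg K A) (gs_deg d) (pvec d).
Proof. by have [] := pvecP d. Qed.

Local Notation jm := (Phi_morphism A_bialgebra pvec_prim).
Local Notation jh := (Phi_homogeneous A_bialgebra pvec_homog).
Local Notation jinj := (Phi_inj A_bialgebra pvec_prim (pvec_inj rk_inj)).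

Lemma Hp_prim_bialgebra : graded_dupdend_bialgebra (Hp K D).
Proof. exact: transport_dupdend jm jinj jh A_bialgebra. Qed.

Lemma primitive_homog_onto n (x : dd_space A) : primitive x ->
  homog (@dd_deg K A) n x -> exists w, Phi w = x.
Proof.
move=> px hx; have [|w Ew] := @pvec_span K A rk rk_inj n
  (\max_(b <- msupp x) (rk b).+1) x px hx.
  move=> b bx; exact: (@leq_bigmax_seq _ _ xpredT (fun b => (rk b).+1) b bx).
by exists (linext (@single K D) w); rewrite Phi_linext_single.
Qed.

Lemma primitive_hcomp n (x : dd_space A) :
  primitive x -> primitive (hcomp (@dd_deg K A) n x).
Proof.
have [_ _ _ [_ _ hp hs]] := A_bialgebra; case=> px sx.
have vh b : homog (@dd_deg K A) (dd_deg b) (vect K b) by exact: homog_vect.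
have h0 : hcomp (@dd_deg2 K A) n (0 : dd_space2 A) = 0.
  exact: (lin0 (@lin_hcomp K _ (@dd_deg2 K A) n)).
split.
  rewrite -(hcomp_lin (@lin_prec K A) (fun b => hp _ _ (vh b))).
  by rewrite px h0.
rewrite -(hcomp_lin (@lin_succ K A) (fun b => hs _ _ (vh b))).
by rewrite sx h0.
Qed.

Lemma tmap_Phi_onto n t : homog (@dd_deg2 K A) n t ->
  (forall b : dd_basis A, (dd_deg b < n)%N -> exists y, Phi y = vect K b) ->
  exists u, tmap Phi Phi u = t.
Proof.
move=> ht IH; apply: lin_onto; first exact: lin_tmap.
case=> b c /ht; rewrite /dd_deg2 /= => En.
have [|y Ey] := IH b; first by rewrite -En -addn1 leq_add2l deg_gt0.
have [|z Ez] := IH c; first by rewrite -En -add1n leq_add2r deg_gt0.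
exists (y ⊗ z); have jl := @lin_Phi K A D (@pvec K A rk).
rewrite (tmap_tens y z jl jl).
by rewrite Ey Ez tens_vect.
Qed.

Lemma Phi_cocycle x u v :
  tmap Phi Phi u = dd_prec x -> tmap Phi Phi v = dd_succ x ->
  dd_cocycle u v.
Proof.
move=> Eu Ev; have [_ /dendriformP[d1 d2 d3] _ _] := A_bialgebra.
have [jl _ _ jp js] := jm; have jc := tmap_cop jm.
have i2 : injective (tmap Phi Phi) by apply: tmap_inj => //; exact: jinj.
have i3 : injective (tmap (tmap Phi Phi) Phi).
  by apply: tmap_inj => //; [exact: lin_tmap | exact: jinj].
have step f g f' g' s t :
    lin f -> lin f' -> (forall z, f' (Phi z) = tmap Phi Phi (f z)) ->
    lin g -> lin g' -> (forall z, g' (Phi z) = tmap Phi Phi (g z)) ->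
    tmap f' id (tmap Phi Phi s) = tassoc (tmap id g' (tmap Phi Phi t)) ->
    tmap f id s = tassoc (tmap id g t).
  move=> fl fl' fE gl gl' gE E; apply: i3.
  apply: (etrans (tmap3_left jm s fl fl' fE)); apply: (etrans E).
  exact: (esym (tmap3_right jm t gl gl' gE)).
have pl := @lin_prec K (Hp K D); have sl := @lin_succ K (Hp K D).
have cl := @lin_cop K (Hp K D).
have pl' := @lin_prec K A; have sl' := @lin_succ K A; have cl' := @lin_cop K A.
split.
- by apply: (step _ _ _ _ _ _ pl pl' jp cl cl' jc); rewrite Eu; exact: d1.
- by apply: (step _ _ _ _ _ _ sl sl' js pl pl' jp); rewrite Eu Ev; exact: d2.
by apply: (step _ _ _ _ _ _ cl cl' jc sl sl' js); rewrite Ev; exact: d3.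
Qed.

Lemma Phi_onto_vect (b : dd_basis A) : exists y, Phi y = vect K b.
Proof.
have [n] := ubnP (dd_deg b); elim: n b => // n IHn b; rewrite ltnS => le_n.
have [_ _ _ [_ _ hp hs]] := A_bialgebra.
have [jl _ _ jp js] := jm.
have vh : homog (@dd_deg K A) (dd_deg b) (vect K b) by exact: homog_vect.
have IH (c : dd_basis A) : (dd_deg c < dd_deg b)%N -> exists y, Phi y = vect K c.
  by move=> lt_c; apply: IHn; apply: leq_trans lt_c le_n.
have [u Eu] := tmap_Phi_onto (hp _ _ vh) IH.
have [v Ev] := tmap_Phi_onto (hs _ _ vh) IH.
have [_ dH _ _] := Hp_prim_bialgebra.
have [y [py sy]] := cocycle_coboundary dH (Phi_cocycle Eu Ev).
have px : primitive (vect K b - Phi y).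
  split.
    apply: (etrans (linB (@lin_prec K A) _ _)).
    by rewrite jp py Eu subrr.
  apply: (etrans (linB (@lin_succ K A) _ _)).
  by rewrite js sy Ev subrr.
(* The element y, obtained from arbitrary preimages, need not be homogeneous, so the remainder is
   projected to the degree of b before [primitive_homog_onto] is applied; the same component of y
   then completes the preimage. *)
have [w Ew] := primitive_homog_onto (primitive_hcomp (dd_deg b) px)
  (@homog_hcomp K _ _ _ _).
exists (w + hcomp (@dd_deg K (Hp K D)) (dd_deg b) y).
rewrite (linD jl) Ew -(hcomp_lin jl jh) -(linD (@lin_hcomp K _ _ _)) subrK.
exact/homogP.
Qed.

Definition Psi : dd_space A -> H :=
  linext (fun b => projT1 (cid (Phi_onto_vect b))).

Lemma PhiK x : Phi (Psi x) = x.
Proof.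
have jl := @lin_Phi K A D (@pvec K A rk).
move: x; apply: lin_eq => [||b]; first exact: lin_comp jl (lin_linext _).
  exact: lin_id.
by rewrite /Psi linext_vect; exact: (projT2 (cid (Phi_onto_vect b))).
Qed.

Lemma PsiK x : Psi (Phi x) = x.
Proof. by apply: jinj; rewrite PhiK. Qed.

Lemma lin_Psi : lin Psi. Proof. exact: lin_linext. Qed.

Lemma tmap_Psi (f : H -> dd_space2 (Hp K D)) (g : dd_space A -> dd_space2 A) x :
  (forall z, g (Phi z) = tmap Phi Phi (f z)) ->
  f (Psi x) = tmap Psi Psi (g x).
Proof.
move=> fg; have jl := @lin_Phi K A D (@pvec K A rk).
have i2 : injective (tmap Phi Phi) by apply: tmap_inj => //; exact: jinj.
apply: i2; rewrite -fg PhiK (tmap_comp Psi Psi _ jl jl).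
apply: (etrans (esym (tmap_id (g x)))); apply: eq_tmap => z; exact: (esym (PhiK z)).
Qed.

Theorem rigidity : isomorphic_graded_dupdend A (Hp K D).
Proof.
have [jl jmul jgr jp js] := jm.
split; [exact: A_bialgebra | exact: Hp_prim_bialgebra |].
pose psi : {linear dd_space A -> H} :=
  HB.pack Psi (GRing.isLinear.Build K (dd_space A) H *:%R Psi lin_Psi).
exists psi; split.
- by exists Phi; [exact: PhiK | exact: PsiK].
- move=> n x hx; apply: (homog_lin_inj jl jinj jh).
  by have -> : Phi (psi x) = x by exact: PhiK.
- move=> x y; split; apply: jinj.
    apply: (etrans (PhiK _)); apply: esym; apply: (etrans (jmul _ _)).
    exact: (congr2 _ (PhiK x) (PhiK y)).
  apply: (etrans (PhiK _)); apply: esym; apply: (etrans (jgr _ _)).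
  exact: (congr2 _ (PhiK x) (PhiK y)).
by move=> x; split; [exact: (tmap_Psi x jp) | exact: (tmap_Psi x js)].
Qed.

End Rigidity.

(** Any injective numbering of the basis can serve as [rk]; countability of the type of parent
    functions provides this one. *)
Definition oforest_code (F : oforest) : nat :=
  choice.pickle (Tagged (fun n => {ffun 'I_n.+1 -> option 'I_n.+1}) (tagged (val F))).

Lemma oforest_code_inj : injective oforest_code.
Proof.
move=> F G /(pcan_inj (@choice.pickleK _)) E; apply: val_inj.
by case: (val F) (val G) E => m f [n g].
Qed.

Theorem theorem23 (K : fieldType) :
  (exists Do : gradedSet, isomorphic_graded_dupdend (Ho K) (Hp K Do)) /\
  (exists Dho : gradedSet, isomorphic_graded_dupdend (Hho K) (Hp K Dho)).
Proof.
split.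
  exists (prim_set (A := Ho K) oforest_code).
  exact: rigidity (Ho_bialgebra K) oforest_code_inj _.
exists (prim_set (A := Hho K) (fun F : hoforest => oforest_code (val F))).
by apply: rigidity (Hho_bialgebra K) _ _ => // F G /oforest_code_inj /val_inj.
Qed.
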